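(* Suppose Assumptions (A3) and (A6) hold. Fix $\gamma_0\in(0,a_0)$ and suppose $\delta\in\big[0,\min\{a_0-\gamma_0,\frac{1-e^{-\omega}}{2M}\}\big)$. Let $\vartheta=\frac{1-2\sigma\gamma_0}{e^{-\omega}+2\delta\sigma}$. Then there exist $N_0\in\mathbb{N}$ and $C_1\in(0,\infty)$ such that for all $\varepsilon>0$: if $d>1$, $$P[\mathcal{W}_1(\mu_n^N,\mu_n)>\varepsilon]\le P[\mathcal{W}_1(\mu_0^N,\mu_0)>2\sigma\gamma_0\vartheta^n\varepsilon]+e^{-C_1\varepsilon N^{1/(d+2)}}$$ for all $n\ge0$ and $N\ge N_0\max\{(\frac1\varepsilon\log^+\frac1\varepsilon)^{d+2},\varepsilon^{(d+2)/(d-1)}\}$; and if $d=1$, $$P[\mathcal{W}_1(\mu_n^N,\mu_n)>\varepsilon]\le P[\mathcal{W}_1(\mu_0^N,\mu_0)>2\sigma\gamma_0\vartheta^n\varepsilon]+e^{-C_1(\varepsilon\wedge1)N^{1/(d+2)}}$$ for all $n\ge0$ and $N\ge N_0\max\{(\frac1\varepsilon\log^+\frac1\varepsilon)^{d+2},1\}$.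
   Context: Setting. Fix integers $d,m\ge1$, a real $d\times d$ matrix $A$ with operator norm $\|A\|$, $\delta\ge0$, a Borel probability measure $\theta$ on $\mathbb{R}^m$, and a measurable $f:\mathbb{R}^d\times\mathcal{P}_1(\mathbb{R}^d)\times\mathbb{R}^m\to\mathbb{R}^d$. $\mathcal{P}_1(\mathbb{R}^d)$: Borel probability measures on $\mathbb{R}^d$ with finite first moment, with the Wasserstein-1 distance $\mathcal{W}_1(\mu,\nu)=\inf E|X-Y|$ over couplings. Particle system: for each $N\ge1$, $\{X_0^{i,N}\}_{i=1}^N$ are exchangeable, each with law $\mu_0\in\mathcal{P}_1(\mathbb{R}^d)$; $\{\epsilon_n^i\}_{i,n\ge1}$ i.i.d. with law $\theta$, independent of the initial conditions; $X_{n+1}^{i,N}=AX_n^{i,N}+\delta f(X_n^{i,N},\mu_n^N,\epsilon_{n+1}^i)$, $\mu_n^N=\frac1N\sum_{i=1}^N\delta_{X_n^{i,N}}$. Nonlinear evolution: $\Psi(\mu)$ is the law of $AX+\delta f(X,\mu,\epsilon)$ with $(X,\epsilon)\sim\mu\otimes\theta$, and $\mu_{n+1}=\Psi(\mu_n)$. $D(z):=\sup\frac{|f(x_1,\mu_1,z)-f(x_2,\mu_2,z)|}{|x_1-x_2|+\mathcal{W}_1(\mu_1,\mu_2)}$ (supremum over $(x_1,\mu_1)\neq(x_2,\mu_2)$), $D_1(z):=|f(0,\delta_0,z)|$, $\sigma:=\int D\,d\theta$, $a_0:=\frac{1-e^{-\omega}}{2\sigma}$, $\log^+x=\max\{\log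 x,0\}$. (A3): $\|A\|\le e^{-\omega}$ for some $\omega>0$. (A6): (i) for some $M\in(1,\infty)$, $D(z)\le M$ for $\theta$-a.e. $z$; (ii) there is $\alpha>0$ with $\int e^{\alpha|x|}\mu_0(dx)<\infty$ and $\int e^{\alpha D_1(z)}\theta(dz)<\infty$. *)

(* Defs.v *)
From HB Require Import structures.
From mathcomp Require Import all_boot all_order all_algebra.
From mathcomp Require Import all_classical all_reals all_analysis.
From mathcomp Require Import giry perm.
Set Implicit Arguments. Unset Strict Implicit. Unset Printing Implicit Defensive.
Import Order.TTheory GRing.Theory Num.Theory.
Local Open Scope classical_set_scope.
Local Open Scope ring_scope.

(* R^k is represented by k.-tuple R, which MathComp-Analysis equips with the
   product (= Borel) sigma-algebra. *)
Notation vec R k := (k.-tuple R).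

Definition vzero (R : realType) (k : nat) : vec R k := [tuple (0:R) | i < k].
Definition vadd (R : realType) (k : nat) (x y : vec R k) : vec R k :=
  [tuple tnth x i + tnth y i | i < k].
Definition vsub (R : realType) (k : nat) (x y : vec R k) : vec R k :=
  [tuple tnth x i - tnth y i | i < k].
Definition vscale (R : realType) (k : nat) (c : R) (x : vec R k) : vec R k :=
  [tuple c * tnth x i | i < k].
Definition mxact (R : realType) (k : nat) (A : 'M[R]_k) (x : vec R k) : vec R k :=
  [tuple \sum_(j < k) A i j * tnth x j | i < k].
Definition enorm (R : realType) (k : nat) (x : vec R k) : R :=
  Num.sqrt (\sum_(i < k) tnth x i ^+ 2).

Definition logp (R : realType) (x : R) : R := Num.max (ln x) 0.

Local Open Scope ereal_scope.

(* Empirical measure (1/N) sum_{i<N} delta_{x i}  (for N = 0 it is an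
   irrelevant default, namely delta_0; only N >= 1 is ever used). *)
Definition empirical (R : realType) (k N : nat) (x : nat -> vec R k)
  : probability (vec R k) R :=
  mnormalize (msum (fun i => @dirac _ (vec R k) (x i) R) N) (\d_(vzero R k)).

Definition coupling (R : realType) (k : nat)
  (mu nu : set (vec R k) -> \bar R) (pi : probability (vec R k * vec R k)%type R) : Prop :=
  (forall A : set (vec R k), measurable A -> pi (A `*` setT) = mu A) /\
  (forall A : set (vec R k), measurable A -> pi (setT `*` A) = nu A).

Definition W1 (R : realType) (k : nat) (mu nu : set (vec R k) -> \bar R) : \bar R :=
  ereal_inf [set \int[pi]_p (enorm (vsub p.1 p.2))%:E |
              pi in [set pi | coupling mu nu pi]].

Definition finite_first_moment (R : realType) (k : nat)
  (mu : probability (vec R k) R) : Prop :=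
  \int[mu]_x (enorm x)%:E < +oo.

Definition meas_eq (R : realType) (k : nat) (mu nu : set (vec R k) -> \bar R) : Prop :=
  forall A, measurable A -> mu A = nu A.

Definition Dlip (R : realType) (d m : nat)
  (f : vec R d -> giry (vec R d) R -> vec R m -> vec R d) (z : vec R m) : \bar R :=
  ereal_sup [set r : \bar R | exists (x1 x2 : vec R d)
                (mu1 mu2 : probability (vec R d) R),
     [/\ finite_first_moment mu1, finite_first_moment mu2,
         (x1 <> x2 \/ ~ meas_eq mu1 mu2) &
         r = ((enorm (vsub (f x1 mu1 z) (f x2 mu2 z))
               / (enorm (vsub x1 x2) + fine (W1 mu1 mu2)))%R)%:E]].

(* The particle system
     X_{n+1}^{i,N} = A X_n^{i,N} + delta f(X_n^{i,N}, mu_n^N, eps_{n+1}^i),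
   with indices shifted to start at 0:  X N n i  (particle i < N, time n),
   initial conditions X0 N i, noises eps n i  (eps n i plays eps_{n+1}^{i+1}). *)
Fixpoint particle (R : realType) (d m : nat) (Omega : Type)
  (A : 'M[R]_d) (delta : R)
  (f : vec R d -> giry (vec R d) R -> vec R m -> vec R d)
  (X0 : nat -> nat -> Omega -> vec R d) (eps : nat -> nat -> Omega -> vec R m)
  (N n i : nat) (w : Omega) : vec R d :=
  match n with
  | 0 => X0 N i w
  | n'.+1 =>
      let y := fun j => particle A delta f X0 eps N n' j w in
      vadd (mxact A (y i)) (vscale delta (f (y i) (empirical N y) (eps n' i w)))
  end.

Definition emp_particles (R : realType) (d m : nat) (Omega : Type)
  (A : 'M[R]_d) (delta : R)
  (f : vec R d -> giry (vec R d) R -> vec R m -> vec R d)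
  (X0 : nat -> nat -> Omega -> vec R d) (eps : nat -> nat -> Omega -> vec R m)
  (N n : nat) (w : Omega) : probability (vec R d) R :=
  empirical N (fun j => particle A delta f X0 eps N n j w).

Definition exchangeable_init (R : realType) (d : nat) (d0 : measure_display)
  (Omega : measurableType d0) (P : probability Omega R)
  (X0 : nat -> nat -> Omega -> vec R d) : Prop :=
  forall (N : nat) (s : {perm 'I_N}) (B : set (N.-tuple (vec R d))),
    measurable B ->
    P [set w | B [tuple X0 N i w | i < N]] =
    P [set w | B [tuple X0 N (s i) w | i < N]].

(* {eps n i}_{n,i} are i.i.d. with law theta and the whole family is independent
   of the family of initial conditions {X0 N i}_{i < N}: product rule on all
   finite-dimensional cylinder events. *)
Definition iid_indep_noise (R : realType) (d m : nat) (d0 : measure_display)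
  (Omega : measurableType d0) (P : probability Omega R)
  (theta : probability (vec R m) R)
  (X0 : nat -> nat -> Omega -> vec R d) (eps : nat -> nat -> Omega -> vec R m) : Prop :=
  forall (F : seq (nat * nat)) (Aset : nat * nat -> set (vec R m))
         (G : seq (nat * nat)) (B : nat * nat -> set (vec R d)),
    uniq F -> (forall k, measurable (Aset k)) ->
    all (fun k => (k.2 < k.1)%N) G -> (forall k, measurable (B k)) ->
    P ([set w | forall k, k \in F -> Aset k (eps k.1 k.2 w)] `&`
       [set w | forall k, k \in G -> B k (X0 k.1 k.2 w)]) =
    (\prod_(k <- F) theta (Aset k)) *
    P [set w | forall k, k \in G -> B k (X0 k.1 k.2 w)].

(* mu_{n+1} = Psi(mu_n): law of A X + delta f(X, mu_n, eps), (X, eps) ~ mu_n (x) theta *)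
Definition nonlinear_evolution (R : realType) (d m : nat)
  (A : 'M[R]_d) (delta : R)
  (f : vec R d -> giry (vec R d) R -> vec R m -> vec R d)
  (theta : probability (vec R m) R) (mu : nat -> probability (vec R d) R) : Prop :=
  forall (n : nat) (S : set (vec R d)), measurable S ->
    mu n.+1 S =
    \int[mu n]_x theta [set z | S (vadd (mxact A x) (vscale delta (f x (mu n) z)))].

Definition sigmaD (R : realType) (d m : nat)
  (f : vec R d -> giry (vec R d) R -> vec R m -> vec R d)
  (theta : probability (vec R m) R) : R :=
  fine (\int[theta]_z Dlip f z).

Definition a0 (R : realType) (omega sigma : R) : \bar R :=
  if sigma == 0%R then +oo else ((1 - expR (- omega)) / (2 * sigma))%:E.

(* Main.v *)
(** Write [V_n] for the distance between the empirical measure and [mu n]. Given the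
    particles at time [n], the empirical measure at time [n+1] is compared, through
    finitely many cells of a ball, with its conditional mean, i.e. the image of the
    empirical measure under the nonlinear evolution; the latter is a contraction of
    ratio [chi = e^-omega + 2 delta sigma < 1]. Hence [V_(n+1) <= chi V_n + r_n],
    where [r_n] is small unless a particle or a noise leaves the ball (exponential
    moments, uniform in time by convexity) or some union of cells is missed
    (Hoeffding and a union bound over the [2^(cells)] unions, costing [N^(d/(d+2))]
    in the exponent). Unrolling the recursion with error budgets growing
    geometrically backwards in time keeps the total failure probability independent
    of [n], and [s (1 - s)^n <= 1/4] with [s = 2 sigma gamma0 = 1 - chi vartheta]
    absorbs the initial term. *)

Require Import Defs.
From HB Require Import structures.
From mathcomp Require Import all_boot all_order all_algebra.
From mathcomp Require Import all_classical all_reals all_analysis giry perm.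
From mathcomp Require Import measurable_realfun ring lra.
Import Order.TTheory GRing.Theory Num.Theory.
Local Open Scope classical_set_scope.
Local Open Scope ring_scope.

Set Implicit Arguments.
Unset Strict Implicit.
Unset Printing Implicit Defensive.

(** * Euclidean vectors *)

(** All scales are powers of $y = N^{1/(d+2)}$. The ball radius is of order $\varepsilon y$ and each
    axis is cut into about $y$ intervals, so the mesh is of order $\varepsilon$; a tolerated
    deviation of order $1/y$ per union of cells, times the radius, again costs order $\varepsilon$.
    With that tolerance the Hoeffding exponent $N/y^2 = y^d$ has the order of the number of cells,
    which makes the union bound affordable, and the exponential tail at radius $\varepsilon y$ gives
    the rate $e^{-C\varepsilon N^{1/(d+2)}}$. The Hoeffding term stays below this rate only if
    $\varepsilon y\le y^d$: hence the threshold $\varepsilon^{(d+2)/(d-1)}$ for $d>1$ and the cap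
    $\varepsilon\wedge1$ for $d=1$. The logarithmic threshold absorbs the factor $N$ of the union
    bound over particles. Two measure-theoretic obstacles shape the proof. Couplings are composed
    without disintegration, by exchanging mass only at the level of cells; and conditioning on the
    past is replaced by a $\pi$-system of cylinders that leave out one noise variable, which Tonelli
    then integrates out with the rest frozen. *)

Section l2.
Context {R : realType} {I : finType}.
Implicit Types a b : I -> R.

Lemma l2_cauchy_schwarz a b :
  \sum_i a i * b i <= Num.sqrt (\sum_i a i ^+ 2) * Num.sqrt (\sum_i b i ^+ 2).
Proof.
have a0 : 0 <= \sum_i a i ^+ 2 by apply: sumr_ge0 => i _; exact: sqr_ge0.
have b0 : 0 <= \sum_i b i ^+ 2 by apply: sumr_ge0 => i _; exact: sqr_ge0.
have zero c e : \sum_i c i ^+ 2 = 0 -> \sum_i c i * e i = 0 :> R.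
  move=> /psumr_eq0P h; apply: big1 => i _.
  have /eqP : c i ^+ 2 = 0 by apply: h => // j _; exact: sqr_ge0.
  by rewrite sqrf_eq0 => /eqP ->; rewrite mul0r.
have [/zero az|an0] := eqVneq (\sum_i a i ^+ 2) 0.
  by rewrite az mulr_ge0// sqrtr_ge0.
have [/zero bz|bn0] := eqVneq (\sum_i b i ^+ 2) 0.
  by under eq_bigr do rewrite mulrC; rewrite bz mulr_ge0// sqrtr_ge0.
set s := Num.sqrt _; set t := Num.sqrt (\sum_i b i ^+ 2).
have s0 : 0 < s by rewrite sqrtr_gt0 lt_neqAle eq_sym an0.
have t0 : 0 < t by rewrite sqrtr_gt0 lt_neqAle eq_sym bn0.
(* Weighted arithmetic-geometric mean; with these weights the right side sums to exactly [s * t]. *)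
have : \sum_i a i * b i <= \sum_i (a i ^+ 2 * (t / s) + b i ^+ 2 * (s / t)) / 2.
  apply: ler_sum => i _.
  have : 0 <= (a i * t - b i * s) ^+ 2 / (s * t).
    by rewrite divr_ge0 ?sqr_ge0// mulr_ge0// ltW.
  have -> : (a i * t - b i * s) ^+ 2 / (s * t) =
    (a i ^+ 2 * (t / s) + b i ^+ 2 * (s / t)) - 2 * (a i * b i).
    by field; rewrite !gt_eqF.
  by rewrite subr_ge0; lra.
rewrite -mulr_suml big_split/= -!mulr_suml => /le_trans; apply.
rewrite -(sqr_sqrtr a0) -(sqr_sqrtr b0) -/s -/t.
rewrite [leLHS](_ : _ = s * t)//; field; by rewrite !gt_eqF.
Qed.

Lemma l2_triangle a b : Num.sqrt (\sum_i (a i + b i) ^+ 2) <=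
  Num.sqrt (\sum_i a i ^+ 2) + Num.sqrt (\sum_i b i ^+ 2).
Proof.
have a0 : 0 <= \sum_i a i ^+ 2 by apply: sumr_ge0 => i _; exact: sqr_ge0.
have b0 : 0 <= \sum_i b i ^+ 2 by apply: sumr_ge0 => i _; exact: sqr_ge0.
rewrite -(ler_pXn2r (ltn0Sn 1)) ?nnegrE ?addr_ge0 ?sqrtr_ge0//.
rewrite sqrrD !sqr_sqrtr//; last by apply: sumr_ge0 => i _; exact: sqr_ge0.
under eq_bigr do rewrite sqrrD.
rewrite 2!big_split/= lerD2r lerD2l sumrMnl.
by rewrite ler_wMn2r// l2_cauchy_schwarz.
Qed.

End l2.

Section vectors.
Context {R : realType} {k : nat}.
Implicit Types x y z : vec R k.

Lemma eq_enorm x y : (forall i, tnth x i ^+ 2 = tnth y i ^+ 2) ->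
  enorm x = enorm y.
Proof. by move=> xy; rewrite /enorm; under eq_bigr do rewrite xy. Qed.

Lemma enorm_ge0 x : 0 <= enorm x.
Proof. exact: sqrtr_ge0. Qed.

Lemma enorm0 : enorm (vzero R k) = 0.
Proof.
rewrite /enorm big1 ?sqrtr0// => i _.
by rewrite tnth_mktuple expr0n.
Qed.

Lemma enorm_vadd x y : enorm (vadd x y) <= enorm x + enorm y.
Proof.
rewrite /enorm; under eq_bigr do rewrite tnth_mktuple; exact: l2_triangle.
Qed.

Lemma enorm_vsubC x y : enorm (vsub x y) = enorm (vsub y x).
Proof.
by apply: eq_enorm => i; rewrite !tnth_mktuple -sqrrN opprB.
Qed.

Lemma vsubxx x : vsub x x = vzero R k.
Proof. by apply: eq_from_tnth => i; rewrite !tnth_mktuple subrr. Qed.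

Lemma vsubx0 x : vsub x (vzero R k) = x.
Proof. by apply: eq_from_tnth => i; rewrite !tnth_mktuple subr0. Qed.

Lemma enorm_vsubxx x : enorm (vsub x x) = 0.
Proof. by rewrite vsubxx enorm0. Qed.

Lemma vsubK x y : vadd (vsub x y) y = x.
Proof. by apply: eq_from_tnth => i; rewrite !tnth_mktuple subrK. Qed.

Lemma enorm_le_vsub x y : enorm x <= enorm (vsub x y) + enorm y.
Proof. by rewrite -[in leLHS](vsubK x y) enorm_vadd. Qed.

Lemma enorm_triangle x y z :
  enorm (vsub x z) <= enorm (vsub x y) + enorm (vsub y z).
Proof.
suff -> : vsub x z = vadd (vsub x y) (vsub y z) by exact: enorm_vadd.
by apply: eq_from_tnth => i; rewrite !tnth_mktuple addrA subrK.
Qed.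

Lemma enorm_vsub_le x y : enorm (vsub x y) <= enorm x + enorm y.
Proof.
have := enorm_triangle x (vzero R k) y.
by rewrite vsubx0 (enorm_vsubC (vzero R k)) vsubx0.
Qed.

Lemma enorm_vscale (c : R) x : enorm (vscale c x) = `|c| * enorm x.
Proof.
rewrite /enorm; under eq_bigr do rewrite tnth_mktuple exprMn.
by rewrite -mulr_sumr sqrtrM ?sqr_ge0// sqrtr_sqr.
Qed.

Lemma enorm_le_sum x : enorm x <= \sum_i `|tnth x i|.
Proof.
have s0 : 0 <= \sum_i `|tnth x i| by exact: sumr_ge0.
rewrite -(ler_pXn2r (ltn0Sn 1)) ?nnegrE ?sqrtr_ge0//.
rewrite sqr_sqrtr; last by apply: sumr_ge0 => i _; exact: sqr_ge0.
rewrite [leRHS]expr2 mulr_suml; apply: ler_sum => i _.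
rewrite -real_normK ?num_real// expr2 ler_wpM2l//.
by rewrite (bigD1 i)//= lerDl sumr_ge0.
Qed.

Lemma le_coord_enorm x i : `|tnth x i| <= enorm x.
Proof.
rewrite -sqrtr_sqr ler_wsqrtr// (bigD1 i)//= lerDl.
by apply: sumr_ge0 => j _; exact: sqr_ge0.
Qed.

Lemma vsub_eq0 x y : enorm (vsub x y) = 0 -> x = y.
Proof.
move=> xy0; apply: eq_from_tnth => i.
have := le_coord_enorm (vsub x y) i.
by rewrite xy0 normr_le0 tnth_mktuple subr_eq0 => /eqP.
Qed.

Lemma vsub_affine (A : 'M[R]_k) (c : R) x y u v :
  vsub (vadd (mxact A x) (vscale c u)) (vadd (mxact A y) (vscale c v)) =
  vadd (mxact A (vsub x y)) (vscale c (vsub u v)).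
Proof.
apply: eq_from_tnth => i; rewrite !tnth_mktuple mulrBr opprD addrACA.
congr (_ + _).
by rewrite -sumrB; apply: eq_bigr => j _; rewrite tnth_mktuple mulrBr.
Qed.

(** Positive dimension enters here. The point [y] makes the supremum in [Dlip] nonempty, and serves
    as a detour when two arguments of [f] are at distance zero. *)
Lemma exists_close_neq x (e : R) : (0 < k)%N -> 0 < e ->
  exists2 y, x <> y & enorm (vsub x y) <= e.
Proof.
move=> k0 e0; exists [tuple tnth x i + (if i == Ordinal k0 then e else 0) | i < k].
  move=> /(congr1 (fun t => tnth t (Ordinal k0))).
  by rewrite tnth_mktuple eqxx => /eqP; rewrite -subr_eq0 opprD addNKr oppr_eq0 gt_eqF.
apply: (le_trans (enorm_le_sum _)).
rewrite (bigD1 (Ordinal k0))//= big1 ?addr0 => [|i /negbTE ik].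
  by rewrite !tnth_mktuple eqxx opprD addNKr normrN gtr0_norm.
by rewrite !tnth_mktuple ik addr0 subrr normr0.
Qed.

End vectors.

Section measurable_vectors.
Context {R : realType} {k : nat} d (T : measurableType d).
Implicit Types f g : T -> vec R k.

Lemma measurable_mktuple (h : 'I_k -> T -> R) :
  (forall i, measurable_fun setT (h i)) ->
  measurable_fun setT (fun t => [tuple h i t | i < k]).
Proof.
move=> mh; apply/measurable_fun_tnthP => i.
by apply: eq_measurable_fun (mh i) => t _; rewrite /= tnth_mktuple.
Qed.

Lemma measurable_coord f i : measurable_fun setT f ->
  measurable_fun setT (fun t => tnth (f t) i).
Proof. by move=> /measurable_fun_tnthP; exact. Qed.

Lemma measurable_vadd f g : measurable_fun setT f -> measurable_fun setT g ->
  measurable_fun setT (fun t => vadd (f t) (g t)).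
Proof.
by move=> mf mg; apply: measurable_mktuple => i; apply: measurable_funD;
  exact: measurable_coord.
Qed.

Lemma measurable_vsub f g : measurable_fun setT f -> measurable_fun setT g ->
  measurable_fun setT (fun t => vsub (f t) (g t)).
Proof.
by move=> mf mg; apply: measurable_mktuple => i; apply: measurable_funB;
  exact: measurable_coord.
Qed.

Lemma measurable_vscale (c : R) f : measurable_fun setT f ->
  measurable_fun setT (fun t => vscale c (f t)).
Proof.
by move=> mf; apply: measurable_mktuple => i; apply: measurable_funM => //;
  exact: measurable_coord.
Qed.

Lemma measurable_mxact (A : 'M[R]_k) f : measurable_fun setT f ->
  measurable_fun setT (fun t => mxact A (f t)).
Proof.
move=> mf; apply: measurable_mktuple => i; apply: measurable_sum => j.
by apply: measurable_funM => //; exact: measurable_coord.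
Qed.

Lemma measurable_enorm f : measurable_fun setT f ->
  measurable_fun setT (fun t => enorm (f t)).
Proof.
move=> mf.
have ms : measurable_fun [set: R] Num.sqrt.
  by apply: continuous_measurable_fun; exact: sqrt_continuous.
apply: (measurableT_comp ms); apply: measurable_sum => j.
by apply: measurable_funX; exact: measurable_coord.
Qed.

End measurable_vectors.

Local Open Scope ereal_scope.
(** * Laws, mixtures and empirical measures *)

Section law.
Context d1 d2 {T1 : measurableType d1} {T2 : measurableType d2} {R : realType}.
Variables (f : T1 -> T2) (mf : measurable_fun setT f).

(** Pushforward as a bundled measure of arbitrary mass: it is applied to restrictions of a coupling
    to cells. *)
Definition mimage (m : {measure set T1 -> \bar R}) : {measure set T2 -> \bar R} :=
  measure_function_pushforward__canonical__measure_function_Measure m mf.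

Lemma integral_mimage (m : {measure set T1 -> \bar R}) (g : T2 -> \bar R) :
  measurable_fun setT g -> (forall y, 0 <= g y) ->
  \int[mimage m]_y g y = \int[m]_x g (f x).
Proof.
move=> mg g0; rewrite -[RHS]/(\int[m]_(x in f @^-1` setT) (g \o f) x).
by rewrite -ge0_integral_pushforward.
Qed.

Definition law (P : probability T1 R) : probability T2 R :=
  let X : {mfun T1 >-> T2} := HB.pack f (isMeasurableFun.Build _ _ _ _ _ mf) in
  distribution P X.

Lemma integral_law (P : probability T1 R) (g : T2 -> \bar R) :
  measurable_fun setT g -> (forall y, 0 <= g y) ->
  \int[law P]_y g y = \int[P]_x g (f x).
Proof. exact: integral_mimage. Qed.

End law.

Section restriction.
Context d {T : measurableType d} {R : realType}.
Variables (m : {measure set T -> \bar R}).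

Lemma integral_mrestr (D : set T) (mD : measurable D) (g : T -> \bar R) :
  measurable_fun setT g -> (forall y, 0 <= g y) ->
  \int[mrestr m mD]_y g y = \int[m]_(y in D) g y.
Proof.
move=> mg g0.
rewrite (@ge0_negligible_integral _ _ _ _ setT (~` D))//; last 2 first.
- exact: measurableC.
- by rewrite -[LHS]/(m (~` D `&` D)) setICl measure0.
rewrite setTD setCK; apply: eq_measure_integral => A mA AD.
by rewrite /= /mrestr (setIidl AD).
Qed.

Lemma ge0_integral_partition (I : finType) (c : T -> I) (g : T -> \bar R) :
  (forall i, measurable [set x | c x = i]) ->
  measurable_fun setT g -> (forall y, 0 <= g y) ->
  \int[m]_x g x = \sum_i \int[m]_(x in [set x | c x = i]) g x.
Proof.
move=> mc mg g0.
under eq_bigr do rewrite integral_mkcond.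
rewrite -ge0_integral_sum//=; last 2 first.
- by move=> i; apply/(measurable_restrictT g (mc i)); exact: measurable_funTS.
- by move=> i x _; exact: erestrict_ge0.
apply: eq_integral => x _.
rewrite (bigD1 (c x))//= big1 ?adde0 => [|i /eqP ic].
  by rewrite patchE mem_set.
by rewrite patchE memNset//= => ci; apply: ic.
Qed.

Lemma measure_partition (I : finType) (c : T -> I) (A : set T) :
  (forall i, measurable [set x | c x = i]) -> measurable A ->
  m A = \sum_i m (A `&` [set x | c x = i]).
Proof.
move=> mc mA; rewrite -[A in LHS]setIT -integral_indic//.
rewrite (ge0_integral_partition mc)//; last first.
  exact/measurable_EFinP/measurable_indic.
by apply: eq_bigr => i _; rewrite integral_indic.
Qed.

End restriction.

Section mixture.
Context d {T : measurableType d} {R : realType} {I : finType}.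
Variables (i0 : I) (c : I -> {nonneg R}) (m : I -> {measure set T -> \bar R}).

(** [msum] runs over natural numbers, so the finite type is traversed through its enumeration; [i0]
    is only the default of [nth]. *)
Definition mixture : {measure set T -> \bar R} :=
  msum (fun n => mscale (c (nth i0 (enum I) n)) (m (nth i0 (enum I) n))) #|I|.

Let sum_nth_enum (F : I -> \bar R) :
  \sum_(n < #|I|) F (nth i0 (enum I) n) = \sum_i F i.
Proof.
rewrite cardE -(big_mkord xpredT (fun n => F (nth i0 (enum I) n))).
by rewrite -(big_nth i0 xpredT F) big_enum.
Qed.

Lemma mixtureE A : mixture A = \sum_i (c i)%:num%:E * m i A.
Proof. by rewrite /mixture/= /msum/= -sum_nth_enum. Qed.

Lemma integral_mixture (g : T -> \bar R) :
  measurable_fun setT g -> (forall y, 0 <= g y) ->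
  \int[mixture]_y g y = \sum_i (c i)%:num%:E * \int[m i]_y g y.
Proof.
move=> mg g0; rewrite /mixture ge0_integral_measure_sum//.
rewrite -sum_nth_enum; apply: eq_bigr => i _.
by rewrite ge0_integral_mscale.
Qed.

End mixture.

(** Repackages a measure of mass one as a bundled probability; [P0] is the fallback argument of
    [mnormalize]. *)
Lemma exists_probability d (T : measurableType d) (R : realType)
    (P0 : probability T R) (m : {measure set T -> \bar R}) : m setT = 1 ->
  exists P : probability T R, forall A, P A = m A.
Proof.
move=> mT; exists (mnormalize m P0) => A.
by rewrite -[LHS]/(mnormalize m P0 A) /mnormalize mT onee_eq0/= invr1 mule1.
Qed.

Section empirical.
Context {R : realType} {k N : nat}.
Hypothesis N0 : (0 < N)%N.
Implicit Types x : nat -> vec R k.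

Lemma empiricalE x A : empirical N x A = (N%:R^-1)%:E * \sum_(i < N) \d_(x i) A.
Proof.
have msumT : msum (fun i => @dirac _ (vec R k) (x i) R) N setT = N%:R%:E.
  rewrite /msum/=; under eq_bigr do rewrite diracT.
  by rewrite sumEFin sumr_const card_ord.
have normE (m : {measure set (vec R k) -> \bar R}) (Q : probability (vec R k) R) :
    m setT = N%:R%:E -> mnormalize m Q A = m A * (N%:R^-1)%:E.
  by move=> mT; rewrite /mnormalize mT eqe pnatr_eq0 gtn_eqF.
by rewrite [LHS](normE _ _ msumT) muleC.
Qed.

Let invN : {nonneg R} := NngNum (ltac:(by rewrite invr_ge0) : 0 <= N%:R^-1 :> R)%R.

Lemma integral_empirical x (g : vec R k -> \bar R) :
  measurable_fun setT g -> (forall y, 0 <= g y) ->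
  \int[empirical N x]_y g y = (N%:R^-1)%:E * \sum_(i < N) g (x i).
Proof.
move=> mg g0.
rewrite (eq_measure_integral
  (mscale invN (msum (fun i => @dirac _ (vec R k) (x i) R) N))); last first.
  by move=> A mA _; rewrite -[LHS]/(empirical N x A) empiricalE.
rewrite ge0_integral_mscale//= ge0_integral_measure_sum//.
congr (_ * _); apply: eq_bigr => i _.
by rewrite integral_dirac// diracT mul1e.
Qed.

Lemma empirical_moment x :
  \int[empirical N x]_y (enorm y)%:E = (N%:R^-1 * \sum_(i < N) enorm (x i))%:E.
Proof.
rewrite integral_empirical ?sumEFin//; last first.
- by move=> y; rewrite lee_fin enorm_ge0.
- exact/measurable_EFinP/measurable_enorm.
Qed.

Lemma empirical_finite_first_moment x : finite_first_moment (empirical N x).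
Proof. by rewrite /finite_first_moment empirical_moment ltry. Qed.

End empirical.

Section product_marginals.
Context d1 d2 {T1 : measurableType d1} {T2 : measurableType d2} {R : realType}.
Variables (P1 : probability T1 R) (P2 : probability T2 R).

Lemma ge0_integral_fst (g : T1 -> \bar R) :
  measurable_fun setT g -> (forall x, 0 <= g x) ->
  \int[P1 \x P2]_p g p.1 = \int[P1]_x g x.
Proof.
move=> mg g0; rewrite (fubini_tonelli1 (fun p => g p.1))//; last first.
  exact: measurableT_comp.
apply: eq_integral => x _.
by rewrite /fubini_F/= integral_cst// [X in _ * X]probability_setT mule1.
Qed.

Lemma ge0_integral_snd (g : T2 -> \bar R) :
  measurable_fun setT g -> (forall x, 0 <= g x) ->
  \int[P1 \x P2]_p g p.2 = \int[P2]_x g x.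
Proof.
move=> mg g0; rewrite (fubini_tonelli1 (fun p => g p.2))//; last first.
  exact: measurableT_comp.
rewrite /fubini_F/= (eq_integral (cst (\int[P2]_x g x)))//.
by rewrite integral_cst// [X in _ * X]probability_setT mule1.
Qed.

End product_marginals.

(** * Wasserstein distance *)

Section wasserstein.
Context {R : realType} {k : nat}.
Implicit Types mu nu : probability (vec R k) R.

Let mcost : measurable_fun setT
  (fun p : vec R k * vec R k => (enorm (vsub p.1 p.2))%:E : \bar R).
Proof. by apply/measurable_EFinP/measurable_enorm/measurable_vsub. Qed.

Lemma W1_ge0 (mu nu : set (vec R k) -> \bar R) : 0 <= W1 mu nu.
Proof.
apply: le_ereal_inf_tmp => _ [pi _ <-]; apply: integral_ge0 => p _.
by rewrite lee_fin enorm_ge0.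
Qed.

Lemma W1_le_coupling (mu nu : set (vec R k) -> \bar R) pi : coupling mu nu pi ->
  W1 mu nu <= \int[pi]_p (enorm (vsub p.1 p.2))%:E.
Proof. by move=> cpi; apply: ereal_inf_lbound; exists pi. Qed.

Lemma W1_lt_coupling (mu nu : set (vec R k) -> \bar R) c : W1 mu nu < c ->
  exists2 pi, coupling mu nu pi & \int[pi]_p (enorm (vsub p.1 p.2))%:E < c.
Proof. by move=> /ereal_inf_lt[_ [pi cpi <-]]; exists pi. Qed.

(** Tested on the product coupling. Finite first moments therefore make [W1] finite, so that [fine]
    loses nothing. *)
Lemma W1_le_moments mu nu :
  W1 mu nu <= \int[mu]_x (enorm x)%:E + \int[nu]_x (enorm x)%:E.
Proof.
have me : measurable_fun setT (fun x : vec R k => (enorm x)%:E : \bar R).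
  exact/measurable_EFinP/measurable_enorm.
apply: (@le_trans _ _ (\int[(mu \x nu)]_p ((enorm p.1)%:E + (enorm p.2)%:E))).
  apply: (le_trans (W1_le_coupling (pi := mu \x nu) _)).
    split => A mA.
      apply: (etrans (product_measure1E mu nu mA measurableT)).
      by rewrite [X in _ * X]probability_setT mule1.
    apply: (etrans (product_measure1E mu nu measurableT mA)).
    by rewrite [X in X * _]probability_setT mul1e.
  apply: ge0_le_integral => //.
  - by move=> p _; rewrite lee_fin enorm_ge0.
  - apply: emeasurable_funD; exact/measurable_EFinP/measurable_enorm.
  - by move=> p _; rewrite -EFinD lee_fin enorm_vsub_le.
rewrite ge0_integralD//; first last.
- exact/measurable_EFinP/measurable_enorm.
- by move=> p _; rewrite lee_fin enorm_ge0.
- exact/measurable_EFinP/measurable_enorm.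
- by move=> p _; rewrite lee_fin enorm_ge0.
have e0 (x : vec R k) : 0 <= (enorm x)%:E by rewrite lee_fin enorm_ge0.
rewrite (ge0_integral_fst mu nu (g := fun x => (enorm x)%:E))//.
by rewrite (ge0_integral_snd mu nu (g := fun x => (enorm x)%:E)).
Qed.

Lemma W1_lty mu nu : finite_first_moment mu -> finite_first_moment nu ->
  W1 mu nu < +oo.
Proof.
by move=> fmu fnu; apply: (le_lt_trans (W1_le_moments _ _)); rewrite lte_add_pinfty.
Qed.

Lemma W1_fineK mu nu : finite_first_moment mu -> finite_first_moment nu ->
  (fine (W1 mu nu))%:E = W1 mu nu.
Proof.
by move=> fmu fnu; rewrite fineK// ge0_fin_numE ?W1_ge0// W1_lty.
Qed.

End wasserstein.

(** * Gluing an empirical measure onto a coupling, cell by cell *)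

Section glue.
Context {R : realType} {k : nat} {T : finType}.
Variables (N : nat) (x : nat -> vec R k) (c : set (vec R k) -> \bar R).
Variables (pi : probability (vec R k * vec R k)%type R).
Variables (cell : vec R k -> T) (w : 'I_N -> T -> R).
Hypothesis N0 : (0 < N)%N.
Hypothesis mcell : forall t, measurable [set y | cell y = t].
Hypothesis w0 : forall i t, (0 <= w i t)%R.
Hypothesis wx : forall i, (\sum_t w i t = N%:R^-1)%R.
Hypothesis wpi : forall t, (\sum_i w i t)%:E = pi [set p | cell p.1 = t].
Hypothesis pic : forall A, measurable A -> pi (setT `*` A) = c A.

Let D t : set (vec R k * vec R k) := [set p | cell p.1 = t].

Let mD t : measurable (D t).
Proof.
rewrite -[D t]setTI; apply: (measurable_fst measurableT _ (mcell t)).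
Qed.

Let mass t : R := \sum_i w i t.

Let mass_ge0 t : (0 <= mass t)%R.
Proof. exact: sumr_ge0. Qed.

Let q (it : 'I_N * T) : {nonneg R} :=
  NngNum (divr_ge0 (w0 it.1 it.2) (mass_ge0 it.2)).

(** A cell of mass zero forces all its nonnegative weights to vanish, so the quotient by zero is
    harmless. *)
Let wmass i t : (w i t / mass t * mass t)%R = w i t.
Proof.
have [m0|m0] := eqVneq (mass t) 0%R; last by rewrite divfK.
rewrite m0 mulr0; apply/esym; move: m0 => /psumr_eq0P; exact.
Qed.

Let jump i (p : vec R k * vec R k) := (x i, p.2).

Let mjump i : measurable_fun setT (jump i).
Proof. exact/measurable_fun_pair. Qed.

(** The part of [pi] over a cell, with its first coordinate replaced by the atom. Weighted by [q],
    the pieces share the second coordinates of a cell among the atoms in proportion to [w i t],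
    wherever in the cell the first coordinate lies. *)
Let piece (it : 'I_N * T) := mimage (mjump it.1) (mrestr pi (mD it.2)).

Let it0 : 'I_N * T := (Ordinal N0, cell (vzero R k)).

Let gamma0 := mixture it0 q piece.

Let sum_mass (F : T -> \bar R) : (forall t, 0 <= F t) ->
  (forall t, mass t = 0%R -> F t = 0) ->
  \sum_(it : 'I_N * T) (q it)%:num%:E * F it.2 = \sum_t F t.
Proof.
move=> F0 Fm.
rewrite -(pair_bigA _ (fun i t => (w i t / mass t)%:E * F t))/= exchange_big/=.
apply: eq_bigr => t _; rewrite -ge0_sume_distrl; last first.
  by move=> i _; rewrite lee_fin divr_ge0.
rewrite sumEFin -mulr_suml -/(mass t).
have [/Fm ->|m0] := eqVneq (mass t) 0%R; first by rewrite mule0.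
by rewrite divff// mul1e.
Qed.

Let gamma0_snd A : measurable A -> gamma0 (setT `*` A) = pi (setT `*` A).
Proof.
move=> mA; have mTA : measurable ([set: vec R k] `*` A) by exact: measurableX.
rewrite mixtureE (@measure_partition _ _ _ pi _ (fun p => cell p.1) (setT `*` A))//.
rewrite -(sum_mass (F := fun t => pi ((setT `*` A) `&` D t))); first last.
- move=> t t0; apply/eqP; rewrite eq_le measure_ge0// andbT.
  rewrite -(_ : pi (D t) = 0) ?le_measure ?inE//; first exact: measurableI.
  by rewrite -wpi -/(mass t) t0.
- by move=> t; exact: measure_ge0.
by apply: eq_bigr => -[i t] _.
Qed.

Let gamma0T : gamma0 setT = 1.
Proof.
by rewrite -setXTT gamma0_snd// setXTT probability_setT.
Qed.

Let gamma_coupling : exists2 gamma : probability (vec R k * vec R k)%type R,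
  coupling (empirical N x) c gamma & forall A, gamma A = gamma0 A.
Proof.
have [gamma gammaE] := exists_probability pi gamma0T.
exists gamma => //.
split => A mA; last by rewrite gammaE -pic// -gamma0_snd.
rewrite gammaE (empiricalE N0) [LHS]mixtureE.
rewrite -(pair_bigA _ (fun i t => (w i t / mass t)%:E * piece (i, t) (A `*` setT)))/=.
rewrite ge0_sume_distrr//; apply: eq_bigr => i _.
have pieceE t : piece (i, t) (A `*` setT) = \d_(x i) A * (mass t)%:E.
  rewrite /mass wpi -/(D t) diracE.
  have [xA|xA] := boolP (x i \in A).
    rewrite mul1e; congr (pi _); apply/seteqP; split => -[a b] /=; first by case.
    by move=> Dt; split => //; split => //; rewrite -inE.
  rewrite mul0e -[RHS](measure0 pi); congr (pi _); apply/seteqP; split => -[a b] //=.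
  by move=> [[]]; rewrite -inE (negbTE xA).
under eq_bigr do rewrite pieceE muleCA -EFinM wmass.
by rewrite sumEFin -mulr_sumr wx /dirac EFinM muleC.
Qed.

Let mcost : measurable_fun setT
  (fun p : vec R k * vec R k => (enorm (vsub p.1 p.2))%:E : \bar R).
Proof. by apply/measurable_EFinP/measurable_enorm/measurable_vsub. Qed.

(* Transporting [x] to the second marginal of [pi] along the first one only
   needs the cell of the intermediate point, so no disintegration is involved. *)
Lemma W1_glue : W1 (empirical N x) c <=
  \sum_(i < N) \sum_t (w i t / \sum_j w j t)%:E *
     \int[pi]_(p in [set p | cell p.1 = t]) (enorm (vsub (x i) p.1))%:E
  + \int[pi]_p (enorm (vsub p.1 p.2))%:E.
Proof.
have [gamma /W1_le_coupling gammaW gammaE] := gamma_coupling.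
apply: (le_trans gammaW).
rewrite (eq_measure_integral gamma0) => [|A _ _]; last exact: gammaE.
rewrite [leLHS]integral_mixture//; last by move=> p; rewrite lee_fin enorm_ge0.
have msnd i : measurable_fun setT
    (fun p : vec R k * vec R k => (enorm (vsub (x i) p.2))%:E : \bar R).
  by apply/measurable_EFinP/measurable_enorm/measurable_vsub.
have mfst i : measurable_fun setT
    (fun p : vec R k * vec R k => (enorm (vsub (x i) p.1))%:E : \bar R).
  by apply/measurable_EFinP/measurable_enorm/measurable_vsub.
have e0 (y z : vec R k) : 0 <= (enorm (vsub y z))%:E by rewrite lee_fin enorm_ge0.
have pieceE it : \int[piece it]_p (enorm (vsub p.1 p.2))%:E =
    \int[pi]_(p in D it.2) (enorm (vsub (x it.1) p.2))%:E.
  rewrite /piece integral_mimage//.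
  move: (msnd it.1) => /= mf.
  by rewrite integral_mrestr.
rewrite (@ge0_integral_partition _ _ _ pi _ (fun p => cell p.1) _ mD)//.
rewrite -(sum_mass (F := fun t => \int[pi]_(p in D t) (enorm (vsub p.1 p.2))%:E)).
- rewrite pair_bigA -big_split/=; apply: lee_sum => -[i t] _.
  rewrite pieceE/= -ge0_muleDr ?integral_ge0// lee_wpmul2l//.
    by rewrite lee_fin divr_ge0.
  rewrite -ge0_integralD//; try exact: mD; try exact: measurable_funTS.
  apply: ge0_le_integral => //; try exact: mD; try exact: measurable_funTS.
    by apply: emeasurable_funD; exact: measurable_funTS.
  by move=> p _; rewrite -EFinD lee_fin enorm_triangle.
- by move=> t; exact: integral_ge0.
- move=> t t0; apply: (@null_set_integral _ _ _ pi (D t)) => //.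
    exact: measurable_funTS.
  by rewrite -[LHS]wpi -/(mass t) t0.
Qed.

End glue.

Lemma measurable_vec1 (R : realType) k (y : vec R k) : measurable [set y].
Proof.
have mf : measurable_fun setT (fun z => enorm (vsub z y)).
  exact/measurable_enorm/measurable_vsub.
rewrite (_ : [set y] = setT `&` (fun z => enorm (vsub z y)) @^-1` [set 0%R]).
  exact: mf.
apply/seteqP; split => z /= => [->|[_ /vsub_eq0//]].
by rewrite enorm_vsubxx.
Qed.

(** * Dependence of the distance on the atoms *)

Section W1_empirical.
Context {R : realType} {k N : nat}.
Hypothesis N0 : (0 < N)%N.

(** Gluing with the atoms of [y] as cells: a near-optimal coupling of [empirical N y] with [c] is
    re-attached to [x] by letting the mass of index [i] start from [x i] instead of [y i]. The slack
    [e] is there because the infimum need not be attained. *)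
Lemma W1_empirical_lipschitz (x y : nat -> vec R k) (c : probability (vec R k) R) :
  W1 (empirical N x) c <=
  (N%:R^-1 * \sum_(i < N) enorm (vsub (x i) (y i)))%:E + W1 (empirical N y) c.
Proof.
apply/lee_addgt0Pr => e e0.
have [->|fW] := eqVneq (W1 (empirical N y) c) +oo; first by rewrite addey ?leey.
have : W1 (empirical N y) c < W1 (empirical N y) c + e%:E.
  have fn : W1 (empirical N y) c \is a fin_num.
    by rewrite ge0_fin_numE ?W1_ge0// ltey.
  by rewrite lteDl// lte_fin.
move=> /W1_lt_coupling[pi [pi1 pi2] piW].
rewrite -addeA; apply: (le_trans _ (leeD (lexx _) (ltW piW))).
(* Coinciding atoms share the cell of the picked index; [None] collects the points off the
   support. *)
pose cell (z : vec R k) : option 'I_N := [pick i : 'I_N | y i == z].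
have cellE z t : cell z = Some t -> y t = z.
  by rewrite /cell; case: pickP => // i /eqP iz [<-].
have cell_y (i : 'I_N) : exists t, cell (y i) = Some t.
  by rewrite /cell; case: pickP => [j _|/(_ i)]; [exists j|rewrite eqxx].
have mcell t : measurable [set z | cell z = t].
  suff fin : forall i, measurable [set z | cell z = Some i].
    case: t => [i|]; first exact: fin.
    rewrite (_ : [set z | _] = ~` \bigcup_(i : 'I_N) [set z | cell z = Some i]).
      by apply: measurableC; apply: countable_bigcupT_measurable.
    apply/seteqP; split => z/=; first by move=> cz [j _] /=; rewrite cz.
    move=> ncz; case E : (cell z) => [j|//]; exfalso; apply: ncz.
    by exists j.
  (* Only an index that represents its own atom has a nonempty cell, the singleton of that atom. *)
  move=> i; have [yi|yi] := eqVneq (cell (y i)) (Some i).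
    rewrite (_ : [set z | _] = [set y i]); first exact: measurable_vec1.
    by apply/seteqP; split => z /= => [/cellE|->].
  rewrite (_ : [set z | _] = set0)//; apply/seteqP; split => z //= zi.
  by move: yi; rewrite (cellE _ _ zi) zi eqxx.
have mD t : measurable [set p : vec R k * vec R k | cell p.1 = t].
  rewrite -[X in measurable X]setTI; exact: (measurable_fst measurableT _ (mcell t)).
pose w (i : 'I_N) t : R := (if cell (y i) == t then N%:R^-1 else 0)%R.
have w0 i t : (0 <= w i t)%R by rewrite /w; case: ifP; rewrite ?invr_ge0.
have wx i : (\sum_t w i t = N%:R^-1)%R.
  rewrite (bigD1 (cell (y i)))//= big1 ?addr0 /w ?eqxx// => t.
  by rewrite eq_sym => /negbTE ->.
have wpi t : (\sum_i w i t)%:E = pi [set p | cell p.1 = t].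
  rewrite (_ : [set p | _] = [set z | cell z = t] `*` setT); last first.
    by apply/seteqP; split => -[a b]//= [].
  rewrite pi1// (empiricalE N0) ge0_sume_distrr//= -sumEFin.
  apply: eq_bigr => i _; rewrite /w diracE.
  have [yt|yt] := eqVneq (cell (y i)) t; first by rewrite mem_set// mule1.
  by rewrite memNset ?mule0//; apply/eqP.
apply: (le_trans (W1_glue x N0 mcell w0 wx wpi pi2)).
rewrite leeD2r// mulr_sumr -sumEFin; apply: lee_sum => i _.
rewrite [leLHS](bigD1 (cell (y i)))//= [X in _ + X <= _]big1 ?adde0; last first.
  by move=> t; rewrite eq_sym /w => /negbTE ->; rewrite mul0r mul0e.
have [j yj] := cell_y i.
rewrite (eq_integral (fun=> (enorm (vsub (x i) (y i)))%:E)); last first.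
  move=> p; rewrite inE/= yj => /cellE <-.
  by rewrite (cellE _ _ yj).
rewrite integral_cst// -[X in _ * (_ * X)]wpi muleCA -EFinM lee_fin [leRHS]mulrC ler_wpM2l ?enorm_ge0//.
have [m0|m0] := eqVneq (\sum_j0 w j0 (cell (y i)))%R 0%R.
  by rewrite m0 mulr0 invr_ge0.
by rewrite divfK// /w eqxx.
Qed.

(* [W1] is Lipschitz in the support points, hence a countable union over
   rational configurations. *)
Lemma measurable_W1_empirical d (T : measurableType d) (x : nat -> T -> vec R k)
    (c : probability (vec R k) R) (e : \bar R) :
  finite_first_moment c -> (forall i, (i < N)%N -> measurable_fun setT (x i)) ->
  measurable [set t | e < W1 (empirical N (x ^~ t)) c].
Proof.
move=> fc mx.
have WK y := W1_fineK (empirical_finite_first_moment N0 y) fc.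
case: e => [e| |]; last 2 first.
- rewrite (_ : [set t | _] = set0)//; apply/seteqP; split => t //=.
  by rewrite ltNge leey.
- rewrite (_ : [set t | _] = setT)//; apply/seteqP; split => t //= _.
  by rewrite -WK ltNyr.
pose G y := fine (W1 (empirical N y) c).
pose gap (y z : nat -> vec R k) :=
  (N%:R^-1 * \sum_(i < N) enorm (vsub (y i) (z i)))%R.
have Glip y z : (G y <= gap y z + G z)%R.
  by rewrite -lee_fin EFinD !WK; exact: W1_empirical_lipschitz.
have gapC y z : gap y z = gap z y.
  by rewrite /gap; under eq_bigr do rewrite enorm_vsubC.
pose pt (r : {ffun 'I_N -> {ffun 'I_k -> rat}}) (i : nat) : vec R k :=
  if insub i is Some j then [tuple ratr (r j l) | l < k] else vzero R k.
have dense y (eps : R) : (0 < eps)%R -> exists r, (gap y (pt r) < eps)%R.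
  move=> eps0; pose h : R := (eps / (2 * k.+1%:R))%R.
  have h0 : (0 < h)%R by rewrite divr_gt0// mulr_gt0.
  have /choice[r1 r1P] (a : R) : exists b : rat, (`|a - ratr b| < h)%R.
    have : (a - h < a + h)%R by rewrite ltrBlDr -addrA ltrDl addr_gt0.
    move=> /rat_in_itvoo[b]; rewrite in_itv/= => /andP[b1 b2]; exists b.
    by rewrite distrC ltr_distl b1.
  exists [ffun i : 'I_N => [ffun l => r1 (tnth (y i) l)]].
  have close (i : 'I_N) : (enorm (vsub (y i)
      (pt [ffun i : 'I_N => [ffun l => r1 (tnth (y i) l)]] i)) <= eps / 2)%R.
    apply: (le_trans (enorm_le_sum _)).
    apply: (@le_trans _ _ (\sum_(l < k) h)%R).
      apply: ler_sum => l _; rewrite tnth_mktuple /pt valK tnth_mktuple !ffunE.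
      exact/ltW/r1P.
    have <- : (h * k.+1%:R = eps / 2)%R.
      by rewrite /h invfM -!mulrA mulVf ?mulr1 ?pnatr_eq0.
    by rewrite sumr_const card_ord -[leLHS]mulr_natr ler_wpM2l ?ler_nat// ltW.
  apply: (@le_lt_trans _ _ (N%:R^-1 * \sum_(i < N) (eps / 2)))%R.
    by rewrite ler_wpM2l ?invr_ge0//; apply: ler_sum => i _; exact: close.
  rewrite sumr_const card_ord -[X in (_ * X)%R]mulr_natl mulKf ?pnatr_eq0 -?lt0n//.
  by rewrite ltr_pdivrMr// ltr_pMr// ltr1n.
(* By the Lipschitz bound in both directions, the distance exceeds [e] exactly when some rational
   configuration exceeds [e] by more than its gap to the actual one. *)
rewrite (_ : [set t | _] = \bigcup_r [set t | (e + gap (x ^~ t) (pt r) < G (pt r))%R]).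
  apply: countable_bigcupT_measurable; first exact: countableP.
  move=> r; rewrite -[X in measurable X]setTI.
  suff h : measurable_fun setT (fun t => e + gap (x ^~ t) (pt r) < G (pt r))%R.
    exact: (h measurableT [set true]).
  apply: measurable_fun_ltr => //; apply: measurable_funD => //.
  apply: measurable_funM => //; apply: measurable_sum => i.
  by apply/measurable_enorm/measurable_vsub => //; exact: mx.
apply/seteqP; split => [t /=|t [r _] /=]; rewrite -WK lte_fin -/(G _) => tW.
  (* Half of the margin, since the gap is paid twice: once to compare distances and once in the
     defining inequality. *)
  have d0 : (0 < (G (x ^~ t) - e) / 2)%R by rewrite divr_gt0// subr_gt0.
  have [r rP] := dense (x ^~ t) _ d0.
  exists r => //=; have := Glip (x ^~ t) (pt r); move: rP; lra.
by have := Glip (pt r) (x ^~ t); rewrite gapC; lra.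
Qed.

End W1_empirical.

(** * Lipschitz constant and one-step evolution *)

(* [Dlip f] is an uncountable supremum and need not be measurable: its integral
   is then a lower integral, which is still monotone. *)
Section lower_integral.
Context d (T : measurableType d) (R : realType).
Variable m : probability T R.
Import HBNNSimple.

Lemma le_integral_nonmeasurable (g h : T -> \bar R) :
  (forall x, 0 <= g x) -> (forall x, g x <= h x) ->
  \int[m]_x g x <= \int[m]_x h x.
Proof.
move=> g0 gh; rewrite !ge0_integralTE//; last by move=> x; exact: le_trans (gh x).
apply: ge_ereal_sup => _ [s /= sg <-]; apply: ereal_sup_ubound.
by exists s => //= x; exact: le_trans (gh x).
Qed.

(** The bound is checked on the simple functions below [h]: they are measurable and inherit it
    almost everywhere. *)
Lemma integral_le_ae_bound (h : T -> \bar R) (M : R) : (0 <= M)%R ->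
  (forall x, 0 <= h x) -> {ae m, forall x, h x <= M%:E} ->
  \int[m]_x h x <= M%:E.
Proof.
move=> M0 h0 hM; rewrite ge0_integralTE//.
apply: ge_ereal_sup => _ [s /= sh <-].
rewrite -integralT_nnsfun.
apply: (@le_trans _ _ (\int[m]_x (cst M%:E) x)).
  apply: ae_ge0_le_integral => //.
  - by move=> x _; rewrite lee_fin.
  - exact/measurable_EFinP.
  - by apply: filterS hM => x hx _; exact: le_trans (sh x) hx.
by rewrite integral_cst// [X in _ * X]probability_setT mule1.
Qed.

End lower_integral.

Section lipschitz.
Context {R : realType} {d m : nat}.
Variable f : vec R d -> giry (vec R d) R -> vec R m -> vec R d.
Hypothesis d0 : (0 < d)%N.
Hypothesis f_eq : forall x (mu1 mu2 : giry (vec R d) R) z,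
  meas_eq mu1 mu2 -> f x mu1 z = f x mu2 z.
Implicit Types (mu nu : probability (vec R d) R) (x y : vec R d) (z : vec R m).

Lemma W1xx mu : W1 mu mu = 0.
Proof.
apply/eqP; rewrite eq_le W1_ge0 andbT.
have md : measurable_fun setT (fun x : vec R d => (x, x)).
  exact: measurable_fun_pair.
apply: (le_trans (W1_le_coupling (pi := law md mu) _)).
  by split => A mA; congr (mu _); apply/seteqP; split => x //= [].
rewrite integral_law//; last by move=> p; rewrite lee_fin enorm_ge0.
  by under eq_integral do rewrite /= enorm_vsubxx; rewrite integral0.
exact/measurable_EFinP/measurable_enorm/measurable_vsub.
Qed.

Definition pdist x mu y nu : R := (enorm (vsub x y) + fine (W1 mu nu))%R.

Lemma pdist_ge0 x mu y nu : (0 <= pdist x mu y nu)%R.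
Proof. by rewrite addr_ge0 ?enorm_ge0// fine_ge0// W1_ge0. Qed.

(** The supremum of the empty set would be minus infinity; two distinct points with the same Dirac
    measure supply a nonnegative member. *)
Lemma Dlip_ge0 z : 0 <= Dlip f z.
Proof.
have [y xy _] := exists_close_neq (vzero R d) d0 ltr01.
pose mu : probability (vec R d) R := \d_(vzero R d).
have fmu : finite_first_moment mu.
  rewrite /finite_first_moment integral_dirac//; last first.
    exact/measurable_EFinP/measurable_enorm.
  by rewrite diracT mul1e ltry.
apply: (@le_trans _ _ ((enorm (vsub (f (vzero R d) mu z) (f y mu z))
               / (enorm (vsub (vzero R d) y) + fine (W1 mu mu)))%R)%:E).
  by rewrite lee_fin divr_ge0 ?enorm_ge0// pdist_ge0.
apply: ereal_sup_ubound.
by exists (vzero R d), y, mu, mu; split => //; left.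
Qed.

(** A pair excluded from the supremum has equal points and measures agreeing on Borel sets; there
    [f_eq] makes the numerator vanish. *)
Lemma le_Dlip x mu y nu z : finite_first_moment mu -> finite_first_moment nu ->
  (0 < pdist x mu y nu)%R ->
  (enorm (vsub (f x mu z) (f y nu z)) / pdist x mu y nu)%:E <= Dlip f z.
Proof.
move=> fmu fnu p0.
have [[xy mn]|xymn] := pselect (x = y /\ meas_eq mu nu).
  by rewrite xy (f_eq _ _ mn) enorm_vsubxx mul0r Dlip_ge0.
apply: ereal_sup_ubound; exists x, y, mu, nu; split => //.
have [xy|] := pselect (x = y); last by left.
by right => mn; apply: xymn.
Qed.

Lemma lipschitz_Dlip x mu y nu z (L : R) : Dlip f z <= L%:E ->
  finite_first_moment mu -> finite_first_moment nu ->
  (enorm (vsub (f x mu z) (f y nu z)) <= L * pdist x mu y nu)%R.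
Proof.
move=> DL fmu fnu.
have L0 : (0 <= L)%R by rewrite -lee_fin (le_trans (Dlip_ge0 z)).
have pos x' mu' y' nu' : finite_first_moment mu' -> finite_first_moment nu' ->
    (0 < pdist x' mu' y' nu')%R ->
    (enorm (vsub (f x' mu' z) (f y' nu' z)) <= L * pdist x' mu' y' nu')%R.
  move=> fm' fn' p0; rewrite -ler_pdivrMr// -lee_fin.
  exact: le_trans (le_Dlip z fm' fn' p0) DL.
have := pdist_ge0 x mu y nu; rewrite le_eqVlt => /predU1P[p0|]; last exact: pos.
have [xy W0] : x = y /\ fine (W1 mu nu) = 0%R.
  have W0 : (0 <= fine (W1 mu nu))%R by rewrite fine_ge0// W1_ge0.
  have e0 := enorm_ge0 (vsub x y).
  by split; [apply: vsub_eq0|]; move: p0; rewrite /pdist; lra.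
(* [Dlip] ignores pairs at distance zero with distinct measures (junk [x / 0]),
   so [x] is moved slightly. *)
rewrite -p0 mulr0 -xy; apply/ler_addgt0Pr => e e0; rewrite add0r.
(* Two detours of length at most [h], each with Lipschitz constant [L], cost at most [e]; [L + 1]
   keeps the denominator positive. *)
pose h : R := (e / (2 * (L + 1)))%R.
have h0 : (0 < h)%R by rewrite divr_gt0// mulr_gt0// ltr_wpDl.
have [x' xx' x'h] := exists_close_neq x d0 h0.
have nxx' : (0 < enorm (vsub x x'))%R.
  by rewrite lt_neqAle enorm_ge0 andbT eq_sym; apply/eqP => /vsub_eq0.
have p1 : pdist x mu x' nu = enorm (vsub x x') by rewrite /pdist W0 addr0.
have p2 : pdist x' nu x nu = enorm (vsub x x').
  by rewrite /pdist W1xx addr0 enorm_vsubC.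
apply: (le_trans (enorm_triangle _ (f x' nu z) _)).
have := @pos x mu x' nu fmu fnu; rewrite p1 => /(_ nxx') l1.
have := @pos x' nu x nu fnu fnu; rewrite p2 => /(_ nxx') l2.
apply: (le_trans (lerD l1 l2)); rewrite -mulrDr.
have : (L * (enorm (vsub x x') + enorm (vsub x x')) <= (L + 1) * (h + h))%R.
  by rewrite ler_pM ?lerD ?lerDl// addr_ge0 ?enorm_ge0.
move/le_trans; apply; rewrite [leLHS](_ : _ = e)// /h.
by field; rewrite gt_eqF// ltr_wpDl.
Qed.

Variable theta : probability (vec R m) R.
Variable M : R.
Hypothesis M0 : (0 <= M)%R.
Hypothesis DM : {ae theta, forall z, Dlip f z <= M%:E}.
Let sigma := sigmaD f theta.

(** The almost-sure bound [M] keeps the lower integral finite, so the [fine] inside [sigmaD]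
    discards nothing. *)
Lemma sigmaDE : sigma%:E = \int[theta]_z Dlip f z.
Proof.
rewrite /sigma /sigmaD fineK// ge0_fin_numE; last first.
  by apply: integral_ge0 => z _; exact: Dlip_ge0.
apply: (le_lt_trans (integral_le_ae_bound M0 _ DM)); first exact: Dlip_ge0.
by rewrite ltry.
Qed.

Lemma sigmaD_ge0 : (0 <= sigma)%R.
Proof.
by rewrite -lee_fin sigmaDE integral_ge0// => z _; exact: Dlip_ge0.
Qed.

Lemma sigmaD_le : (sigma <= M)%R.
Proof.
rewrite -lee_fin sigmaDE; apply: integral_le_ae_bound => //; exact: Dlip_ge0.
Qed.

Hypothesis mf : forall x (mu : giry (vec R d) R), measurable_fun setT (f x mu).

(** Dividing by the distance puts the integrand under [Dlip], and monotonicity is all that the lower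
    integral has to offer. At distance zero the almost-sure Lipschitz bound gives zero directly. *)
Lemma integral_lipschitz x mu y nu :
  finite_first_moment mu -> finite_first_moment nu ->
  \int[theta]_z (enorm (vsub (f x mu z) (f y nu z)))%:E <=
  (sigma * pdist x mu y nu)%:E.
Proof.
move=> fmu fnu.
have mg : measurable_fun setT (fun z => (enorm (vsub (f x mu z) (f y nu z)))%:E : \bar R).
  exact/measurable_EFinP/measurable_enorm/measurable_vsub.
have g0 z : 0 <= (enorm (vsub (f x mu z) (f y nu z)))%:E by rewrite lee_fin enorm_ge0.
have := pdist_ge0 x mu y nu; rewrite le_eqVlt => /predU1P[p0|p0].
  rewrite -p0 mulr0; apply: integral_le_ae_bound => //.
  apply: filterS DM => z Dz; rewrite lee_fin.
  by have := lipschitz_Dlip x y Dz fmu fnu; rewrite -p0 mulr0.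
under eq_integral => z _ do rewrite -[enorm _](divfK (lt0r_neq0 p0)) EFinM muleC.
rewrite ge0_integralZl//; first last.
- by rewrite lee_fin ltW.
- by move=> z _; rewrite lee_fin divr_ge0 ?enorm_ge0// ltW.
- apply/measurable_EFinP/measurable_funM => //.
  exact/measurable_enorm/measurable_vsub.
rewrite mulrC EFinM; apply: lee_wpmul2l; first by rewrite lee_fin ltW.
rewrite sigmaDE; apply: le_integral_nonmeasurable => z; last exact: le_Dlip.
by rewrite lee_fin divr_ge0 ?enorm_ge0// ltW.
Qed.

End lipschitz.

Lemma coupling_integral_fst {R : realType} {k : nat} (mu : probability (vec R k) R)
    (nu : set (vec R k) -> \bar R) pi (g : vec R k -> \bar R) :
  coupling mu nu pi -> measurable_fun setT g -> (forall x, 0 <= g x) ->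
  \int[pi]_p g p.1 = \int[mu]_x g x.
Proof.
move=> [c1 _] mg g0; rewrite -(integral_law (@measurable_fst _ _ (vec R k) (vec R k)))//.
apply: eq_measure_integral => B mB _; apply: (etrans _ (c1 _ mB)).
by congr (pi _); apply/seteqP; split => -[a b] //= [].
Qed.

Lemma coupling_integral_snd {R : realType} {k : nat}
    (mu : set (vec R k) -> \bar R) (nu : probability (vec R k) R)
    pi (g : vec R k -> \bar R) :
  coupling mu nu pi -> measurable_fun setT g -> (forall x, 0 <= g x) ->
  \int[pi]_p g p.2 = \int[nu]_x g x.
Proof.
move=> [_ c2] mg g0; rewrite -(integral_law (@measurable_snd _ _ (vec R k) (vec R k)))//.
apply: eq_measure_integral => B mB _; apply: (etrans _ (c2 _ mB)).
by congr (pi _); apply/seteqP; split => -[a b] //= [].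
Qed.

Section evolution.
Context {R : realType} {d m : nat}.
Variables (A : 'M[R]_d) (delta : R).
Variable f : vec R d -> giry (vec R d) R -> vec R m -> vec R d.

Definition evol x mu z := vadd (mxact A x) (vscale delta (f x mu z)).

Hypothesis mf : measurable_fun setT
  (fun p : (vec R d * giry (vec R d) R * vec R m)%type => f p.1.1 p.1.2 p.2).

Lemma measurable_f d' (T : measurableType d') (g : T -> vec R d)
    (h : T -> giry (vec R d) R) (l : T -> vec R m) :
  measurable_fun setT g -> measurable_fun setT h -> measurable_fun setT l ->
  measurable_fun setT (fun t => f (g t) (h t) (l t)).
Proof.
move=> mg mh ml.
apply: (measurableT_comp mf (g := fun t => ((g t, h t), l t))).
exact/measurable_fun_pair/ml/measurable_fun_pair.
Qed.

Lemma measurable_evol d' (T : measurableType d') (g : T -> vec R d)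
    (h : T -> giry (vec R d) R) (l : T -> vec R m) :
  measurable_fun setT g -> measurable_fun setT h -> measurable_fun setT l ->
  measurable_fun setT (fun t => evol (g t) (h t) (l t)).
Proof.
move=> mg mh ml; apply: measurable_vadd; first exact: measurable_mxact.
by apply: measurable_vscale; exact: measurable_f.
Qed.

Lemma measurable_evol_noise x (mu : giry (vec R d) R) :
  measurable_fun setT (evol x mu).
Proof. exact: (@measurable_evol _ _ (fun=> x) (fun=> mu) id). Qed.

Hypothesis d0 : (0 < d)%N.
Hypothesis f_eq : forall x (mu1 mu2 : giry (vec R d) R) z,
  meas_eq mu1 mu2 -> f x mu1 z = f x mu2 z.
Variable theta : probability (vec R m) R.
Variables M a : R.
Hypothesis M0 : (0 <= M)%R.
Hypothesis DM : {ae theta, forall z, Dlip f z <= M%:E}.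
Hypothesis delta0 : (0 <= delta)%R.
Hypothesis a0 : (0 <= a)%R.
Hypothesis Aa : forall x, (enorm (mxact A x) <= a * enorm x)%R.
Implicit Types (mu nu : probability (vec R d) R) (x y : vec R d) (z : vec R m).
Let sigma := sigmaD f theta.

(** One step of [nonlinear_evolution] as a relation, so that it also applies to the image of a
    random empirical measure. *)
Definition Psi mu (nu : set (vec R d) -> \bar R) :=
  forall S : set (vec R d), measurable S ->
    nu S = \int[mu]_x theta [set z | S (evol x mu z)].

Let mevol2 mu :
  measurable_fun setT (fun q : vec R d * vec R m => evol q.1 mu q.2).
Proof. exact: measurable_evol. Qed.

Lemma integral_Psi mu nu (g : vec R d -> \bar R) : Psi mu nu ->
  measurable_fun setT g -> (forall x, 0 <= g x) ->
  \int[nu]_x g x = \int[mu]_x \int[theta]_z g (evol x mu z).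
Proof.
move=> munu mg g0; have me := mevol2 mu.
transitivity (\int[law me (mu \x theta)]_x g x).
  apply: eq_measure_integral => S mS _; apply: (etrans (munu _ mS)).
  rewrite -[RHS]/((mu \x theta) ((fun q => evol q.1 mu q.2) @^-1` S)).
  rewrite -[X in _ = _ X]setIT -integral_indic//; last first.
    by rewrite -[X in measurable X]setTI; exact: me.
  rewrite fubini_tonelli1//; last first.
    apply/measurable_EFinP/measurable_indic.
    by rewrite -[X in measurable X]setTI; exact: me.
  apply: eq_integral => x _; rewrite /fubini_F/=.
  rewrite -[X in theta X]setIT -integral_indic//.
  rewrite -[X in measurable X]setTI.
  exact: measurable_evol_noise.
rewrite integral_law// (fubini_tonelli1 (fun q => g (evol q.1 mu q.2)))//.
exact: (measurableT_comp mg).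
Qed.

(** Synchronous coupling: a near-optimal coupling of [mu1] and [mu2] is pushed forward with one
    common noise. The matrix contributes [a], and the drift contributes [delta * sigma] twice, once
    through the points and once through the measures. *)
Lemma coupling_evol mu1 mu2 nu1 nu2 (e : R) :
  finite_first_moment mu1 -> finite_first_moment mu2 ->
  Psi mu1 nu1 -> Psi mu2 nu2 -> (0 < e)%R ->
  exists2 pi, coupling nu1 nu2 pi &
    \int[pi]_p (enorm (vsub p.1 p.2))%:E <=
    ((a + 2 * delta * sigma) * (fine (W1 mu1 mu2) + e))%:E.
Proof.
move=> f1 f2 P1 P2 e0.
have WK := W1_fineK f1 f2.
have : W1 mu1 mu2 < (fine (W1 mu1 mu2) + e)%:E by rewrite -WK lte_fin ltrDl.
move=> /W1_lt_coupling[pi cpi piW].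
pose h (q : (vec R d * vec R d) * vec R m) := (evol q.1.1 mu1 q.2, evol q.1.2 mu2 q.2).
have mh : measurable_fun setT h.
  apply: measurable_fun_pair; apply: measurable_evol => //;
    exact: measurableT_comp.
have s0 : (0 <= sigma)%R by apply: sigmaD_ge0 DM.
have mpre (g : (vec R d * vec R d) * vec R m -> vec R d) B :
    measurable_fun setT g -> measurable B -> measurable (g @^-1` B).
  by move=> mg mB; rewrite -[X in measurable X]setTI; exact: mg.
have slice mu x B : measurable B -> measurable [set z | B (evol x mu z)].
  move=> mB; rewrite -[X in measurable X]setTI.
  exact: measurable_evol_noise.
have mslice mu B : measurable B ->
    measurable_fun setT (fun x => theta [set z | B (evol x mu z)]).
  move=> mB; have mX : measurable ((fun q : vec R d * vec R m => evol q.1 mu q.2) @^-1` B).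
    by rewrite -[X in measurable X]setTI; exact: mevol2.
  apply: eq_measurable_fun (measurable_fun_xsection theta mX) => x _ /=.
  by congr (theta _); apply/seteqP; split => z; rewrite /xsection/= inE.
exists (law mh (pi \x theta)); first split => B mB.
- rewrite P1//; rewrite -(coupling_integral_fst cpi)//; last exact: mslice.
  rewrite -[LHS]/((pi \x theta) (h @^-1` (B `*` setT))).
  rewrite -[X in _ X = _]setIT -integral_indic//; last first.
    by rewrite -[X in measurable X]setTI; apply: mh => //; exact: measurableX.
  rewrite fubini_tonelli1//; last first.
    apply/measurable_EFinP/measurable_indic.
    by rewrite -[X in measurable X]setTI; apply: mh => //; exact: measurableX.
  apply: eq_integral => p _; rewrite /fubini_F/= -[X in theta X]setIT.
  rewrite -integral_indic//; last exact: slice.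
  apply: eq_integral => z _; congr (_%:E).
  by rewrite !indicE; congr ((nat_of_bool _)%:R)%R; apply/idP/idP; rewrite !inE/=; [case|].
- rewrite P2//; rewrite -(coupling_integral_snd cpi)//; last exact: mslice.
  rewrite -[LHS]/((pi \x theta) (h @^-1` (setT `*` B))).
  rewrite -[X in _ X = _]setIT -integral_indic//; last first.
    by rewrite -[X in measurable X]setTI; apply: mh => //; exact: measurableX.
  rewrite fubini_tonelli1//; last first.
    apply/measurable_EFinP/measurable_indic.
    by rewrite -[X in measurable X]setTI; apply: mh => //; exact: measurableX.
  apply: eq_integral => p _; rewrite /fubini_F/= -[X in theta X]setIT.
  rewrite -integral_indic//; last exact: slice.
  apply: eq_integral => z _; congr (_%:E).
  by rewrite !indicE; congr ((nat_of_bool _)%:R)%R; apply/idP/idP; rewrite !inE/=; [case|].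
have mc : measurable_fun setT
    (fun p : vec R d * vec R d => (enorm (vsub p.1 p.2))%:E : \bar R).
  by apply/measurable_EFinP/measurable_enorm/measurable_vsub.
have c0 (p : vec R d * vec R d) : 0 <= (enorm (vsub p.1 p.2))%:E.
  by rewrite lee_fin enorm_ge0.
rewrite integral_law// fubini_tonelli1//; last exact: (measurableT_comp mc).
set W := fine (W1 mu1 mu2).
have W0 : (0 <= W)%R by rewrite fine_ge0// W1_ge0.
apply: (@le_trans _ _ (\int[pi]_p (((a + delta * sigma)%:E * (enorm (vsub p.1 p.2))%:E)
   + (delta * sigma * W)%:E))).
  apply: ge0_le_integral => //.
  - by move=> p _; apply: integral_ge0.
  - apply: measurable_fun_fubini_tonelli_F => //; exact: (measurableT_comp mc).
  - apply: emeasurable_funD => //; exact: measurable_funeM.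
  move=> p _; rewrite /fubini_F/=.
  have mg : measurable_fun setT
      (fun z => (enorm (vsub (f p.1 mu1 z) (f p.2 mu2 z)))%:E : \bar R).
    by apply/measurable_EFinP/measurable_enorm/measurable_vsub; exact: measurable_f.
  apply: (@le_trans _ _ (\int[theta]_z ((a * enorm (vsub p.1 p.2))%:E +
     delta%:E * (enorm (vsub (f p.1 mu1 z) (f p.2 mu2 z)))%:E))).
    apply: ge0_le_integral => //.
    - by move=> z _; rewrite lee_fin enorm_ge0.
    - by apply/measurable_EFinP/measurable_enorm/measurable_vsub;
        exact: measurable_evol_noise.
    - apply: emeasurable_funD => //; exact: measurable_funeM.
    move=> z _; rewrite -EFinM -EFinD lee_fin /evol vsub_affine.
    apply: (le_trans (enorm_vadd _ _)); rewrite enorm_vscale ger0_norm//.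
    by rewrite lerD2r.
  rewrite ge0_integralD//; first last.
  - exact: measurable_funeM.
  - by move=> z _; rewrite -EFinM lee_fin mulr_ge0// enorm_ge0.
  - by move=> z _; rewrite lee_fin mulr_ge0// enorm_ge0.
  rewrite integral_cst// [X in _ * X]probability_setT mule1 ge0_integralZl//; last first.
    by move=> z _; rewrite lee_fin enorm_ge0.
  apply: (@le_trans _ _ ((a * enorm (vsub p.1 p.2))%:E +
     delta%:E * (sigma * pdist p.1 mu1 p.2 mu2)%:E)).
    rewrite leeD2l// lee_wpmul2l//.
    by apply: (integral_lipschitz d0 f_eq M0 DM) => // x mu; exact: measurable_f.
  by rewrite -!EFinM -!EFinD lee_fin /pdist -/W; lra.
rewrite ge0_integralD//; first last.
- by move=> p _; rewrite lee_fin !mulr_ge0.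
- exact: measurable_funeM.
- by move=> p _; rewrite -EFinM lee_fin mulr_ge0 ?enorm_ge0// addr_ge0// mulr_ge0.
rewrite integral_cst// [X in _ + _ * X]probability_setT mule1 ge0_integralZl//; last first.
  by rewrite lee_fin addr_ge0// mulr_ge0.
apply: (@le_trans _ _ ((a + delta * sigma)%:E * (W + e)%:E + (delta * sigma * W)%:E)).
  rewrite leeD2r//; apply: lee_wpmul2l; last exact: ltW.
  by rewrite lee_fin addr_ge0// mulr_ge0.
rewrite -EFinM -EFinD lee_fin.
have : (0 <= delta * sigma * e)%R by rewrite !mulr_ge0// ltW.
by lra.
Qed.

(** The function $D_1$ of assumption (A6). *)
Definition drift0 z := enorm (f (vzero R d) (\d_(vzero R d) : probability _ R) z).

Lemma measurable_drift0 : measurable_fun setT drift0.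
Proof. by apply: measurable_enorm; exact: measurable_f. Qed.

Lemma dirac0_moment :
  \int[(\d_(vzero R d) : probability (vec R d) R)]_x (enorm x)%:E = 0.
Proof.
rewrite integral_dirac//; last exact/measurable_EFinP/measurable_enorm.
by rewrite diracT mul1e enorm0.
Qed.

(** Comparison with the base point formed by the origin and its Dirac mass, whose distance [W1] to
    [mu] is at most the first moment [c]. *)
Lemma evol_growth x mu z (c : R) : Dlip f z <= M%:E ->
  \int[mu]_y (enorm y)%:E = c%:E ->
  (enorm (evol x mu z) <= (a + delta * M) * enorm x + delta * M * c + delta * drift0 z)%R.
Proof.
move=> Dz muc.
have fmu : finite_first_moment mu by rewrite /finite_first_moment muc ltry.
have f0 : finite_first_moment (\d_(vzero R d) : probability (vec R d) R).
  by rewrite /finite_first_moment dirac0_moment ltry.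
have Wc : (fine (W1 mu (\d_(vzero R d) : probability (vec R d) R)) <= c)%R.
  rewrite -lee_fin W1_fineK//; apply: (le_trans (W1_le_moments _ _)).
  by rewrite muc dirac0_moment adde0.
have fb : (enorm (f x mu z) <= M * (enorm x + c) + drift0 z)%R.
  have := lipschitz_Dlip d0 f_eq x (vzero R d) Dz fmu f0.
  rewrite /pdist vsubx0 => l1.
  apply: (le_trans (enorm_le_vsub _
    (f (vzero R d) (\d_(vzero R d) : probability _ R) z))).
  rewrite lerD2r; apply: (le_trans l1).
  by rewrite ler_wpM2l// lerD2l.
apply: (le_trans (enorm_vadd _ _)); rewrite enorm_vscale (ger0_norm delta0).
have := ler_wpM2l delta0 fb; have := Aa x; lra.
Qed.

Lemma Psi_finite_first_moment mu nu : \int[theta]_z (drift0 z)%:E < +oo ->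
  finite_first_moment mu -> Psi mu nu -> finite_first_moment nu.
Proof.
move=> t0 fmu munu.
have me : measurable_fun setT (fun x : vec R d => (enorm x)%:E : \bar R).
  exact/measurable_EFinP/measurable_enorm.
have e0 (x : vec R d) : 0 <= (enorm x)%:E by rewrite lee_fin enorm_ge0.
have [c muc] : exists c, \int[mu]_x (enorm x)%:E = c%:E.
  exists (fine (\int[mu]_x (enorm x)%:E)); rewrite fineK// ge0_fin_numE//.
  exact: integral_ge0.
have c0 : (0 <= c)%R by rewrite -lee_fin -muc integral_ge0.
have md := measurable_drift0.
have b0 : (0 <= a + delta * M)%R by rewrite addr_ge0// mulr_ge0.
have g0 x : (0 <= (a + delta * M) * enorm x + delta * M * c)%R.
  by rewrite addr_ge0 ?mulr_ge0// enorm_ge0.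
rewrite /finite_first_moment (integral_Psi munu)//.
apply: (@le_lt_trans _ _ (\int[mu]_x
   (((a + delta * M)%:E * (enorm x)%:E + (delta * M * c)%:E) +
    delta%:E * \int[theta]_z (drift0 z)%:E))).
  have i0 : 0 <= \int[theta]_z (drift0 z)%:E.
    by apply: integral_ge0 => z _; rewrite lee_fin enorm_ge0.
  apply: ge0_le_integral => //.
  - by move=> x _; apply: integral_ge0.
  - apply: (measurable_fun_fubini_tonelli_F (m2 := theta)
      (fun q => (enorm (evol q.1 mu q.2))%:E)) => //.
    exact: (measurableT_comp me).
  - apply: emeasurable_funD => //; apply: emeasurable_funD => //.
    exact: measurable_funeM.
  move=> x _.
  rewrite -EFinM -EFinD -ge0_integralZl//; first last.
  - by move=> z _; rewrite lee_fin enorm_ge0.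
  - exact/measurable_EFinP.
  rewrite -[X in X + _]mule1 -[X in _ * X + _](probability_setT theta).
  rewrite -integral_cst// -ge0_integralD//; first last.
  - by apply: measurable_funeM; exact/measurable_EFinP.
  - by move=> z _; rewrite -EFinM lee_fin mulr_ge0// enorm_ge0.
  - by move=> z _; rewrite lee_fin.
  apply: ae_ge0_le_integral => //.
  - apply: (measurableT_comp me).
    exact: measurable_evol_noise.
  - by move=> z _; rewrite -EFinM -EFinD lee_fin addr_ge0// mulr_ge0// enorm_ge0.
  - apply: emeasurable_funD => //; apply: measurable_funeM; exact/measurable_EFinP.
  apply: filterS DM => z Dz _; rewrite -EFinM -EFinD lee_fin.
  exact: evol_growth.
rewrite ge0_integralD//; first last.
- move=> x _; rewrite mule_ge0// integral_ge0// => z _.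
  by rewrite lee_fin enorm_ge0.
- by apply: emeasurable_funD => //; exact: measurable_funeM.
- by move=> x _; rewrite -EFinM -EFinD lee_fin.
rewrite integral_cst// [X in _ + _ * X]probability_setT mule1 lte_add_pinfty//; last first.
  by rewrite lte_mul_pinfty.
rewrite ge0_integralD//; first last.
- by move=> x _; rewrite lee_fin !mulr_ge0.
- exact: measurable_funeM.
- by move=> x _; rewrite -EFinM lee_fin mulr_ge0// enorm_ge0.
rewrite integral_cst// [X in _ + _ * X]probability_setT mule1 ge0_integralZl//.
by rewrite muc -EFinM -EFinD ltry.
Qed.

End evolution.

Local Close Scope ereal_scope.

(** * Comparison of measures through finitely many cells *)

Section discrete_transport.
Context {R : realType} {N : nat} {T : finType}.
Variables (l : 'I_N -> T) (b : T -> R).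
Hypothesis N0 : (0 < N)%N.
Hypothesis b0 : forall t, 0 <= b t.
Hypothesis b1 : \sum_t b t = 1.

Definition freq t : R := \sum_(i | l i == t) N%:R^-1.

Let invN0 : 0 < N%:R^-1 :> R.
Proof. by rewrite invr_gt0 ltr0n. Qed.

Let freq_ge0 t : 0 <= freq t.
Proof. by apply: sumr_ge0 => i _; exact: ltW. Qed.

Let freq_gt0 i : 0 < freq (l i).
Proof. by rewrite /freq (bigD1 i)//= ltr_wpDr// sumr_ge0// => j _; exact: ltW. Qed.

Let sum_freq : \sum_t freq t = 1.
Proof.
transitivity (\sum_(i < N) N%:R^-1 : R); first by rewrite [RHS](partition_big l xpredT).
rewrite sumr_const card_ord.
by rewrite -(mulr_natl N%:R^-1) divff// pnatr_eq0 -lt0n.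
Qed.

Let excess t := Num.max (b t - freq t) 0.
Let surplus t := Num.max (freq t - b t) 0.

Let surplus_excess : \sum_t surplus t = \sum_t excess t.
Proof.
apply/eqP; rewrite -subr_eq0 -sumrB.
rewrite (eq_bigr (fun t => freq t - b t)) => [|t _].
  by rewrite sumrB sum_freq b1 subrr.
by rewrite /surplus /excess /Num.max; do 2!case: ifPn; rewrite -?leNgt; lra.
Qed.

Let excess_ge0 t : 0 <= excess t.
Proof. by rewrite le_max lexx orbT. Qed.

Let surplus_ge0 t : 0 <= surplus t.
Proof. by rewrite le_max lexx orbT. Qed.

Let total := \sum_t excess t.

Let total0 : 0 <= total.
Proof. exact: sumr_ge0. Qed.

Let kept i t := if l i == t then Num.min (freq t) (b t) / freq t * N%:R^-1 else 0.
Let share i := surplus (l i) / freq (l i) * N%:R^-1.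
Let moved i t := share i * (excess t / total).

Let sum_over_cell (c : T -> R) t : (freq t = 0 -> c t = 0) ->
  \sum_(i | l i == t) c (l i) / freq (l i) * N%:R^-1 = c t.
Proof.
move=> ct; rewrite (eq_bigr (fun=> c t / freq t * N%:R^-1)) => [|i /eqP-> //].
rewrite -mulr_sumr -/(freq t); have [ft|ft] := eqVneq (freq t) 0.
  by rewrite ft mulr0 ct.
by rewrite divfK.
Qed.

Let sum_share : \sum_i share i = total.
Proof.
rewrite /total -surplus_excess (partition_big l xpredT)//=.
apply: eq_bigr => t _; apply: sum_over_cell => ft.
by rewrite /surplus ft sub0r; apply/max_idPr; rewrite oppr_le0.
Qed.

(** Optimal transport of mass vectors for the discrete metric: [u] keeps the common mass
    [min freq b] in its cell, [v] carries the surplus of overfull cells to the deficient ones in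
    proportion to their deficits. Surplus and deficit have the same total because both vectors have
    mass one. *)
Lemma discrete_transport : exists u v : 'I_N -> T -> R,
  [/\ (forall i t, 0 <= u i t) /\ (forall i t, 0 <= v i t),
      forall i t, l i != t -> u i t = 0,
      forall i, \sum_t (u i t + v i t) = N%:R^-1,
      forall t, \sum_i (u i t + v i t) = b t &
      \sum_i \sum_t v i t = \sum_t Num.max (b t - freq t) 0].
Proof.
have share0 i : 0 <= share i by rewrite !mulr_ge0 ?invr_ge0// ltW.
have sum_moved i : \sum_t moved i t = share i.
  rewrite /moved -mulr_sumr -mulr_suml -/total.
  (* If nothing has to be moved every surplus vanishes, so dividing by [total = 0] does no harm. *)
  have [t0|t0] := eqVneq total 0; last by rewrite divff// mulr1.
  have : surplus (l i) <= 0.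
    rewrite -t0 /total -surplus_excess (bigD1 (l i))//= lerDl.
    by apply: sumr_ge0 => t _.
  rewrite le_eqVlt ltNge surplus_ge0 orbF => /eqP s0.
  by rewrite /share s0 !mul0r.
exists kept, moved; split => //.
- split => i t; last by rewrite /moved mulr_ge0// divr_ge0.
  rewrite /kept; case: ifP => // _; rewrite !mulr_ge0 ?invr_ge0// ?(ltW invN0)//.
  by rewrite le_min freq_ge0 b0.
- by move=> i t /negbTE lt; rewrite /kept lt.
- move=> i; rewrite big_split/= sum_moved (bigD1 (l i))//= big1 ?addr0; last first.
    by move=> t; rewrite eq_sym => /negbTE lt; rewrite /kept lt.
  rewrite /kept eqxx /share -mulrDl -mulrDl.
  have -> : Num.min (freq (l i)) (b (l i)) + surplus (l i) = freq (l i).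
    by rewrite /surplus /Num.max /Num.min; do 2!case: ifPn; rewrite -?leNgt; lra.
  by rewrite divff ?mul1r// gt_eqF.
- move=> t; rewrite big_split/= -mulr_suml sum_share.
  have -> : \sum_i kept i t = Num.min (freq t) (b t).
    rewrite /kept -big_mkcond/=.
    rewrite -[RHS](sum_over_cell (c := fun t => Num.min (freq t) (b t)))//; last first.
      by move=> ->; apply/min_idPl.
    by apply: eq_bigr => i /eqP ->.
  have -> : total * (excess t / total) = excess t.
    have [t0|t0] := eqVneq total 0; last by rewrite mulrC divfK.
    apply/esym/eqP; rewrite t0 mul0r eq_le excess_ge0 andbT -t0 /total.
    by rewrite (bigD1 t)//= lerDl sumr_ge0.
  by rewrite /excess /Num.max /Num.min; do 2!case: ifPn; rewrite -?leNgt; lra.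
- by rewrite -/total -sum_share; apply: eq_bigr => i _; exact: sum_moved.
Qed.

End discrete_transport.

Local Open Scope ereal_scope.

Section W1_cells.
Context {R : realType} {k N : nat} {T : finType}.
Variables (y : nat -> vec R k) (c : set (vec R k) -> \bar R).
Variables (pi : probability (vec R k * vec R k)%type R).
Variables (cell : vec R k -> option T) (rad B : R).
Hypothesis N0 : (0 < N)%N.
Hypothesis mcell : forall t, measurable [set z | cell z = t].
Hypothesis pic : forall A, measurable A -> pi (setT `*` A) = c A.
Hypothesis y_in : forall i, (i < N)%N -> cell (y i) <> None.
Hypothesis cell_diam : forall z z' t, cell z = Some t -> cell z' = Some t ->
  (enorm (vsub z z') <= rad)%R.
Hypothesis cell_in : forall z t, cell z = Some t -> (enorm z <= B)%R.
Hypothesis cell_out : forall z, cell z = None -> (B <= enorm z)%R.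
Hypothesis rad0 : (0 <= rad)%R.
Hypothesis B0 : (0 <= B)%R.

Definition cell_mass t : R := fine (pi [set p | cell p.1 = t]).
Let b := cell_mass.

(** The atoms are glued to the first marginal of [pi]. Mass kept in its cell travels at most [rad],
    mass moved inside the ball at most [2 * B], and mass sent to a point outside at most twice the
    norm of that point, since all atoms lie in the ball. *)
Lemma W1_cells :
  W1 (empirical N y) c <=
  (rad + 2 * B * \sum_t Num.max (cell_mass t - freq (fun i : 'I_N => cell (y i)) t) 0)%:E
  + 2%:E * \int[pi]_(p in [set p | cell p.1 = None]) (enorm p.1)%:E
  + \int[pi]_p (enorm (vsub p.1 p.2))%:E.
Proof.
have mD t : measurable [set p : vec R k * vec R k | cell p.1 = t].
  rewrite -[X in measurable X]setTI; exact: (measurable_fst measurableT _ (mcell t)).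
have bE t : (b t)%:E = pi [set p | cell p.1 = t].
  by rewrite fineK// fin_num_measure.
have b0 t : (0 <= b t)%R by rewrite fine_ge0.
have b1 : (\sum_t b t = 1)%R.
  apply/EFin_inj; rewrite -sumEFin -(probability_setT pi).
  rewrite [RHS](@measure_partition _ _ _ pi _ (fun p => cell p.1) setT mD)//.
  by apply: eq_bigr => t _; rewrite setTI bE.
have [u [v [[u0 v0] ul uvx uvb vtot]]] :=
  discrete_transport (fun i : 'I_N => cell (y i)) N0 b0 b1.
have w0 i t : (0 <= u i t + v i t)%R by rewrite addr_ge0.
have wb t : (\sum_i (u i t + v i t))%:E = pi [set p | cell p.1 = t].
  by rewrite uvb bE.
apply: (le_trans (W1_glue y N0 mcell w0 uvx wb pic)).
rewrite leeD2r// -vtot; under eq_bigr => i _ do under eq_bigr => t _ do rewrite uvb.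
set out := \int[pi]_(p in _) (enorm p.1)%:E.
have out0 : 0 <= out by apply: integral_ge0 => p _; rewrite lee_fin enorm_ge0.
have mfst i : measurable_fun setT
    (fun p : vec R k * vec R k => (enorm (vsub (y i) p.1))%:E : \bar R).
  by apply/measurable_EFinP/measurable_enorm/measurable_vsub.
have e0 i (p : vec R k * vec R k) : 0 <= (enorm (vsub (y i) p.1))%:E.
  by rewrite lee_fin enorm_ge0.
pose bd (i : 'I_N) (t : option T) : \bar R := (u i t * rad + v i t * (2 * B))%:E +
  (if t is None then ((u i t + v i t) / b t)%:E * (2%:E * out) else 0).
apply: (@le_trans _ _ (\sum_(i < N) \sum_t bd i t)).
  apply: lee_sum => i _; apply: lee_sum => t _; rewrite /bd.
  have q0 : (0 <= (u i t + v i t) / b t)%R by rewrite divr_ge0.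
  case: t q0 => [t|] q0; last first.
    rewrite -[leLHS]add0e leeD//.
      by rewrite lee_fin addr_ge0 ?mulr_ge0.
    apply: lee_wpmul2l; first by rewrite lee_fin.
    rewrite /out -ge0_integralZl//; first last.
    - by move=> p _; rewrite lee_fin enorm_ge0.
    - apply: measurable_funTS; exact/measurable_EFinP/measurable_enorm.
    apply: ge0_le_integral => //.
    - exact: measurable_funTS.
    - apply: measurable_funeM; apply: measurable_funTS.
      exact/measurable_EFinP/measurable_enorm.
    move=> p /= pN; rewrite -EFinM lee_fin.
    apply: (le_trans (enorm_vsub_le _ _)).
    have [s ys] : exists s, cell (y i) = Some s.
      by have := y_in (ltn_ord i); case: (cell (y i)) => // s _; exists s.
    by have := cell_in ys; have := cell_out pN; lra.
  rewrite adde0.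
  have int_le (e : R) :
      (forall p : vec R k * vec R k, cell p.1 = Some t -> (enorm (vsub (y i) p.1) <= e)%R) ->
      \int[pi]_(p in [set p | cell p.1 = Some t]) (enorm (vsub (y i) p.1))%:E <=
      (e * b (Some t))%:E.
    move=> ple; rewrite EFinM bE -integral_cst//.
    by apply: ge0_le_integral => //; exact: measurable_funTS.
  have wbK : ((u i (Some t) + v i (Some t)) / b (Some t) * b (Some t) =
      u i (Some t) + v i (Some t))%R.
    have [bt|bt] := eqVneq (b (Some t)) 0%R; last by rewrite divfK.
    rewrite bt mulr0; apply/esym; move: bt; rewrite -uvb => /psumr_eq0P; apply => //.
  have wle e : (\int[pi]_(p in [set p | cell p.1 = Some t]) (enorm (vsub (y i) p.1))%:E <=
      (e * b (Some t))%:E) ->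
    ((u i (Some t) + v i (Some t)) / b (Some t))%:E *
      \int[pi]_(p in [set p | cell p.1 = Some t]) (enorm (vsub (y i) p.1))%:E <=
    ((u i (Some t) + v i (Some t)) * e)%:E.
    move=> h; apply: (@le_trans _ _ (((u i (Some t) + v i (Some t)) / b (Some t))%:E *
      (e * b (Some t))%:E)); first by apply: lee_wpmul2l => //; rewrite lee_fin.
    by rewrite -EFinM (mulrC e) mulrA wbK.
  have [lt|lt] := eqVneq (cell (y i)) (Some t).
    (* Within one cell the distance is below both bounds, so the minimum serves kept and moved
       weight at once. *)
    have : ((u i (Some t) + v i (Some t)) * Num.min rad (2 * B) <=
        u i (Some t) * rad + v i (Some t) * (2 * B))%R.
      by rewrite mulrDl lerD// ler_wpM2l// ge_min lexx ?orbT.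
    rewrite -lee_fin; apply: le_trans; apply/wle/int_le => p pt.
    rewrite le_min (cell_diam lt pt)/=.
    apply: (le_trans (enorm_vsub_le _ _)).
    by have := cell_in lt; have := cell_in pt; lra.
  rewrite [X in (X * rad)%R]ul// mul0r add0r.
  apply: (le_trans (wle (2 * B)%R _)); last by rewrite lee_fin ul// add0r.
  apply: int_le => p pt; apply: (le_trans (enorm_vsub_le _ _)).
  have [s ys] : exists s, cell (y i) = Some s.
    by have := y_in (ltn_ord i); case: (cell (y i)) => // s _; exists s.
  by have := cell_in ys; have := cell_in pt; lra.
rewrite /bd; under eq_bigr do rewrite big_split/=; rewrite big_split/=; apply: leeD.
  under eq_bigr do rewrite sumEFin big_split/= -!mulr_suml.
  rewrite sumEFin big_split/= -!mulr_suml lee_fin [in leRHS]mulrC lerD2r.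
  rewrite ler_piMl// -b1; under [leRHS]eq_bigr do rewrite -uvb.
  by rewrite exchange_big/=; apply: ler_sum => t _; apply: ler_sum => i _; rewrite lerDl.
have -> : \sum_(i < N) \sum_(t : option T)
    (if t is None then ((u i t + v i t) / b t)%:E * (2%:E * out) else 0) =
    \sum_(i < N) ((u i None + v i None) / b None)%:E * (2%:E * out).
  by apply: eq_bigr => i _; rewrite (bigD1 None)//= big1 ?adde0// => -[].
rewrite -ge0_sume_distrl; last by move=> i _; rewrite lee_fin divr_ge0.
rewrite -[leRHS]mul1e; apply: lee_wpmul2r; first by rewrite mule_ge0.
rewrite sumEFin -mulr_suml uvb lee_fin.
have [->|bN] := eqVneq (b None) 0%R; first by rewrite mul0r.
by rewrite divff.
Qed.

End W1_cells.

Section ball_cells.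
Context {R : realType} {k : nat}.
Variables (B : R) (q : nat).
Hypothesis B0 : (0 < B)%R.
Hypothesis q0 : (0 < q)%N.

Let height (z : vec R k) (i : 'I_k) : R := ((tnth z i + B) * (q%:R / (2 * B)))%R.

(** A grid with [q] intervals per axis on [[-B, B]]; the upper endpoint has height exactly [q],
    hence the index type ['I_q.+1]. *)
Definition ball_cell (z : vec R k) : option {ffun 'I_k -> 'I_q.+1} :=
  if (enorm z <= B)%R then Some [ffun i => inord (Num.truncn (height z i))] else None.

Lemma ball_cell_in z t : ball_cell z = Some t -> (enorm z <= B)%R.
Proof. by rewrite /ball_cell; case: ifP. Qed.

Lemma ball_cell_out z : ball_cell z = None -> (B < enorm z)%R.
Proof. by rewrite /ball_cell; case: ifPn => //; rewrite -ltNge. Qed.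

Lemma ball_cell_some z : (enorm z <= B)%R -> ball_cell z <> None.
Proof. by rewrite /ball_cell => ->. Qed.

(** Heights with equal truncation differ by at most one, that is, by [2 * B / q] in the coordinate;
    the factor [k] comes from bounding the Euclidean norm by the sum of coordinates. *)
Lemma ball_cell_diam z z' t : ball_cell z = Some t -> ball_cell z' = Some t ->
  (enorm (vsub z z') <= k%:R * (2 * B / q%:R))%R.
Proof.
have hbound x i : (enorm x <= B)%R -> (0 <= height x i <= q%:R)%R.
  move=> xB; have := le_trans (le_coord_enorm x i) xB; rewrite ler_norml => /andP[l1 l2].
  have c0 : (0 <= q%:R / (2 * B))%R by rewrite divr_ge0// mulr_ge0// ltW.
  apply/andP; split; first by rewrite mulr_ge0//; lra.
  have -> : (q%:R = (2 * B) * (q%:R / (2 * B)) :> R)%R.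
    by rewrite mulrC divfK// gt_eqF// mulr_gt0.
  by rewrite ler_wpM2r//; lra.
rewrite /ball_cell; case: ifP => // zB [<-]; case: ifP => // z'B [].
move=> /ffunP same.
apply: (le_trans (enorm_le_sum _)).
apply: (@le_trans _ _ (\sum_(i < k) (2 * B / q%:R))%R); last first.
  by rewrite sumr_const card_ord -[leLHS]mulr_natl.
apply: ler_sum => i _; rewrite tnth_mktuple.
have /andP[h0 hq] := hbound _ i zB; have /andP[h0' hq'] := hbound _ i z'B.
have tr x : (0 <= x)%R -> (x <= q%:R)%R -> (Num.truncn x < q.+1)%N.
  move=> x0 xq; rewrite truncn_lt_nat//.
  by rewrite (le_lt_trans xq)// ltr_nat.
have : Num.truncn (height z i) = Num.truncn (height z' i).
  have := same i; rewrite !ffunE => /(congr1 (@nat_of_ord _)).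
  by rewrite !inordK ?tr.
move=> trE; have /andP[t1 t2] := truncn_itv h0; have /andP[t1' t2'] := truncn_itv h0'.
have hd : (`|height z i - height z' i| <= 1)%R.
  move: t1 t2 t1' t2'; rewrite trE -natr1 => t1 t2 t1' t2'.
  by rewrite ler_norml; lra.
have -> : (tnth z i - tnth z' i = (height z i - height z' i) * (2 * B / q%:R))%R.
  have cc : ((q%:R / (2 * B)) * (2 * B / q%:R) = 1)%R.
    by field; rewrite pnatr_eq0 -lt0n q0 gt_eqF.
  by rewrite /height -mulrBl -[RHS]mulrA cc mulr1; lra.
rewrite normrM (ger0_norm (_ : 0 <= 2 * B / q%:R)%R); last first.
  by rewrite divr_ge0// mulr_ge0// ltW.
by rewrite ler_piMl// divr_ge0// mulr_ge0// ltW.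
Qed.

Lemma measurable_ball_cell t : measurable [set z | ball_cell z = t].
Proof.
have me : measurable [set z : vec R k | (enorm z <= B)%R].
  have h : measurable_fun setT (fun z : vec R k => (enorm z <= B)%R).
    by apply: measurable_fun_ler => //; exact: measurable_enorm.
  by rewrite -[X in measurable X]setTI; exact: (h measurableT [set true]).
case: t => [t|]; last first.
  rewrite (_ : [set z | _] = ~` [set z : vec R k | (enorm z <= B)%R]); first exact: measurableC.
  by apply/seteqP; split => z /=; rewrite /ball_cell; case: ifP.
have mlt (i : 'I_k) n : measurable [set z : vec R k | (height z i < n%:R)%R].
  have h : measurable_fun setT (fun z : vec R k => (height z i < n%:R)%R).
    apply: measurable_fun_ltr => //; apply: measurable_funM => //.
    by apply: measurable_funD => //; exact: measurable_tnth.
  by rewrite -[X in measurable X]setTI; exact: (h measurableT [set true]).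
have mtr (i : 'I_k) n : measurable [set z : vec R k | Num.truncn (height z i) = n].
  (* [truncn] sends negative heights to zero, so level zero carries no lower constraint. *)
  rewrite (_ : [set z | _] = [set z : vec R k | (height z i < n.+1%:R)%R] `\`
     (if n is 0%N then set0 else [set z : vec R k | (height z i < n%:R)%R])).
    by apply: measurableD => //; case: n => // n.
  apply/seteqP; split => z /=.
    move=> <-; split; first exact: truncnS_gt.
    case E : (Num.truncn (height z i)) => [|n'] //=.
    by rewrite -truncn_le_nat E ltnn.
  case: n => [|n]; rewrite -truncn_le_nat => -[].
    by rewrite leqn0 => /eqP.
  move=> h1 /=; rewrite -truncn_le_nat => /negP; rewrite -ltnNge => h2.
  by apply/eqP; rewrite eqn_leq h1.
have mi (i : 'I_k) (j : 'I_q.+1) :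
    measurable [set z : vec R k | inord (Num.truncn (height z i)) = j].
  rewrite (_ : [set z | _] = \bigcup_n
    ([set z : vec R k | Num.truncn (height z i) = n] `&` [set z | inord n = j])).
    apply: bigcupT_measurable => n; apply: measurableI => //.
    have [nj|nj] := eqVneq (inord n) j.
      by rewrite (_ : [set _ | _] = setT)//; apply/seteqP; split.
    by rewrite (_ : [set _ | _] = set0)//; apply/seteqP; split => //= z; apply/eqP.
  apply/seteqP; split => z /=; first by move=> zj; exists (Num.truncn (height z i)).
  by move=> [n _ [-> ]].
rewrite (_ : [set z | _] = [set z : vec R k | (enorm z <= B)%R] `&`
   ~` \bigcup_i ~` [set z : vec R k | inord (Num.truncn (height z i)) = t i]).
  apply: measurableI => //; apply: measurableC.
  by apply: countable_bigcupT_measurable => // i; exact: measurableC.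
rewrite -setC_bigcap setCK; apply/seteqP; split => z /=; rewrite /ball_cell.
  by case: ifP => // zB [<-]; split => // i _ /=; rewrite ffunE.
move=> [-> h]; congr Some; apply/ffunP => i; rewrite ffunE; exact: h.
Qed.

End ball_cells.

(** The positive parts add up to the plain sum over the set where [b - a] is nonnegative. This turns
    the transported mass into finitely many one-sided events, one per union of cells. *)
Lemma sum_excess_subset {R : realType} {T : finType} (b a : T -> R) (tau : R) :
  (forall S : {set T}, \sum_(t in S) (b t - a t) <= tau)%R ->
  (\sum_t Num.max (b t - a t) 0 <= tau)%R.
Proof.
move=> h; apply: le_trans (h [set t | (0 <= b t - a t)%R]%SET).
rewrite [leRHS]big_mkcond/=; apply: ler_sum => t _.
rewrite inE; case: ifPn => h0; rewrite ge_max ?lexx//=.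
by rewrite andbT; move: h0; rewrite -ltNge => /ltW.
Qed.

Lemma measurable_fun_expR d (T : measurableType d) {R : realType} (g : T -> R) :
  measurable_fun setT g -> measurable_fun setT (fun t => expR (g t)).
Proof. by move=> mg; apply: measurableT_comp => //; exact: measurable_expR. Qed.

(** * One step for fixed configurations *)

Section one_step.
Context {R : realType} {d m : nat}.
Variables (A : 'M[R]_d) (delta : R).
Variable f : vec R d -> giry (vec R d) R -> vec R m -> vec R d.
Hypothesis mf : measurable_fun setT
  (fun p : (vec R d * giry (vec R d) R * vec R m)%type => f p.1.1 p.1.2 p.2).
Hypothesis d0 : (0 < d)%N.
Hypothesis f_eq : forall x (mu1 mu2 : giry (vec R d) R) z,
  meas_eq mu1 mu2 -> f x mu1 z = f x mu2 z.
Variable theta : probability (vec R m) R.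
Variables M a : R.
Hypothesis M0 : (0 <= M)%R.
Hypothesis DM : {ae theta, forall z, Dlip f z <= M%:E}.
Hypothesis delta0 : (0 <= delta)%R.
Hypothesis a0 : (0 <= a)%R.
Hypothesis Aa : forall x, (enorm (mxact A x) <= a * enorm x)%R.
Let sigma := sigmaD f theta.
Let F := evol A delta f.

Lemma exists_Psi (mu : probability (vec R d) R) :
  exists nu : probability (vec R d) R, Psi A delta f theta mu nu.
Proof.
have me : measurable_fun setT (fun q : vec R d * vec R m => F q.1 mu q.2).
  exact: measurable_evol.
exists (law me (mu \x theta)) => S mS.
rewrite -[LHS]/((mu \x theta) ((fun q => F q.1 mu q.2) @^-1` S)).
have mpre : measurable ((fun q : vec R d * vec R m => F q.1 mu q.2) @^-1` S).
  by rewrite -[X in measurable X]setTI; exact: me.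
rewrite -[X in _ X = _]setIT -integral_indic// fubini_tonelli1//; last first.
  by apply/measurable_EFinP/measurable_indic.
apply: eq_integral => x _; rewrite /fubini_F/=.
rewrite -[X in theta X]setIT -integral_indic//.
by rewrite -[X in measurable X]setTI; apply: measurable_evol_noise.
Qed.

Variables (N : nat) (x y : nat -> vec R d) (mu : probability (vec R d) R).
Variable nu : probability (vec R d) R.
Hypothesis N0 : (0 < N)%N.
Hypothesis fmu : finite_first_moment mu.
Hypothesis munu : Psi A delta f theta mu nu.
Let E := empirical N x.

Variables (B : R) (q : nat).
Hypothesis B0 : (0 < B)%R.
Hypothesis q0 : (0 < q)%N.
Let cell := @ball_cell R d B q.

(** With [x] fixed, the expected next cell frequencies; equally the cell masses of the image of
    [empirical N x] under the evolution. *)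
Definition step_mass t : R :=
  (N%:R^-1 * \sum_(i < N) fine (theta [set z | cell (F (x i) E z) = t]))%R.

Hypothesis y_in : forall i, (i < N)%N -> (enorm (y i) <= B)%R.

(** The image [nu1] of the old empirical measure mediates: it is coupled synchronously with [nu],
    and the new atoms are matched with it through cells. The mass of [nu1] outside the ball is an
    average over particles of the integrals bounded by [out]. *)
Lemma W1_one_step (tau out : R) :
  (\sum_t Num.max (step_mass t - freq (fun i : 'I_N => cell (y i)) t) 0 <= tau)%R ->
  (forall i, (i < N)%N ->
    \int[theta]_(z in [set z | (B < enorm (F (x i) E z))%R]) (enorm (F (x i) E z))%:E
    <= out%:E) ->
  W1 (empirical N y) nu <= ((a + 2 * delta * sigma) * fine (W1 E mu) +
    (d%:R * (2 * B / q%:R) + 2 * B * tau + 2 * out))%:E.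
Proof.
move=> exc outP.
have [nu1 Enu1] := exists_Psi E.
have fE : finite_first_moment E by exact: empirical_finite_first_moment.
have chi0 : (0 <= a + 2 * delta * sigma)%R.
  by rewrite addr_ge0// !mulr_ge0//; apply: sigmaD_ge0 DM.
have mcell t : measurable [set z | cell z = t] by exact: measurable_ball_cell.
have mFc i t : measurable [set z | cell (F (x i) E z) = t].
  by rewrite -[X in measurable X]setTI; apply: (measurable_evol_noise _ _ mf _ _ _ (mcell t)).
have slack (e : R) : (0 < e)%R -> W1 (empirical N y) nu <=
    ((a + 2 * delta * sigma) * (fine (W1 E mu) + e) +
    (d%:R * (2 * B / q%:R) + 2 * B * tau + 2 * out))%:E.
  move=> e0.
  have [pi cpi piW] := coupling_evol mf d0 f_eq M0 DM delta0 a0 Aa fE fmu Enu1 munu e0.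
  have nu1cell t : pi [set p | cell p.1 = t] = (step_mass t)%:E.
    have -> : [set p : vec R d * vec R d | cell p.1 = t] =
        [set z | cell z = t] `*` setT.
      by apply/seteqP; split => -[p1 p2] //= [].
    rewrite (proj1 cpi)// Enu1// (integral_empirical N0)//.
    - rewrite /step_mass EFinM -sumEFin; congr (_ * _); apply: eq_bigr => i _.
      by rewrite fineK// fin_num_measure.
    have mX : measurable ((fun r : vec R d * vec R m => F r.1 E r.2) @^-1`
        [set z | cell z = t]).
      by rewrite -[X in measurable X]setTI; apply: measurable_evol.
    apply: eq_measurable_fun (measurable_fun_xsection theta mX) => u _ /=.
    by congr (theta _); apply/seteqP; split => z; rewrite /xsection/= inE.
  have cmE t : cell_mass pi cell t = step_mass t by rewrite /cell_mass nu1cell.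
  have outE : \int[pi]_(p in [set p | cell p.1 = None]) (enorm p.1)%:E <= out%:E.
    pose g (z : vec R d) : \bar R := ((fun z => (enorm z)%:E) \_ [set z | cell z = None]) z.
    have mg : measurable_fun setT g.
      apply/(measurable_restrictT _ (mcell None)); apply: measurable_funTS.
      exact/measurable_EFinP/measurable_enorm.
    have g0 z : 0 <= g z by apply: erestrict_ge0 => u _; rewrite lee_fin enorm_ge0.
    rewrite integral_mkcond.
    have -> : \int[pi]_p ((fun p => (enorm p.1)%:E) \_ [set p | cell p.1 = None]) p =
        \int[pi]_p g p.1.
      by apply: eq_integral => p _; rewrite /g !patchE/=; congr (if _ then _ else _);
        apply/idP/idP; rewrite !inE.
    rewrite (coupling_integral_fst cpi)// (integral_Psi mf Enu1)//.
    rewrite (integral_empirical N0); last 2 first.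
    - apply: (measurable_fun_fubini_tonelli_F (m2 := theta)
        (fun r => g (evol A delta f r.1 E r.2))) => //.
      apply: (measurableT_comp mg); exact: measurable_evol.
    - by move=> u; apply: integral_ge0.
    apply: (@le_trans _ _ ((N%:R^-1)%:E * \sum_(i < N) out%:E)).
      apply: lee_wpmul2l; first by rewrite lee_fin invr_ge0.
      apply: lee_sum => i _; apply: le_trans (outP _ (ltn_ord i)).
      rewrite [leRHS]integral_mkcond le_eqVlt; apply/orP; left; apply/eqP.
      apply: eq_integral => z _; rewrite /g !patchE/=; congr (if _ then _ else _).
      apply/idP/idP; rewrite !inE/= => h; first exact: ball_cell_out h.
      rewrite /cell /ball_cell; case: ifPn => //.
      by rewrite leNgt h.
    rewrite sumEFin -EFinM lee_fin sumr_const card_ord -(mulr_natl out).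
    by rewrite mulKf// pnatr_eq0 -lt0n.
  have mcell' : forall t, measurable [set z | cell z = t] by [].
  have y_cell i : (i < N)%N -> cell (y i) <> None.
    by move=> iN; exact: ball_cell_some (y_in iN).
  have cdiam : forall z z' t, cell z = Some t -> cell z' = Some t ->
      (enorm (vsub z z') <= d%:R * (2 * B / q%:R))%R.
    by move=> z z' t; exact: ball_cell_diam.
  have cin : forall z t, cell z = Some t -> (enorm z <= B)%R.
    by move=> z t; exact: ball_cell_in.
  have cout : forall z, cell z = None -> (B <= enorm z)%R.
    by move=> z /ball_cell_out/ltW.
  have r0 : (0 <= d%:R * (2 * B / q%:R))%R.
    by rewrite mulr_ge0// divr_ge0// mulr_ge0// ltW.
  apply: (le_trans (W1_cells N0 mcell' (proj2 cpi) y_cell cdiam cin cout r0 (ltW B0))).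
  under eq_bigr do rewrite cmE.
  apply: (@le_trans _ _ ((d%:R * (2 * B / q%:R) + 2 * B * tau)%:E + 2%:E * out%:E +
    ((a + 2 * delta * sigma) * (fine (W1 E mu) + e))%:E)); last first.
    by rewrite -EFinM -!EFinD lee_fin; lra.
  apply: leeD => //; apply: leeD; last exact: lee_wpmul2l.
  by rewrite lee_fin lerD2l ler_wpM2l// mulr_ge0// ltW.
apply/lee_addgt0Pr => e e0.
pose h := (e / (a + 2 * delta * sigma + 1))%R.
have h0 : (0 < h)%R by rewrite divr_gt0// ltr_wpDl.
apply: (le_trans (slack h h0)); rewrite -EFinD lee_fin.
have : ((a + 2 * delta * sigma) * h <= e)%R.
  have -> : (e = (a + 2 * delta * sigma + 1) * h)%R.
    by rewrite /h mulrC divfK// gt_eqF// ltr_wpDl.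
  by apply: ler_wpM2r; [exact: ltW|rewrite lerDl].
by rewrite mulrDr; lra.
Qed.

End one_step.

Section truncation.
Context {R : realType} {d m : nat}.
Variables (A : 'M[R]_d) (delta : R).
Variable f : vec R d -> giry (vec R d) R -> vec R m -> vec R d.
Hypothesis mf : measurable_fun setT
  (fun p : (vec R d * giry (vec R d) R * vec R m)%type => f p.1.1 p.1.2 p.2).
Hypothesis d0 : (0 < d)%N.
Hypothesis f_eq : forall x (mu1 mu2 : giry (vec R d) R) z,
  meas_eq mu1 mu2 -> f x mu1 z = f x mu2 z.
Variable theta : probability (vec R m) R.
Variables M a : R.
Hypothesis M0 : (0 <= M)%R.
Hypothesis DM : {ae theta, forall z, Dlip f z <= M%:E}.
Hypothesis delta0 : (0 <= delta)%R.
Hypothesis delta_half : (delta <= 2^-1)%R.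
Hypothesis a0 : (0 <= a)%R.
Hypothesis Aa : forall x, (enorm (mxact A x) <= a * enorm x)%R.
Hypothesis rho1 : (a + 2 * delta * M <= 1)%R.
Let F := evol A delta f.

Variables (N : nat) (x : nat -> vec R d) (K : R).
Hypothesis N0 : (0 < N)%N.
Hypothesis K0 : (0 < K)%R.
Hypothesis xK : forall i, (i < N)%N -> (enorm (x i) <= K)%R.
Let E := empirical N x.

(** The weights [a + delta * M] of the particle and [delta * M] of the average add up to at most
    one, so a common radius [K] survives up to half the drift. *)
Lemma step_growth i z : (i < N)%N -> Dlip f z <= M%:E ->
  (enorm (F (x i) E z) <= K + drift0 f z / 2)%R.
Proof.
move=> iN Dz.
have avg : (N%:R^-1 * \sum_(j < N) enorm (x j) <= K)%R.
  rewrite mulrC ler_pdivrMr ?ltr0n// (le_trans (ler_sum _ (fun j _ => xK (ltn_ord j))))//.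
  by rewrite sumr_const card_ord -[leLHS]mulr_natr.
have := evol_growth d0 f_eq M0 delta0 Aa (x i) Dz (empirical_moment N0 x).
set c := (N%:R^-1 * _)%R in avg * => l1; apply: (le_trans l1).
have dM0 : (0 <= delta * M)%R by rewrite mulr_ge0.
have h1 : ((a + delta * M) * enorm (x i) <= (a + delta * M) * K)%R.
  by rewrite ler_wpM2l ?addr_ge0//; exact: xK.
have h2 : (delta * M * c <= delta * M * K)%R by rewrite ler_wpM2l.
have h3 : ((a + 2 * delta * M) * K <= 1 * K)%R by rewrite ler_wpM2r// ltW.
have h4 : (delta * drift0 f z <= 2^-1 * drift0 f z)%R.
  by rewrite ler_wpM2r// enorm_ge0.
lra.
Qed.

Lemma step_in_ball i z : (i < N)%N -> Dlip f z <= M%:E ->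
  (drift0 f z <= 2 * K)%R -> (enorm (F (x i) E z) <= 2 * K)%R.
Proof. by move=> iN Dz zK; apply: (le_trans (step_growth iN Dz)); lra. Qed.

(** On this event the drift exceeds [2 * K] and dominates the norm of the new point. With
    [s = alpha * drift0 f z], one has [s / 2 <= expR (s / 2)], and [s / 2 >= alpha * K] trades the
    other half of the exponential moment for [expR (- (alpha * K))]. *)
Lemma step_tail (alpha H : R) i : (0 < alpha)%R -> (i < N)%N ->
  \int[theta]_z (expR (alpha * drift0 f z))%:E <= H%:E ->
  \int[theta]_(z in [set z | (2 * K < enorm (F (x i) E z))%R]) (enorm (F (x i) E z))%:E
  <= (2 / alpha * H * expR (- (alpha * K)))%:E.
Proof.
move=> al0 iN hH.
have mn : measurable_fun setT (fun z => enorm (F (x i) E z)).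
  by apply: measurable_enorm; apply: measurable_evol_noise.
have mset : measurable [set z | (2 * K < enorm (F (x i) E z))%R].
  have h : measurable_fun setT (fun z => (2 * K < enorm (F (x i) E z))%R).
    exact: measurable_fun_ltr.
  by rewrite -[X in measurable X]setTI; exact: (h measurableT [set true]).
have md := measurable_drift0 mf.
have mexp : measurable_fun setT (fun z => (expR (alpha * drift0 f z))%:E : \bar R).
  by apply/measurable_EFinP/measurable_fun_expR/measurable_funM.
apply: (@le_trans _ _ (\int[theta]_z
   ((2 / alpha * expR (- (alpha * K)))%:E * (expR (alpha * drift0 f z))%:E))).
  rewrite integral_mkcond; apply: ae_ge0_le_integral => //.
  - by move=> z _; apply: erestrict_ge0 => u _; rewrite lee_fin enorm_ge0.
  - apply/(measurable_restrictT _ mset); apply: measurable_funTS.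
    exact/measurable_EFinP.
  - by move=> z _; rewrite -EFinM lee_fin !mulr_ge0 ?expR_ge0// invr_ge0 ltW.
  - exact: measurable_funeM.
  apply: filterS DM => z Dz _; rewrite patchE; case: ifPn; last first.
    by move=> _; rewrite -EFinM lee_fin !mulr_ge0 ?expR_ge0// invr_ge0 ltW.
  rewrite inE/= => big; rewrite -EFinM lee_fin.
  have g := step_growth iN Dz.
  have dK : (2 * K < drift0 f z)%R by lra.
  apply: (@le_trans _ _ (drift0 f z)); first lra.
  have e1 : (alpha * drift0 f z / 2 <= expR (alpha * drift0 f z / 2))%R.
    by rewrite (le_trans _ (expR_ge1Dx _))// lerDr.
  have e2 : (expR (alpha * drift0 f z / 2) <=
      expR (- (alpha * K)) * expR (alpha * drift0 f z))%R.
    rewrite -expRD ler_expR.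
    by have := ler_wpM2l (ltW al0) (ltW dK); lra.
  have dE : (drift0 f z = 2 / alpha * (alpha * drift0 f z / 2))%R.
    by field; rewrite gt_eqF.
  rewrite [leLHS]dE -[leRHS]mulrA; apply: ler_wpM2l; last exact: le_trans e1 e2.
  by rewrite divr_ge0// ltW.
rewrite ge0_integralZl//; last first.
  by rewrite lee_fin mulr_ge0 ?expR_ge0// divr_ge0// ltW.
apply: (@le_trans _ _ ((2 / alpha * expR (- (alpha * K)))%:E * H%:E)).
  by apply: lee_wpmul2l => //; rewrite lee_fin mulr_ge0 ?expR_ge0// divr_ge0// ltW.
by rewrite -EFinM lee_fin; lra.
Qed.

End truncation.

(** * Independence and concentration *)

Section freezing.
Context {R : realType} d0 {Omega : measurableType d0} (P : probability Omega R).
Context d1 {Z : measurableType d1} (theta : probability Z R).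
Variables (G : set (set Omega)) (eps : Omega -> Z).
Hypothesis GI : setI_closed G.
Hypothesis GT : G setT.
Hypothesis Gm : G `<=` measurable.
Hypothesis meps : measurable_fun setT eps.
Hypothesis indep : forall A B, G A -> measurable B ->
  P (A `&` eps @^-1` B) = P A * theta B.

Lemma g_sigma_algebra_sub (A : set (g_sigma_algebraType G)) :
  measurable A -> measurable (A : set Omega).
Proof. by apply: smallest_sub => //; exact: sigma_algebra_measurable. Qed.

(** Uniqueness of measures on a generating $\pi$-system: for fixed [B], both sides are finite
    measures in [A] that agree on [G]. *)
Lemma indep_g_sigma_algebra (A : set (g_sigma_algebraType G)) B :
  measurable A -> measurable B -> P (A `&` eps @^-1` B) = P A * theta B.
Proof.
move=> mA mB.
have meB : measurable (eps @^-1` B).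
  by rewrite -[X in measurable X]setTI; exact: meps.
have tB0 : (0 <= fine (theta B))%R by rewrite fine_ge0.
have : mrestr P meB A = mscale (NngNum tB0) P A.
  apply: (g_sigma_algebra_measure_unique G Gm (fun=> setT)) => //.
  - by rewrite bigcup_const.
  - move=> C GC; apply: (etrans (indep GC mB)).
    rewrite -[RHS]/((fine (theta B))%:E * P C) fineK ?fin_num_measure//.
    by rewrite muleC.
  - move=> _; have : P (setT `&` eps @^-1` B) < +oo; last by [].
    by rewrite setTI (le_lt_trans (probability_le1 _ _))// ltry.
move=> restrE; apply: (etrans restrE).
rewrite -[LHS]/((fine (theta B))%:E * P A) fineK ?fin_num_measure//.
by rewrite muleC.
Qed.

(** Substitute for conditional expectation. [Omega] is retyped with the sigma-algebra generated by
    [G], so measurability of [h] encodes dependence on the past only; the joint law with [eps] is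
    then a product and Tonelli applies. *)
Lemma integral_freezing (h : g_sigma_algebraType G * Z -> \bar R) :
  measurable_fun setT h -> (forall p, 0 <= h p) ->
  \int[P]_w h (w, eps w) = \int[P]_w \int[theta]_z h (w, z).
Proof.
move=> mh h0.
have mid : measurable_fun setT (id : Omega -> g_sigma_algebraType G).
  by move=> _ A mA; rewrite setTI; exact: g_sigma_algebra_sub.
pose P' := law mid P.
have mphi : measurable_fun setT (fun w => ((w, eps w) : g_sigma_algebraType G * Z)).
  exact: measurable_fun_pair.
rewrite -(integral_law mphi P mh h0).
transitivity (\int[P' \x theta]_p h p).
  apply/esym; apply: eq_measure_integral => X mX _.
  have prodE (A : set (g_sigma_algebraType G)) B : measurable A -> measurable B ->
      law mphi P (A `*` B) = P' A * theta B.
    by move=> mA mB; rewrite -[RHS](indep_g_sigma_algebra mA mB).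
  exact: (product_measure_unique prodE mX).
rewrite fubini_tonelli1// integral_law//.
- exact: measurable_fun_fubini_tonelli_F.
- by move=> w; apply: integral_ge0.
Qed.

End freezing.

Lemma chernoff {R : realType} d {T : measurableType d} (P : probability T R)
    (g : T -> R) (c : R) : measurable_fun setT g ->
  P [set w | (c < g w)%R] <= (expR (- c))%:E * \int[P]_w (expR (g w))%:E.
Proof.
move=> mg.
have mset : measurable [set w | (c < g w)%R].
  have h : measurable_fun setT (fun w => (c < g w)%R) by exact: measurable_fun_ltr.
  by rewrite -[X in measurable X]setTI; exact: (h measurableT [set true]).
have me : measurable_fun setT (fun w => (expR (g w))%:E : \bar R).
  exact/measurable_EFinP/measurable_fun_expR.
have ec0 : 0 <= (expR (- c))%:E by rewrite lee_fin expR_ge0.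
have e0 w : setT w -> 0 <= (expR (g w))%:E by rewrite lee_fin expR_ge0.
rewrite -(ge0_integralZl P measurableT me e0 ec0).
rewrite -[X in P X]setIT -integral_indic//.
apply: ge0_le_integral => //.
- exact/measurable_EFinP/measurable_indic.
- exact: measurable_funeM.
move=> w _; rewrite -EFinM lee_fin -expRD indicE.
have [|_] := boolP (w \in _); last exact: expR_ge0.
rewrite inE/= => cg; rewrite mulr1n.
by rewrite (le_trans _ (expR_ge1Dx _))// lerDl; lra.
Qed.

(** From [1 - u <= expR (- u)] one gets [expR u <= 1 / (1 - u)], and $(1+u+2u^2)(1-u) = 1 +
    u^2(1-2u)$ is at least one exactly in the allowed range, negative [u] included. *)
Lemma expR_le_quadratic {R : realType} (u : R) : (u <= 2^-1 ->
  expR u <= 1 + u + 2 * u ^+ 2)%R.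
Proof.
move=> u2; have u1 : (0 < 1 - u)%R by lra.
have : (expR u * (1 - u) <= 1)%R.
  rewrite -[leRHS](expRxMexpNx_1 u) ler_wpM2l ?expR_ge0//.
  exact: expR_ge1Dx.
rewrite -ler_pdivlMr// div1r => /le_trans; apply.
rewrite -div1r ler_pdivrMr//.
have : (0 <= u ^+ 2 * (1 - 2 * u))%R by rewrite mulr_ge0 ?sqr_ge0//; lra.
by rewrite expr2; lra.
Qed.

(** The centred variable takes two values; in the quadratic bounds the linear terms cancel and $1 +
    2\lambda^2 p(1-p)$ remains. *)
Lemma bernoulli_mgf {R : realType} d {T : measurableType d} (theta : probability T R)
    (U : set T) (lam : R) : measurable U -> (0 <= lam <= 2^-1)%R ->
  \int[theta]_z (expR (lam * (fine (theta U) - \1_U z)))%:E <= (expR (2 * lam ^+ 2))%:E.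
Proof.
move=> mU /andP[lam0 lam1]; set p := fine (theta U).
have pE : theta U = p%:E by rewrite fineK// fin_num_measure.
have p01 : (0 <= p <= 1)%R by rewrite -!lee_fin -pE measure_ge0 probability_le1.
have -> : \int[theta]_z (expR (lam * (p - \1_U z)))%:E =
    \int[theta]_z ((expR (lam * (p - 1)))%:E * (\1_U z)%:E +
                   (expR (lam * p))%:E * (\1_(~` U) z)%:E).
  apply: eq_integral => z _; rewrite -!EFinM -EFinD !indicE in_setC.
  by have [_|_] := boolP (z \in U); rewrite ?mulr1 ?mulr0 ?addr0 ?add0r ?subr0.
have mi (V : set T) : measurable V -> measurable_fun setT (fun z => (\1_V z)%:E : \bar R).
  by move=> mV; exact/measurable_EFinP/measurable_indic.
rewrite ge0_integralD//; first last.
- by apply: measurable_funeM; apply: mi; exact: measurableC.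
- by apply: measurable_funeM; exact: mi.
have mUC : measurable (~` U) by exact: measurableC.
rewrite !ge0_integralZl ?lee_fin ?expR_ge0//; try exact: mi.
have cE : theta (~` U) = (1 - p)%:E by rewrite probability_setC// pE.
rewrite !integral_indic// !setIT [X in _ * X + _]pE [X in _ + _ * X]cE.
rewrite -!EFinM -EFinD lee_fin.
have e1 : (expR (lam * (p - 1)) <= 1 + lam * (p - 1) + 2 * (lam * (p - 1)) ^+ 2)%R.
  by apply: expR_le_quadratic; nra.
have e2 : (expR (lam * p) <= 1 + lam * p + 2 * (lam * p) ^+ 2)%R.
  by apply: expR_le_quadratic; nra.
have p0 : (0 <= p)%R by case/andP: p01.
have p1 : (0 <= 1 - p)%R by case/andP: p01; lra.
apply: (le_trans (lerD (ler_wpM2r p0 e1) (ler_wpM2r p1 e2))).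
apply: (@le_trans _ _ (1 + 2 * lam ^+ 2)%R); last exact: expR_ge1Dx.
have l2 : (0 <= lam ^+ 2)%R by exact: sqr_ge0.
have : (0 <= lam ^+ 2 * (1 - p * (1 - p)))%R.
  by rewrite mulr_ge0//; nra.
rewrite !exprMn !expr2; nra.
Qed.

Section particles.
Context {R : realType} {d m : nat}.
Variables (A : 'M[R]_d) (delta : R).
Variable f : vec R d -> giry (vec R d) R -> vec R m -> vec R d.
Hypothesis mf : measurable_fun setT
  (fun p : (vec R d * giry (vec R d) R * vec R m)%type => f p.1.1 p.1.2 p.2).

(** Measurability into the space of probabilities is tested on evaluations, here finite averages of
    Dirac masses. *)
Lemma measurable_empirical d' (T : measurableType d') N (y : nat -> T -> vec R d) :
  (0 < N)%N -> (forall i, (i < N)%N -> measurable_fun setT (y i)) ->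
  measurable_fun setT (fun t => (empirical N (y ^~ t) : giry (vec R d) R)).
Proof.
move=> N0 my; apply: measurable_giry_codensity => // B mB.
apply: (eq_measurable_fun (fun t => (N%:R^-1)%:E * \sum_(i < N) \d_(y i t) B)).
  by move=> t _; apply/esym; exact: (empiricalE N0).
apply: measurable_funeM; apply: emeasurable_sum => i.
apply: (measurableT_comp (f := fun v => \d_v B) _ (my _ (ltn_ord i))).
exact: measurable_fun_dirac.
Qed.

Lemma measurable_particle d' (T : measurableType d')
    (X0 : nat -> nat -> T -> vec R d) (eps : nat -> nat -> T -> vec R m) N n :
  (forall i, (i < N)%N -> measurable_fun setT (X0 N i)) ->
  (forall n' i, (n' < n)%N -> (i < N)%N -> measurable_fun setT (eps n' i)) ->
  forall i, (i < N)%N -> measurable_fun setT (particle A delta f X0 eps N n i).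
Proof.
move=> mX0; elim: n => [|n IH] meps i iN; first exact: mX0.
have N0 : (0 < N)%N by exact: leq_ltn_trans iN.
have {}IH j : (j < N)%N -> measurable_fun setT (particle A delta f X0 eps N n j).
  by move=> jN; apply: IH => // n' k n'n kN; apply: meps => //; exact: ltnW.
apply: measurable_evol => //; [exact: IH| |exact: meps].
exact: measurable_empirical.
Qed.

End particles.

(** * The past of a noise variable *)

Section noise.
Context {R : realType} {d m : nat} d0 {Omega : measurableType d0}.
Variables (P : probability Omega R) (theta : probability (vec R m) R).
Variables (X0 : nat -> nat -> Omega -> vec R d) (eps : nat -> nat -> Omega -> vec R m).
Hypothesis mX0 : forall N i, (i < N)%N -> measurable_fun setT (X0 N i).
Hypothesis meps : forall n i, measurable_fun setT (eps n i).
Hypothesis iid : iid_indep_noise P theta X0 eps.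

Definition noise_cyl (F : seq (nat * nat)) (As : nat * nat -> set (vec R m)) :=
  [set w | forall k, k \in F -> As k (eps k.1 k.2 w)].
Definition init_cyl (G : seq (nat * nat)) (Bs : nat * nat -> set (vec R d)) :=
  [set w | forall k, k \in G -> Bs k (X0 k.1 k.2 w)].

Variable k0 : nat * nat.

(* A pi-system for the past of the noise [k0], the other noises of the same time
   step included. *)
Definition cylinders : set (set Omega) := [set C | exists F As G Bs,
  [/\ [/\ uniq F, k0 \notin F & all (fun k => (k.2 < k.1)%N) G],
      (forall k, measurable (As k)), (forall k, measurable (Bs k)) &
      C = noise_cyl F As `&` init_cyl G Bs]].

Lemma measurable_noise_cyl F As : (forall k, measurable (As k)) ->
  measurable (noise_cyl F As).
Proof.
move=> mAs; rewrite (_ : noise_cyl F As =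
  ~` \bigcup_(k in [set k | k \in F]) ~` (eps k.1 k.2 @^-1` As k)).
  apply/measurableC; rewrite bigcup_seq; apply: bigsetU_measurable => k _.
  by apply/measurableC; rewrite -[X in measurable X]setTI; exact: meps.
by rewrite -setC_bigcap setCK.
Qed.

Lemma measurable_init_cyl G Bs : all (fun k => (k.2 < k.1)%N) G ->
  (forall k, measurable (Bs k)) -> measurable (init_cyl G Bs).
Proof.
move=> /allP Glt mBs; rewrite (_ : init_cyl G Bs =
  ~` \bigcup_(k in [set k | k \in G]) ~` (X0 k.1 k.2 @^-1` Bs k)).
  apply: measurableC; rewrite bigcup_seq big_seq; apply: bigsetU_measurable => k kG.
  by apply/measurableC; rewrite -[X in measurable X]setTI; apply: mX0 => //; exact: Glt.
by rewrite -setC_bigcap setCK.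
Qed.

Lemma cylinders_measurable : cylinders `<=` measurable.
Proof.
move=> _ [F [As [G [Bs [[_ _ Glt] mAs mBs ->]]]]].
by apply: measurableI; [exact: measurable_noise_cyl|exact: measurable_init_cyl].
Qed.

Lemma cylindersT : cylinders setT.
Proof.
exists [::], (fun=> setT), [::], (fun=> setT); split => //.
by apply/seteqP; split.
Qed.

(** A coordinate absent from one list is constrained by [setT]; [undup] restores the distinct noise
    indices that the product rule demands. *)
Lemma cylindersI : setI_closed cylinders.
Proof.
move=> C1 C2 [F1 [A1 [G1 [B1 [[u1 n1 l1] mA1 mB1 ->]]]]].
move=> [F2 [A2 [G2 [B2 [[u2 n2 l2] mA2 mB2 ->]]]]].
exists (undup (F1 ++ F2)), (fun k => (if k \in F1 then A1 k else setT) `&`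
  (if k \in F2 then A2 k else setT)), (G1 ++ G2),
  (fun k => (if k \in G1 then B1 k else setT) `&` (if k \in G2 then B2 k else setT)).
split.
- split; first exact: undup_uniq.
    by rewrite mem_undup mem_cat negb_or n1.
  by rewrite all_cat l1.
- by move=> k; apply: measurableI; case: ifP.
- by move=> k; apply: measurableI; case: ifP.
apply/seteqP; split => w /=.
  move=> [[a1 b1] [a2 b2]]; split => k; rewrite ?mem_undup mem_cat => _.
    by split; case: ifP => // ?; [exact: a1|exact: a2].
  by split; case: ifP => // ?; [exact: b1|exact: b2].
move=> [a b]; split; split => k kF.
- by have := a k; rewrite mem_undup mem_cat kF => /(_ isT)[].
- by have := b k; rewrite mem_cat kF => /(_ isT)[].
- by have := a k; rewrite mem_undup mem_cat kF orbT => /(_ isT)[].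
- by have := b k; rewrite mem_cat kF orbT => /(_ isT)[].
Qed.

(** As [k0] is not in [F], the event [B] becomes one more factor in the product rule, which is
    applied with and without it. *)
Lemma cylinders_indep C B : cylinders C -> measurable B ->
  P (C `&` eps k0.1 k0.2 @^-1` B) = P C * theta B.
Proof.
move=> [F [As [G [Bs [[uF k0F Glt] mAs mBs ->]]]]] mB.
pose As' k := if k == k0 then B else As k.
have As'E k : k \in F -> As' k = As k.
  by rewrite /As'; case: eqP => // -> kF; rewrite kF in k0F.
have -> : noise_cyl F As `&` init_cyl G Bs `&` eps k0.1 k0.2 @^-1` B =
    noise_cyl (k0 :: F) As' `&` init_cyl G Bs.
  apply/seteqP; split => w /=.
    move=> [[a b] c]; split => // k; rewrite in_cons => /orP[/eqP ->|kF].
      by rewrite /As' eqxx.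
    by rewrite As'E//; exact: a.
  move=> [a b]; split; first split => // k kF.
    by rewrite -As'E//; apply: a; rewrite in_cons kF orbT.
  by have := a k0; rewrite in_cons eqxx /As' eqxx => /(_ isT).
have mAs' k : measurable (As' k) by rewrite /As'; case: ifP.
rewrite [LHS](iid _ mAs' Glt mBs) /=; last by rewrite k0F.
rewrite [in RHS](iid uF mAs Glt mBs) big_cons {1}/As' eqxx.
rewrite (eq_big_seq (fun k => theta (As k))); last by move=> k /As'E ->.
by rewrite -!muleA muleC -!muleA.
Qed.

Lemma measurable_noise_past n i : (n, i) != k0 ->
  measurable_fun setT (eps n i : g_sigma_algebraType cylinders -> vec R m).
Proof.
move=> ni _ B mB; rewrite setTI; apply: sub_sigma_algebra.
exists [:: (n, i)], (fun=> B), [::], (fun=> setT); split => //.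
  by split => //; rewrite inE eq_sym.
apply/seteqP; split => w /=.
  by move=> wB; split => // k; rewrite inE => /eqP ->.
by move=> [h _]; apply: (h (n, i)); rewrite inE.
Qed.

Lemma measurable_init_past N i : (i < N)%N ->
  measurable_fun setT (X0 N i : g_sigma_algebraType cylinders -> vec R d).
Proof.
move=> iN _ B mB; rewrite setTI; apply: sub_sigma_algebra.
exists [::], (fun=> setT), [:: (N, i)], (fun=> B); split => //.
  by split => //=; rewrite iN.
apply/seteqP; split => w /=.
  by move=> wB; split => // k; rewrite inE => /eqP ->.
by move=> [_ h]; apply: (h (N, i)); rewrite inE.
Qed.

End noise.

Lemma measure_bigsetU_le {R : realType} d {T : measurableType d} (P : probability T R)
    (I : Type) (s : seq I) (C : I -> set T) (e : \bar R) :
  (forall i, measurable (C i)) -> (forall i, P (C i) <= e) -> 0 <= e ->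
  P (\big[setU/set0]_(i <- s) C i) <= (size s)%:R%:E * e.
Proof.
move=> mC Ce e0; elim: s => [|i s IH]; first by rewrite big_nil measure0 mul0e.
rewrite big_cons /= -natr1 addrC EFinD ge0_muleDl ?lee_fin// mul1e.
apply: le_trans (measureU2 _ _ _) _ => //; first exact: bigsetU_measurable.
by apply: leeD; [exact: Ce|exact: IH].
Qed.

Lemma measurable_fun_indic {R : realType} d d' (T : measurableType d)
    (T' : measurableType d') (U : set T') (g : T -> T') : measurable U ->
  measurable_fun setT g -> measurable_fun setT (fun t => \1_U (g t) : R).
Proof. by move=> mU mg; apply: measurableT_comp => //; exact: measurable_indic. Qed.

(** * Concentration of the number of particles in a set *)

Section particle_system.
Context {R : realType} {d m : nat} {d0 : measure_display} {Omega : measurableType d0}.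
Variables (A : 'M[R]_d) (delta : R).
Variable f : vec R d -> giry (vec R d) R -> vec R m -> vec R d.
Hypothesis mf : measurable_fun setT
  (fun p : (vec R d * giry (vec R d) R * vec R m)%type => f p.1.1 p.1.2 p.2).
Variables (P : probability Omega R) (theta : probability (vec R m) R).
Variables (X0 : nat -> nat -> Omega -> vec R d) (eps : nat -> nat -> Omega -> vec R m).
Hypothesis mX0 : forall N i, (i < N)%N -> measurable_fun setT (X0 N i).
Hypothesis meps : forall n i, measurable_fun setT (eps n i).
Hypothesis iid : iid_indep_noise P theta X0 eps.
Let F := evol A delta f.

Lemma noise_law n i (B : set (vec R m)) : measurable B ->
  P (eps n i @^-1` B) = theta B.
Proof.
move=> mB.
have := iid (F := [:: (n, i)]) (Aset := fun=> B) (G := [::]) (B := fun=> setT)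
  isT (fun=> mB) isT (fun=> measurableT).
rewrite big_cons big_nil mule1.
rewrite (_ : [set w | forall k, k \in [::] -> setT (X0 k.1 k.2 w)] = setT); last first.
  by apply/seteqP; split.
rewrite setIT probability_setT mule1 => <-; congr (P _); apply/seteqP; split => w /=.
  by move=> wB k; rewrite inE => /eqP ->.
by move=> h; apply: (h (n, i)); rewrite inE.
Qed.

Lemma integral_noise n i (g : vec R m -> \bar R) : measurable_fun setT g ->
  (forall z, 0 <= g z) -> \int[P]_w g (eps n i w) = \int[theta]_z g z.
Proof.
move=> mg g0; rewrite -(integral_law (meps n i) P mg g0).
by apply: eq_measure_integral => B mB _; exact: noise_law.
Qed.

Lemma ae_noise n i (Q : vec R m -> Prop) :
  {ae theta, forall z, Q z} -> {ae P, forall w, Q (eps n i w)}.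
Proof.
move=> [B [mB B0 QB]]; exists (eps n i @^-1` B); split.
- by rewrite -[X in measurable X]setTI; exact: meps.
- by rewrite noise_law.
- by move=> w /= nQ; apply: QB.
Qed.

Variables (N n : nat).
Hypothesis N0 : (0 < N)%N.

Let xs i w := particle A delta f X0 eps N n i w.
Let xs' i w := particle A delta f X0 eps N n.+1 i w.
Let E w := empirical N (fun i => xs i w).

Let mxs i : (i < N)%N -> measurable_fun setT (xs i).
Proof. by move=> iN; apply: measurable_particle => // j; exact: mX0. Qed.

Definition hit_prob (S : set (vec R d)) x (mu : giry (vec R d) R) : R :=
  fine (theta [set z | S (F x mu z)]).

Let mevol_preimage (S : set (vec R d)) x (mu : giry (vec R d) R) :
  measurable S -> measurable [set z | S (F x mu z)].
Proof.
move=> mS; rewrite -[X in measurable X]setTI.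
exact: (measurable_evol_noise A delta mf x mu measurableT mS).
Qed.

Lemma measurable_hit_prob d' (T : measurableType d') (S : set (vec R d))
    (g : T -> vec R d) (h : T -> giry (vec R d) R) : measurable S ->
  measurable_fun setT g -> measurable_fun setT h ->
  measurable_fun setT (fun t => hit_prob S (g t) (h t)).
Proof.
move=> mS mg mh; apply/measurable_EFinP.
have mX : measurable ((fun r : T * vec R m => F (g r.1) (h r.1) r.2) @^-1` S).
  rewrite -[X in measurable X]setTI; apply: measurable_evol => //.
    exact: measurableT_comp.
  exact: measurableT_comp.
apply: eq_measurable_fun (measurable_fun_xsection theta mX) => t _ /=.
rewrite /hit_prob fineK; last first.
  by apply: fin_num_measure; exact: mevol_preimage.
by congr (theta _); apply/seteqP; split => z; rewrite /xsection/= inE.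
Qed.

(** Given the past, a centred Bernoulli variable; the sign is such that a large average means that
    too few particles have reached [S]. *)
Definition deviation S i w : R := (hit_prob S (xs i w) (E w) - \1_S (xs' i w))%R.

Lemma measurable_deviation S i : measurable S -> (i < N)%N ->
  measurable_fun setT (deviation S i).
Proof.
move=> mS iN; apply: measurable_funB.
  apply: measurable_hit_prob => //; first exact: mxs.
  by apply: measurable_empirical => // j; exact: mxs.
apply: (measurable_fun_indic mS).
by apply: measurable_particle => // j; exact: mX0.
Qed.

Lemma deviation_le1 S i w : measurable S -> (deviation S i w <= 1)%R.
Proof.
move=> mS; have h1 : (hit_prob S (xs i w) (E w) <= 1)%R.
  rewrite /hit_prob -lee_fin fineK.
    by apply: probability_le1; exact: mevol_preimage.
  by apply: fin_num_measure; exact: mevol_preimage.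
by rewrite /deviation lerBlDr (le_trans h1)// lerDl indicE.
Qed.

Lemma mgf_deviation S lam K : measurable S -> (0 <= lam <= 2^-1)%R -> (K <= N)%N ->
  \int[P]_w (expR (lam * \sum_(i < K) deviation S i w))%:E <=
  (expR (2 * lam ^+ 2 * K%:R))%:E.
Proof.
move=> mS lam01; elim: K => [|K IH] KN.
  under eq_integral do rewrite big_ord0 mulr0 expR0.
  by rewrite integral_cst// [X in _ * X]probability_setT mule1 mulr0 expR0.
pose G := cylinders X0 eps (n, K).
have GI : setI_closed G by exact: cylindersI.
have GT : G setT by exact: cylindersT.
have Gm : G `<=` measurable by exact: cylinders_measurable.
pose O := g_sigma_algebraType G.
have mxsO i : (i < N)%N -> measurable_fun setT (xs i : O -> vec R d).
  move=> iN; apply: (@measurable_particle R d m A delta f mf _ O X0 eps) => //.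
    by move=> j jN; exact: measurable_init_past.
  move=> n' j n'n jN; apply: measurable_noise_past.
  by apply/eqP => -[nn' _]; rewrite nn' ltnn in n'n.
have mEO : measurable_fun setT (E : O -> giry (vec R d) R).
  exact: (@measurable_empirical _ _ _ O).
(* Particle [i < K] consumes the noise [(n, i)], distinct from [(n, K)], so its deviation belongs to
   the past as well. *)
have mdevO i : (i < K)%N -> measurable_fun setT (deviation S i : O -> R).
  move=> iK; have iN : (i < N)%N by exact: ltn_trans iK KN.
  apply: measurable_funB.
    by apply: measurable_hit_prob => //; exact: mxsO.
  apply: (measurable_fun_indic mS).
  apply: measurable_evol => //; first exact: mxsO.
  apply: measurable_noise_past; apply/eqP => -[iK'].
  by rewrite iK' ltnn in iK.
pose h (p : O * vec R m) : \bar R := (expR (lam * \sum_(i < K) deviation S i p.1) *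
  expR (lam * (hit_prob S (xs K p.1) (E p.1) - \1_S (F (xs K p.1) (E p.1) p.2))))%:E.
have mpast : measurable_fun setT
    (fun w : O => (expR (lam * \sum_(i < K) deviation S i w))%R).
  apply: measurable_fun_expR; apply: measurable_funM => //.
  by apply: measurable_sum => i; exact: mdevO.
have mfst : measurable_fun setT (fst : O * vec R m -> O) by exact: measurable_fst.
have mh : measurable_fun setT h.
  apply/measurable_EFinP; apply: measurable_funM.
    exact: (measurableT_comp mpast mfst).
  apply: measurable_fun_expR; apply: measurable_funM => //; apply: measurable_funB.
    apply: measurable_hit_prob => //; last exact: (measurableT_comp mEO mfst).
    exact: (measurableT_comp (mxsO K KN) mfst).
  apply: (measurable_fun_indic mS).
  apply: measurable_evol => //; last exact: (measurableT_comp mEO mfst).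
  exact: (measurableT_comp (mxsO K KN) mfst).
have h0 p : 0 <= h p by rewrite lee_fin mulr_ge0// expR_ge0.
have -> : \int[P]_w (expR (lam * \sum_(i < K.+1) deviation S i w))%:E =
    \int[P]_w h (w, eps n K w).
  apply: eq_integral => w _; rewrite /h/= big_ord_recr/= mulrDr expRD.
  by [].
have indep C B : G C -> measurable B ->
    P (C `&` eps n K @^-1` B) = P C * theta B.
  by move=> GC mB; exact: (cylinders_indep iid GC mB).
rewrite (integral_freezing GI GT Gm (meps n K) indep mh h0).
apply: (@le_trans _ _ (\int[P]_w ((expR (2 * lam ^+ 2))%:E *
    (expR (lam * \sum_(i < K) deviation S i w))%:E))).
  apply: ge0_le_integral => //.
  - by move=> w _; apply: integral_ge0.
  - have mO : measurable_fun setT (fun w : O => \int[theta]_z h (w, z)).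
      exact: (measurable_fun_fubini_tonelli_F (m2 := theta) h).
    move=> _ B mB; rewrite setTI; apply: (g_sigma_algebra_sub Gm).
    by have := mO measurableT B mB; rewrite setTI.
  - apply: measurable_funeM; apply/measurable_EFinP/measurable_fun_expR.
    apply: measurable_funM => //; apply: measurable_sum => i.
    by apply: measurable_deviation => //; exact: ltn_trans (ltn_ord i) KN.
  move=> w _; rewrite /h/=.
  under eq_integral do rewrite EFinM.
  have mU : measurable [set z | S (F (xs K w) (E w) z)] by exact: mevol_preimage.
  rewrite ge0_integralZl//; first last.
  - apply/measurable_EFinP/measurable_fun_expR/measurable_funM => //.
    apply: measurable_funB => //.
    apply: (measurable_fun_indic mS).
    exact: measurable_evol_noise.
  rewrite muleC; apply: lee_wpmul2r; first by rewrite lee_fin expR_ge0.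
  by apply: le_trans (bernoulli_mgf theta mU lam01).
rewrite ge0_integralZl//; first last.
- apply/measurable_EFinP/measurable_fun_expR.
  apply: measurable_funM => //; apply: measurable_sum => i.
  by apply: measurable_deviation => //; exact: ltn_trans (ltn_ord i) KN.
apply: (@le_trans _ _ ((expR (2 * lam ^+ 2))%:E * (expR (2 * lam ^+ 2 * K%:R))%:E)).
  by apply: lee_wpmul2l; [rewrite lee_fin expR_ge0|apply: IH; exact: ltnW].
by rewrite -EFinM lee_fin -expRD ler_expR -natr1; lra.
Qed.

(** Chernoff at [lam = t / 4], the minimiser of $2\lambda^2 - \lambda t$, with value $-t^2/8$. It is
    in the range of [mgf_deviation] only for [t <= 2]; beyond that the event is empty because
    deviations are at most one. *)
Lemma hoeffding_deviation S (t : R) : measurable S -> (0 < t)%R ->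
  P [set w | (t < N%:R^-1 * \sum_(i < N) deviation S i w)%R] <=
  (expR (- (t ^+ 2 / 8 * N%:R)))%:E.
Proof.
move=> mS t0; have NR : (0 < N%:R :> R)%R by rewrite ltr0n.
have [t2|t2] := leP t 2%R; last first.
  rewrite (_ : [set w | _] = set0) ?measure0 ?lee_fin ?expR_ge0//.
  apply/seteqP; split => // w /= h.
  have : (N%:R^-1 * \sum_(i < N) deviation S i w <= 1)%R.
    rewrite mulrC ler_pdivrMr// mul1r.
    apply: (@le_trans _ _ (\sum_(i < N) 1)%R).
      by apply: ler_sum => i _; exact: deviation_le1.
    by rewrite sumr_const card_ord.
  by lra.
have mg : measurable_fun setT (fun w => (t / 4 * \sum_(i < N) deviation S i w)%R).
  by apply: measurable_funM => //; apply: measurable_sum => i; exact: measurable_deviation.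
have -> : [set w | (t < N%:R^-1 * \sum_(i < N) deviation S i w)%R] =
    [set w | (t / 4 * (t * N%:R) < t / 4 * \sum_(i < N) deviation S i w)%R].
  have avgE s : (t < N%:R^-1 * s)%R = (t * N%:R < s)%R by rewrite mulrC ltr_pdivlMr.
  by apply/seteqP; split => w /=; rewrite ltr_pM2l ?divr_gt0// avgE.
apply: (le_trans (chernoff P _ mg)).
apply: (@le_trans _ _ ((expR (- (t / 4 * (t * N%:R))))%:E *
   (expR (2 * (t / 4) ^+ 2 * N%:R))%:E)).
  apply: lee_wpmul2l; first by rewrite lee_fin expR_ge0.
  by apply: mgf_deviation => //; rewrite divr_ge0 ?(ltW t0)//=; lra.
by rewrite -EFinM lee_fin -expRD ler_expR expr2; lra.
Qed.

End particle_system.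

(** Jensen's inequality by the tangent line of [expR] at the barycentre [c], whose linear parts
    cancel in the sum. *)
Lemma expR_convex_mean {R : realType} N (p1 p2 p3 u w : R) (v : 'I_N -> R) :
  (0 < N)%N -> (0 <= p1)%R -> (0 <= p2)%R -> (0 <= p3)%R -> (p1 + p2 + p3 = 1)%R ->
  (expR (p1 * u + p2 * (N%:R^-1 * \sum_i v i) + p3 * w) <=
   p1 * expR u + p2 * (N%:R^-1 * \sum_i expR (v i)) + p3 * expR w)%R.
Proof.
move=> N0 p10 p20 p30 p1E; set c := (_ + p3 * w)%R.
have tangent s : (expR c * (1 + (s - c)) <= expR s)%R.
  have -> : (expR s = expR c * expR (s - c))%R by rewrite -expRD addrC subrK.
  by apply: ler_wpM2l; [exact: expR_ge0|exact: expR_ge1Dx].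
have avg : (expR c * (1 + (N%:R^-1 * \sum_i v i - c)) <= N%:R^-1 * \sum_i expR (v i))%R.
  have NN : (N%:R != 0 :> R)%R by rewrite pnatr_eq0 -lt0n.
  rewrite ler_pdivlMl ?ltr0n//.
  have -> : (N%:R * (expR c * (1 + (N%:R^-1 * \sum_i v i - c))) =
      \sum_(i < N) expR c * (1 + (v i - c)))%R.
    rewrite -mulr_sumr big_split/= sumrB !sumr_const card_ord -(mulr_natl c).
    by field.
  by apply: ler_sum => i _; exact: tangent.
apply: (le_trans _ (lerD (lerD (ler_wpM2l p10 (tangent u)) (ler_wpM2l p20 avg))
  (ler_wpM2l p30 (tangent w)))).
have -> : p3 = (1 - p1 - p2)%R by lra.
rewrite -subr_ge0 [leRHS](_ : _ = 0)%R// {2 4 6}/c.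
have -> : p3 = (1 - p1 - p2)%R by lra.
ring.
Qed.

(** * Exponential moments of the particles *)

Section particle_moments.
Context {R : realType} {d m : nat} {d0 : measure_display} {Omega : measurableType d0}.
Variables (A : 'M[R]_d) (delta : R).
Variable f : vec R d -> giry (vec R d) R -> vec R m -> vec R d.
Hypothesis dim0 : (0 < d)%N.
Hypothesis mf : measurable_fun setT
  (fun p : (vec R d * giry (vec R d) R * vec R m)%type => f p.1.1 p.1.2 p.2).
Hypothesis f_eq : forall x (mu1 mu2 : giry (vec R d) R) z,
  meas_eq mu1 mu2 -> f x mu1 z = f x mu2 z.
Variables (P : probability Omega R) (theta : probability (vec R m) R).
Variables (X0 : nat -> nat -> Omega -> vec R d) (eps : nat -> nat -> Omega -> vec R m).
Hypothesis mX0 : forall N i, (i < N)%N -> measurable_fun setT (X0 N i).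
Hypothesis meps : forall n i, measurable_fun setT (eps n i).
Hypothesis iid : iid_indep_noise P theta X0 eps.
Variables M a : R.
Hypothesis M0 : (0 <= M)%R.
Hypothesis DM : {ae theta, forall z, Dlip f z <= M%:E}.
Hypothesis delta0 : (0 <= delta)%R.
Hypothesis delta_half : (delta <= 2^-1)%R.
Hypothesis a0 : (0 <= a)%R.
Hypothesis Aa : forall x, (enorm (mxact A x) <= a * enorm x)%R.
Hypothesis rho1 : (a + 2 * delta * M < 1)%R.
Variables alpha H : R.
Hypothesis alpha0 : (0 < alpha)%R.
Hypothesis H0 : (0 <= H)%R.
Hypothesis drift_moment : \int[theta]_z (expR (alpha * drift0 f z))%:E <= H%:E.
Hypothesis init_moment : forall N i, (i < N)%N ->
  \int[P]_w (expR (alpha * enorm (X0 N i w)))%:E <= H%:E.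

(** The factor after [alpha] is the weight left to the drift in the convex combination for one step;
    with this exponent a step preserves the moment bound with the same constant [H]. *)
Definition decay : R := (alpha * (1 - (a + 2 * delta * M)))%R.

Lemma decay_gt0 : (0 < decay)%R.
Proof. by rewrite mulr_gt0// subr_gt0. Qed.

Lemma decay_le : (decay <= alpha)%R.
Proof.
by rewrite /decay ler_piMr ?(ltW alpha0)// lerBlDr lerDl addr_ge0// !mulr_ge0.
Qed.

Let X N n i w := particle A delta f X0 eps N n i w.

Let mX N n i : (i < N)%N -> measurable_fun setT (X N n i).
Proof. by move=> iN; apply: measurable_particle => // j; exact: mX0. Qed.

(* A step is dominated by a convex combination of the particle's norm, the
   average norm and the drift, so Jensen suffices and independence plays no role. *)
Lemma particle_exp_moment N n i : (i < N)%N ->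
  \int[P]_w (expR (decay * enorm (X N n i w)))%:E <= H%:E.
Proof.
have mexp k j : (j < N)%N ->
    measurable_fun setT (fun w => (expR (decay * enorm (X N k j w)))%:E : \bar R).
  move=> jN; apply/measurable_EFinP/measurable_fun_expR/measurable_funM => //.
  by apply: measurable_enorm; exact: mX.
elim: n i => [|n IH] i iN.
  apply: le_trans (init_moment iN); apply: ge0_le_integral => //.
  - exact: mexp.
  - apply/measurable_EFinP/measurable_fun_expR/measurable_funM => //.
    by apply: measurable_enorm; exact: mX0.
  - move=> w _; rewrite lee_fin ler_expR ler_wpM2r ?enorm_ge0//.
    exact: decay_le.
have N0 : (0 < N)%N by exact: leq_ltn_trans iN.
pose p1 := (a + delta * M)%R; pose p2 := (delta * M)%R.
pose p3 := (1 - (a + 2 * delta * M))%R.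
have p20 : (0 <= p2)%R by rewrite mulr_ge0.
have p10 : (0 <= p1)%R by rewrite addr_ge0.
have p30 : (0 <= p3)%R by rewrite subr_ge0 ltW.
have p123 : (p1 + p2 + p3 = 1)%R by rewrite /p1 /p2 /p3; lra.
pose g w := (p1%:E * (expR (decay * enorm (X N n i w)))%:E +
  (p2 / N%:R)%:E * \sum_(j < N) (expR (decay * enorm (X N n j w)))%:E) +
  p3%:E * (expR (alpha * drift0 f (eps n i w)))%:E.
have mdrift : measurable_fun setT
    (fun z => (expR (alpha * drift0 f z))%:E : \bar R).
  apply/measurable_EFinP/measurable_fun_expR/measurable_funM => //.
  exact: measurable_drift0.
have q0 : 0 <= (p2 / N%:R)%:E by rewrite lee_fin divr_ge0.
have mg1 : measurable_fun setT
    (fun w => p1%:E * (expR (decay * enorm (X N n i w)))%:E).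
  by apply: measurable_funeM; exact: mexp.
have ms : measurable_fun setT
    (fun w => \sum_(j < N) (expR (decay * enorm (X N n j w)))%:E : \bar R).
  by apply: emeasurable_sum => j; exact: mexp.
have mg2 : measurable_fun setT (fun w =>
    (p2 / N%:R)%:E * \sum_(j < N) (expR (decay * enorm (X N n j w)))%:E).
  exact: measurable_funeM.
have me : measurable_fun setT (fun w =>
    (expR (alpha * drift0 f (eps n i w)))%:E : \bar R).
  exact: (measurableT_comp mdrift).
have mg3 : measurable_fun setT (fun w =>
    p3%:E * (expR (alpha * drift0 f (eps n i w)))%:E).
  exact: measurable_funeM.
have e0 (s : R) : 0 <= (expR s)%:E by rewrite lee_fin expR_ge0.
have s0 w : 0 <= \sum_(j < N) (expR (decay * enorm (X N n j w)))%:E.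
  by apply: sume_ge0.
have g10 w : 0 <= p1%:E * (expR (decay * enorm (X N n i w)))%:E by rewrite mule_ge0.
have g20 w : 0 <= (p2 / N%:R)%:E * \sum_(j < N) (expR (decay * enorm (X N n j w)))%:E.
  by rewrite mule_ge0.
have g30 w : 0 <= p3%:E * (expR (alpha * drift0 f (eps n i w)))%:E by rewrite mule_ge0.
apply: (@le_trans _ _ (\int[P]_w g w)).
  apply: ae_ge0_le_integral => //.
  - exact: mexp.
  - by move=> w _; rewrite adde_ge0// adde_ge0.
  - by apply: emeasurable_funD => //; exact: emeasurable_funD.
  apply: filterS (ae_noise meps iid n i DM) => w Dw _.
  rewrite /g sumEFin -!EFinM -!EFinD lee_fin -(mulrA p2).
  apply: le_trans (expR_convex_mean _ _ (fun j : 'I_N => decay * enorm (X N n j w))%R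
    N0 p10 p20 p30 p123).
  rewrite ler_expR.
  have := evol_growth dim0 f_eq M0 delta0 Aa (X N n i w) Dw
    (empirical_moment N0 (fun j => X N n j w)).
  rewrite -/(X N n.+1 i w) => /(ler_wpM2l (ltW decay_gt0)) l1.
  apply: (le_trans l1); rewrite -mulr_sumr.
  (* The drift has weight [p3] in the combination, and [decay = alpha * p3] is exactly what this
     allows. *)
  have l2 : (decay * (delta * drift0 f (eps n i w)) <=
      p3 * (alpha * drift0 f (eps n i w)))%R.
    have dD : (delta * drift0 f (eps n i w) <= drift0 f (eps n i w))%R.
      rewrite ler_piMl//; first exact: enorm_ge0.
      by apply: (le_trans delta_half); rewrite invf_le1// ler1n.
    apply: (le_trans (ler_wpM2l (ltW decay_gt0) dD)).
    by rewrite /decay -/p3 (mulrCA p3) mulrA.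
  set D := drift0 f (eps n i w) in l2 *; set S := (\sum_(j < N) _)%R.
  by rewrite /p1 /p2; lra.
rewrite /g ge0_integralD//; last 2 first.
- by move=> w _; rewrite adde_ge0.
- exact: emeasurable_funD.
rewrite ge0_integralD// !ge0_integralZl//; last exact: mexp.
rewrite ge0_integral_sum//; last by move=> j; exact: mexp.
rewrite (integral_noise meps iid n i mdrift)//.
apply: (@le_trans _ _ (p1%:E * H%:E + (p2 / N%:R)%:E * \sum_(j < N) H%:E + p3%:E * H%:E)).
  apply: leeD; last by apply: lee_wpmul2l.
  apply: leeD; first by apply: lee_wpmul2l => //; exact: IH.
  by apply: lee_wpmul2l => //; apply: lee_sum => j _; exact: IH.
rewrite sumEFin sumr_const card_ord -!EFinM -!EFinD lee_fin.
rewrite -(mulr_natl H) mulrA divfK ?pnatr_eq0 -?lt0n//.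
by rewrite -!mulrDl p123 mul1r.
Qed.

Lemma particle_tail N n i K : (i < N)%N ->
  P [set w | (K < enorm (X N n i w))%R] <= (H * expR (- (decay * K)))%:E.
Proof.
move=> iN.
have mg : measurable_fun setT (fun w => (decay * enorm (X N n i w))%R).
  by apply: measurable_funM => //; apply: measurable_enorm; exact: mX.
have -> : [set w | (K < enorm (X N n i w))%R] =
    [set w | (decay * K < decay * enorm (X N n i w))%R].
  by apply/seteqP; split => w /=; rewrite ltr_pM2l// decay_gt0.
have -> : (H * expR (- (decay * K)))%:E = (expR (- (decay * K)))%:E * H%:E.
  by rewrite -EFinM mulrC.
apply: (le_trans (chernoff P _ mg)).
by apply: lee_wpmul2l; [rewrite lee_fin expR_ge0|exact: particle_exp_moment].
Qed.

Lemma drift_tail n i K : (0 <= K)%R ->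
  P [set w | (2 * K < drift0 f (eps n i w))%R] <= (H * expR (- (decay * K)))%:E.
Proof.
move=> K0; have md : measurable_fun setT (drift0 f) by exact: measurable_drift0.
have mg : measurable_fun setT (fun w => (alpha * drift0 f (eps n i w))%R).
  by apply: measurable_funM => //; exact: (measurableT_comp md).
have -> : [set w | (2 * K < drift0 f (eps n i w))%R] =
    [set w | (alpha * (2 * K) < alpha * drift0 f (eps n i w))%R].
  by apply/seteqP; split => w /=; rewrite ltr_pM2l.
apply: (le_trans (chernoff P _ mg)).
rewrite (integral_noise meps iid n i
  (g := fun z => (expR (alpha * drift0 f z))%:E))//; last first.
  apply/measurable_EFinP/measurable_fun_expR; exact: measurable_funM.
apply: (@le_trans _ _ ((expR (- (decay * K)))%:E * H%:E)); last first.
  by rewrite -EFinM mulrC.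
apply: lee_pmul => //; rewrite ?lee_fin ?expR_ge0//.
  by apply: integral_ge0 => z _; rewrite lee_fin expR_ge0.
rewrite ler_expR lerN2.
have := ler_wpM2r K0 decay_le; have := mulr_ge0 (ltW alpha0) K0; lra.
Qed.

End particle_moments.

(** * One step of the particle system *)

Section step_probability.
Context {R : realType} {d m : nat} {d0 : measure_display} {Omega : measurableType d0}.
Variables (A : 'M[R]_d) (delta : R).
Variable f : vec R d -> giry (vec R d) R -> vec R m -> vec R d.
Hypothesis dim0 : (0 < d)%N.
Hypothesis mf : measurable_fun setT
  (fun p : (vec R d * giry (vec R d) R * vec R m)%type => f p.1.1 p.1.2 p.2).
Hypothesis f_eq : forall x (mu1 mu2 : giry (vec R d) R) z,
  meas_eq mu1 mu2 -> f x mu1 z = f x mu2 z.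
Variables (P : probability Omega R) (theta : probability (vec R m) R).
Variables (X0 : nat -> nat -> Omega -> vec R d) (eps : nat -> nat -> Omega -> vec R m).
Hypothesis mX0 : forall N i, (i < N)%N -> measurable_fun setT (X0 N i).
Hypothesis meps : forall n i, measurable_fun setT (eps n i).
Hypothesis iid : iid_indep_noise P theta X0 eps.
Variables M a : R.
Hypothesis M0 : (0 <= M)%R.
Hypothesis DM : {ae theta, forall z, Dlip f z <= M%:E}.
Hypothesis delta0 : (0 <= delta)%R.
Hypothesis delta_half : (delta <= 2^-1)%R.
Hypothesis a0 : (0 <= a)%R.
Hypothesis Aa : forall x, (enorm (mxact A x) <= a * enorm x)%R.
Hypothesis rho1 : (a + 2 * delta * M < 1)%R.
Variables alpha H : R.
Hypothesis alpha0 : (0 < alpha)%R.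
Hypothesis H0 : (0 <= H)%R.
Hypothesis drift_moment : \int[theta]_z (expR (alpha * drift0 f z))%:E <= H%:E.
Hypothesis init_moment : forall N i, (i < N)%N ->
  \int[P]_w (expR (alpha * enorm (X0 N i w)))%:E <= H%:E.

Let X N n i w := particle A delta f X0 eps N n i w.
Let E N n w := emp_particles A delta f X0 eps N n w.
Let c1 := decay delta M a alpha.

Let mstep_preimage N n i w (S : set (vec R d)) : measurable S ->
  measurable [set z | S (evol A delta f (X N n i w) (E N n w) z)].
Proof.
move=> mS; rewrite -[X in measurable X]setTI.
exact: (measurable_evol_noise A delta mf (X N n i w) (E N n w) measurableT mS).
Qed.

Lemma measurable_cells B q (S : {set option {ffun 'I_d -> 'I_q.+1}}) :
  measurable [set v : vec R d | ball_cell B q v \in S].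
Proof.
rewrite (_ : [set v | _] = \bigcup_(t in [set t | t \in S]) [set v | ball_cell B q v = t]).
  rewrite (_ : [set t | t \in S] = [set t | t \in enum S]).
    rewrite bigcup_seq; apply: bigsetU_measurable => t _.
    exact: measurable_ball_cell.
  by apply/seteqP; split => t /=; rewrite mem_enum.
by apply/seteqP; split => v /=; [exists (ball_cell B q v)|move=> [t tS /= ->]].
Qed.

(** Masses and frequencies are additive over cells, so the deficit of a union of cells is an average
    of [deviation] for the corresponding set. *)
Lemma step_discrepancy N n q (B tau : R) w : (0 < N)%N ->
  (forall S : {set option {ffun 'I_d -> 'I_q.+1}},
    (N%:R^-1 * \sum_(i < N) deviation A delta f theta X0 eps N n
       [set v | ball_cell B q v \in S] i w <= tau)%R) ->
  (\sum_t Num.max (step_mass A delta f theta N (fun i => X N n i w) B t -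
     freq (fun i : 'I_N => ball_cell B q (X N n.+1 i w)) t) 0 <= tau)%R.
Proof.
move=> N0 dev; apply: sum_excess_subset => S; apply: le_trans (dev S).
pose S' := [set v : vec R d | ball_cell B q v \in S].
have h1 : (\sum_(t in S) step_mass A delta f theta N (fun i => X N n i w) B t =
    N%:R^-1 * \sum_(i < N) hit_prob A delta f theta S' (X N n i w) (E N n w))%R.
  rewrite /step_mass -mulr_sumr exchange_big/=; congr (_ * _)%R.
  apply: eq_bigr => i _; apply/EFin_inj.
  have mU := mstep_preimage N n i w (measurable_cells B S).
  have mt t := mstep_preimage N n i w (@measurable_ball_cell R d B q t).
  rewrite /hit_prob fineK ?fin_num_measure// -sumEFin.
  rewrite [RHS](@measure_partition _ _ _ theta _
    (fun z => ball_cell B q (evol A delta f (X N n i w) (E N n w) z)))//.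
  rewrite [LHS]big_mkcond/=; apply: eq_bigr => t _.
  case: ifPn => tS.
    rewrite fineK ?fin_num_measure//; last exact: mt.
    congr (theta _); apply/seteqP; split => z /=; last by case.
    by move=> zt; split => //; rewrite /S'/= zt.
  rewrite -[LHS](measure0 theta); congr (theta _).
  by apply/seteqP; split => z //= [zS zt]; move: zS tS; rewrite /S'/= zt => ->.
have h2 : (\sum_(t in S) freq (fun i : 'I_N => ball_cell B q (X N n.+1 i w)) t =
    N%:R^-1 * \sum_(i < N) \1_S' (X N n.+1 i w) :> R)%R.
  rewrite /freq (exchange_big_dep xpredT)//= mulr_sumr; apply: eq_bigr => i _.
  rewrite indicE; have [iS|iS] := boolP (ball_cell B q (X N n.+1 i w) \in S).
    rewrite mem_set// mulr1 (bigD1 (ball_cell B q (X N n.+1 i w)))/=; last first.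
      by rewrite iS eqxx.
    rewrite big1 ?addr0// => t /andP[/andP[_ /eqP h1'] /eqP h2].
    by case: h2; rewrite h1'.
  rewrite memNset ?mulr0; last by apply/negP.
  by rewrite big1// => t /andP[tS /eqP h]; move: iS; rewrite h tS.
by rewrite sumrB h1 h2 -mulrBr -sumrB.
Qed.

(** The three terms come from the mesh, the mass missed by cells, and the mean mass outside, for a
    ball of radius [2 * K]. *)
Definition step_error (q : nat) (N : nat) (K tau : R) : R :=
  (d%:R * (2 * (2 * K) / q%:R) + 2 * (2 * K) * tau +
   2 * (2 / alpha * H * expR (- (alpha * K))))%R.

(** Particles in the ball of radius [K] and drifts below [2 * K] keep the new particles in the ball
    of radius [2 * K], which is the one cut into cells; outside [Bad] the estimate for fixed
    configurations therefore applies. *)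
Lemma step_probability N n q (K tau : R) (mu nu : probability (vec R d) R) :
  (0 < N)%N -> (0 < q)%N -> (0 < K)%R -> (0 < tau)%R ->
  finite_first_moment mu -> Psi A delta f theta mu nu ->
  exists Bad : set Omega, [/\ measurable Bad,
    P Bad <= (2 * N%:R * (H * expR (- (c1 * K))) +
      (2 ^ ((q.+1 ^ d).+1))%:R * expR (- (tau ^+ 2 / 8 * N%:R)))%:E &
    forall w, ~ Bad w -> W1 (E N n.+1 w) nu <=
      ((a + 2 * delta * sigmaD f theta) * fine (W1 (E N n w) mu) +
       step_error q N K tau)%:E].
Proof.
move=> N0 q0 K0 tau0 fmu munu.
have [Z [mZ Z0 DZ]] := DM.
pose T := option {ffun 'I_d -> 'I_q.+1}.
pose B := (2 * K)%R; have B0 : (0 < B)%R by rewrite mulr_gt0.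
pose S' (S : {set T}) := [set v : vec R d | ball_cell B q v \in S].
have mlt (g : Omega -> R) c : measurable_fun setT g -> measurable [set w | (c < g w)%R].
  move=> mg; have h : measurable_fun setT (fun w => (c < g w)%R) by exact: measurable_fun_ltr.
  by rewrite -[X in measurable X]setTI; exact: (h measurableT [set true]).
have mX k (i : 'I_N) : measurable_fun setT (X N k i).
  by apply: measurable_particle => // j; exact: mX0.
pose B1 := \big[setU/set0]_(i <- enum 'I_N) [set w | (K < enorm (X N n i w))%R].
pose B2 := \big[setU/set0]_(i <- enum 'I_N) [set w | (2 * K < drift0 f (eps n i w))%R].
(* A null event: the almost-sure bound on [Dlip] has to hold at the noises actually drawn. *)
pose B3 := \big[setU/set0]_(i <- enum 'I_N) (eps n i @^-1` Z).
pose B4 := \big[setU/set0]_(S <- enum {set T}) [set w | (tau <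
   N%:R^-1 * \sum_(i < N) deviation A delta f theta X0 eps N n (S' S) i w)%R].
have m1 (i : 'I_N) : measurable [set w | (K < enorm (X N n i w))%R].
  by apply: mlt; apply: measurable_enorm; exact: mX.
have m2 (i : 'I_N) : measurable [set w | (2 * K < drift0 f (eps n i w))%R].
  apply: mlt; apply: (measurableT_comp (measurable_drift0 mf)); exact: meps.
have m3 (i : 'I_N) : measurable (eps n i @^-1` Z).
  by rewrite -[X in measurable X]setTI; exact: meps.
have m4 S : measurable [set w | (tau <
   N%:R^-1 * \sum_(i < N) deviation A delta f theta X0 eps N n (S' S) i w)%R].
  apply: mlt; apply: measurable_funM => //; apply: measurable_sum => i.
  by apply: measurable_deviation => //; exact: measurable_cells.
have mB1 : measurable B1 by exact: bigsetU_measurable.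
have mB2 : measurable B2 by exact: bigsetU_measurable.
have mB3 : measurable B3 by exact: bigsetU_measurable.
have mB4 : measurable B4 by exact: bigsetU_measurable.
have mem (I : finType) (C : I -> set Omega) i w : C i w ->
    (\big[setU/set0]_(j <- enum I) C j) w.
  by move=> Ciw; rewrite -bigcup_seq; exists i => //=; rewrite mem_enum.
have He0 : (0 <= H * expR (- (c1 * K)))%R by rewrite mulr_ge0// expR_ge0.
have sN : size (enum 'I_N) = N by rewrite -cardE card_ord.
exists (B1 `|` B2 `|` B3 `|` B4); split.
- by apply: measurableU => //; apply: measurableU => //; exact: measurableU.
- have p1 : P B1 <= N%:R%:E * (H * expR (- (c1 * K)))%:E.
    rewrite -[in leRHS]sN; apply: measure_bigsetU_le => //.
    by move=> i; exact: (particle_tail dim0 mf f_eq mX0 meps iid M0 DM).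
  have p2 : P B2 <= N%:R%:E * (H * expR (- (c1 * K)))%:E.
    rewrite -[in leRHS]sN; apply: measure_bigsetU_le => //.
    by move=> i; apply: (drift_tail mf meps iid M0) => //; exact: ltW.
  have p3 : P B3 <= N%:R%:E * 0.
    rewrite -[in leRHS]sN; apply: measure_bigsetU_le => // i.
    by rewrite (noise_law iid)// Z0.
  have p4 : P B4 <= (2 ^ ((q.+1 ^ d).+1))%:R%:E * (expR (- (tau ^+ 2 / 8 * N%:R)))%:E.
    (* The grid cells and the outer cell [None]; each subset of them is one union. *)
    have -> : (2 ^ (q.+1 ^ d).+1 = size (enum {set T}))%N.
      by rewrite -cardE -cardsT -powersetT card_powerset cardsT card_option card_ffun !card_ord.
    apply: measure_bigsetU_le => //.
    by move=> S; apply: hoeffding_deviation => //; exact: measurable_cells.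
  apply: (@le_trans _ _ (((N%:R%:E * (H * expR (- (c1 * K)))%:E +
     N%:R%:E * (H * expR (- (c1 * K)))%:E) + N%:R%:E * 0) +
     (2 ^ ((q.+1 ^ d).+1))%:R%:E * (expR (- (tau ^+ 2 / 8 * N%:R)))%:E)).
    have mB12 : measurable (B1 `|` B2) by exact: measurableU.
    have mB123 : measurable (B1 `|` B2 `|` B3) by exact: measurableU.
    apply: (le_trans (measureU2 P mB123 mB4)); apply: leeD => //.
    apply: (le_trans (measureU2 P mB12 mB3)); apply: leeD => //.
    by apply: (le_trans (measureU2 P mB1 mB2)); exact: leeD.
  by rewrite mule0 adde0 -!EFinM -!EFinD lee_fin; lra.
move=> w nBad.
have xK i : (i < N)%N -> (enorm (X N n i w) <= K)%R.
  move=> iN; rewrite leNgt; apply/negP => h; apply: nBad; left; left; left.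
  exact: (mem _ _ (Ordinal iN)).
have zK i : (i < N)%N -> (drift0 f (eps n i w) <= 2 * K)%R.
  move=> iN; rewrite leNgt; apply/negP => h; apply: nBad; left; left; right.
  exact: (mem _ _ (Ordinal iN)).
have Dz i : (i < N)%N -> Dlip f (eps n i w) <= M%:E.
  move=> iN; apply: contrapT => h; apply: nBad; left; right.
  apply: (mem _ (fun i : 'I_N => eps n i @^-1` Z) (Ordinal iN)).
  exact: DZ.
have yB i : (i < N)%N -> (enorm (X N n.+1 i w) <= B)%R.
  move=> iN.
  by apply: (step_in_ball dim0 f_eq M0 delta0 delta_half a0 Aa (ltW rho1) N0 K0 xK iN);
    [exact: Dz|exact: zK].
have exc := @step_discrepancy N n q B tau w N0.
apply: (W1_one_step mf dim0 f_eq M0 DM delta0 a0 Aa N0 fmu munu B0 q0 yB).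
- apply: exc => S; rewrite leNgt; apply/negP => h; apply: nBad; right.
  exact: (mem _ _ S).
- move=> i iN.
  exact: (step_tail mf dim0 f_eq M0 DM delta0 delta_half a0 Aa (ltW rho1) N0 K0 xK alpha0 iN).
Qed.

End step_probability.

Local Close Scope ereal_scope.

(** * Choice of scales *)

Section rate.
Context {R : realType}.
Implicit Types (x y v B C eta eps : R).

Lemma rootn_powRE (N n : nat) : ((N%:R : R) `^ (n.+1%:R)^-1) ^+ n.+1 = N%:R.
Proof.
by rewrite -powR_mulrn ?powR_ge0// -powRrM mulVf ?pnatr_eq0// powRr1.
Qed.

(* [y] plays the role of [N^(1/(d+2))]. *)
Lemma log_rate (n : nat) C : 1 <= C -> exists2 B, 1 <= B &
  forall (N : nat) y eta, (0 < N)%N -> 0 < y -> y ^+ n = N%:R -> 0 < eta ->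
    B <= eta * y -> ln eta^-1 <= (eta * y) / B ->
    C * (1 + ln N%:R) <= eta * y.
Proof.
move=> C1; pose s := C * (1 + 3 * n%:R).
have n0 : 0 <= n%:R :> R by [].
have s1 : 1 <= s by rewrite /s; nra.
(* Then [s <= sqrt v], so [ln v = 2 * ln (sqrt v) <= 2 * (v / s)]; with the bound on [ln eta^-1]
   this gives [ln y <= 3 * (v / s)], and [s] is chosen so that the total is exactly [v]. *)
exists (s ^+ 2); first exact: exprn_ege1.
move=> N y eta N0 y0 yN eta0 Bv lnv.
set v := eta * y in Bv lnv *.
have v0 : 0 < v by rewrite mulr_gt0.
have s0 : 0 < s by rewrite (lt_le_trans _ s1).
have r0 : 0 < Num.sqrt v by rewrite sqrtr_gt0.
have rv : Num.sqrt v ^+ 2 = v by rewrite sqr_sqrtr// ltW.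
have sr : s <= Num.sqrt v.
  by rewrite -[s]ger0_norm ?(ltW s0)// -sqrtr_sqr ler_wsqrtr.
have lnv2 : ln v <= 2 * (v / s).
  rewrite -{1}rv lnXn// mulr2n.
  have h1 := ltW (ln_sublinear r0).
  have h2 : Num.sqrt v <= v / s.
    by rewrite ler_pdivlMr// -{2}rv expr2 ler_pM2l.
  lra.
have vs : 1 <= v / s.
  rewrite ler_pdivlMr// mul1r (le_trans sr)// -{2}rv expr2 ler_peMr ?(ltW r0)//.
  exact: le_trans s1 sr.
have lne : ln eta^-1 <= v / s.
  apply: (le_trans lnv); rewrite expr2 invfM mulrA ler_piMr ?divr_ge0 ?(ltW v0) ?(ltW s0)//.
  by rewrite invf_le1.
have lny : ln y <= 3 * (v / s).
  have -> : y = v * eta^-1 by rewrite /v mulrC mulKf// gt_eqF.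
  by rewrite lnM ?posrE ?invr_gt0//; lra.
rewrite -yN lnXn// -mulr_natl.
apply: (@le_trans _ _ (C * (v / s + n%:R * (3 * (v / s))))).
  rewrite ler_wpM2l ?(le_trans _ C1)// lerD//.
  by rewrite ler_wpM2l.
rewrite (_ : C * _ = v)//.
rewrite (_ : C * (v / s + n%:R * (3 * (v / s))) = s * (v / s)); last first.
  by rewrite /s; ring.
by rewrite mulrC divfK// gt_eqF.
Qed.

Let E : R := expR 1.

Let E1 : 1 <= E. Proof. by rewrite /E (le_trans _ (expR_ge1Dx _))// lerDl. Qed.

Section thresholds.
Variables (n N N0 : nat) (B y eps : R).
Hypothesis n0 : (0 < n)%N.
Hypothesis B1 : 1 <= B.
Hypothesis eps0 : 0 < eps.
Hypothesis y0 : 0 <= y.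
Hypothesis yN : y ^+ n = N%:R.
Hypothesis SN : (E ^+ 2 * B) ^+ n <= N0%:R.

Let E2 : 1 <= E ^+ 2. Proof. exact: exprn_ege1. Qed.
Let S0 : 0 <= E ^+ 2 * B. Proof. by rewrite mulr_ge0// ?sqr_ge0// (le_trans _ B1). Qed.

Let y_ge x : 0 <= x -> N0%:R * x ^+ n <= N%:R -> E ^+ 2 * B * x <= y.
Proof.
move=> x0 xN; rewrite -(@ler_pXn2r _ n)// ?nnegrE ?(mulr_ge0 S0 x0)//.
by rewrite yN exprMn (le_trans _ xN)// ler_wpM2r// exprn_ge0.
Qed.

(** The root of the threshold reads $\varepsilon y\ge e^2 B\log(1/\varepsilon)$; since the logarithm
    is at least one, both claims follow. *)
Lemma threshold_small : N0%:R * (eps^-1 * logp eps^-1) ^+ n <= N%:R ->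
  1 <= ln eps^-1 -> B <= eps * y /\ ln eps^-1 <= eps * y / B.
Proof.
move=> hN L1; have logE : logp eps^-1 = ln eps^-1.
  by rewrite /logp; apply/max_idPl; exact: le_trans L1.
rewrite logE in hN.
have /y_ge/(_ hN) hy : 0 <= eps^-1 * ln eps^-1.
  by rewrite mulr_ge0 ?invr_ge0 ?(ltW eps0)// (le_trans _ L1).
have B0 : 0 < B by exact: lt_le_trans B1.
have hv : B * ln eps^-1 <= eps * y.
  apply: (@le_trans _ _ (eps * (E ^+ 2 * B * (eps^-1 * ln eps^-1)))); last first.
    by rewrite ler_wpM2l// ltW.
  rewrite (_ : eps * _ = E ^+ 2 * (B * ln eps^-1)); last first.
    by field; rewrite gt_eqF.
  apply: ler_peMl => //; apply: mulr_ge0; [exact: ltW|exact: le_trans L1].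
split; last by rewrite ler_pdivlMr// mulrC.
by rewrite (le_trans _ hv)//; apply: ler_peMr => //; exact: ltW.
Qed.

(** When the logarithm is at most one its threshold may degenerate, and another lower bound on $N$,
    through [x], takes over. The factor $e^2$ pays for [x] being as small as $1/e$. *)
Lemma threshold_large x : 0 < x -> 1 <= x * E -> ln eps^-1 <= 1 ->
  N0%:R * x ^+ n <= N%:R -> x <= eps -> B <= eps * y /\ ln eps^-1 <= eps * y / B.
Proof.
move=> x0 xE L1 hN xeps; have hy := y_ge (ltW x0) hN.
have B0 : 0 < B by exact: lt_le_trans B1.
have Bv : B <= eps * y.
  apply: (@le_trans _ _ (x * (E ^+ 2 * B * x))).
    rewrite (_ : x * _ = (x * E) ^+ 2 * B); last by ring.
    by apply: ler_peMl; [exact: ltW|exact: exprn_ege1].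
  by apply: ler_pM => //; [exact: ltW|rewrite mulr_ge0// ltW].
by split=> //; rewrite (le_trans L1)// ler_pdivlMr// mul1r.
Qed.

End thresholds.

Let small_or_large eps : 0 < eps ->
  1 <= ln eps^-1 \/ (ln eps^-1 <= 1 /\ 1 <= eps * E).
Proof.
move=> eps0; have [|L1] := leP 1 (ln eps^-1); [by left|right].
split; first exact: ltW.
rewrite -[leLHS](divff (lt0r_neq0 eps0)) ler_wpM2l ?(ltW eps0)//.
by rewrite -(@lnK _ eps^-1) ?posrE ?invr_gt0// ler_expR ltW.
Qed.

Let N0E n B : exists N0 : nat, (E ^+ 2 * B) ^+ n <= N0%:R /\ (0 < N0)%N.
Proof.
exists (Num.truncn ((E ^+ 2 * B) ^+ n)).+1; split => //.
by apply/ltW; exact: truncnS_gt.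
Qed.

(** Taking roots, the power threshold says $\varepsilon\le y^{d-1}$, which is the last claim. It
    also replaces the logarithmic threshold when $\varepsilon$ is not small. *)
Lemma rate_dim_gt1 (d : nat) C : (1 < d)%N -> 1 <= C -> exists N0 : nat,
  forall eps (N : nat), 0 < eps ->
    N0%:R * Num.max ((eps^-1 * logp eps^-1) ^+ (d + 2))
                    (eps `^ ((d + 2)%:R / (d - 1)%:R)) <= N%:R ->
    let y := N%:R `^ ((d + 2)%:R)^-1 in
    [/\ (0 < N)%N, 1 <= y, y ^+ (d + 2) = N%:R,
       C * (1 + ln N%:R) <= eps * y & eps * y <= y ^+ d].
Proof.
move=> d1 C1; have [B B1 logB] := log_rate (d + 2) C1.
have [N0 [SN N0pos]] := N0E (d + 2) B; exists N0 => eps N eps0 hN y.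
have N0R : 1 <= N0%:R :> R by rewrite ler1n.
have hN1 : N0%:R * (eps^-1 * logp eps^-1) ^+ (d + 2) <= N%:R.
  by apply: (le_trans _ hN); rewrite ler_wpM2l// le_max lexx.
set u := eps `^ _ in hN.
have hN2 : N0%:R * u <= N%:R.
  by apply: (le_trans _ hN); rewrite ler_wpM2l// le_max lexx orbT.
have u0 : 0 < u by exact: powR_gt0.
have Npos : (0 < N)%N.
  rewrite -(ltr0n R); apply: lt_le_trans hN2; rewrite mulr_gt0//.
  exact: lt_le_trans N0R.
have N1 : 1 <= N%:R :> R by rewrite ler1n.
have yN : y ^+ (d + 2) = N%:R by rewrite /y addn2 rootn_powRE.
have y0 : 0 < y by rewrite powR_gt0// (lt_le_trans _ N1).
have y1 : 1 <= y by rewrite -(@expr_ge1 _ (d + 2)) ?addn2 ?(ltW y0)// -addn2 yN.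
have uE : u ^+ (d - 1) = eps ^+ (d + 2).
  rewrite -!powR_mulrn ?ltW// /u -powRrM divfK// pnatr_eq0.
  by rewrite -lt0n subn_gt0.
have epsy : eps <= y ^+ (d - 1).
  rewrite -(@ler_pXn2r _ (d + 2)) ?nnegrE ?addn2 ?exprn_ge0 ?(ltW eps0) ?(ltW y0)// -addn2.
  rewrite -uE exprAC yN lerXn2r ?nnegrE ?(ltW u0)//.
  by rewrite (le_trans _ hN2)// ler_peMl// ltW.
have [B_le lnB] : B <= eps * y /\ ln eps^-1 <= eps * y / B.
  have nn : (0 < d + 2)%N by rewrite addn2.
  have [|[L1 epsE]] := small_or_large eps0.
    exact: (threshold_small nn B1 eps0 (ltW y0) yN SN hN1).
  (* The comparison point is [1] for [eps >= 1], as then [u >= 1]; otherwise it is [eps] itself, as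
     [u <= 1] gives $\varepsilon^{d+2} = u^{d-1}\le u$. *)
  have [eps1|eps1] := leP 1 eps.
    apply: (threshold_large nn B1 (ltW y0) yN SN ltr01 _ L1 _ eps1).
      by rewrite mul1r.
    rewrite expr1n (le_trans _ hN2)// ler_wpM2l//.
    rewrite -(@ler_pXn2r _ (d - 1)) ?nnegrE ?subn_gt0 ?(ltW u0)//.
    by rewrite uE expr1n exprn_ege1.
  apply: (threshold_large nn B1 (ltW y0) yN SN eps0 epsE L1 _ (lexx _)).
  rewrite (le_trans _ hN2)// ler_wpM2l// -uE.
  have u1 : u <= 1.
    rewrite -(@ler_pXn2r _ (d - 1)) ?nnegrE ?subn_gt0 ?(ltW u0)// uE expr1n.
    by rewrite exprn_ile1 ?ltW.
  by rewrite -[leRHS]expr1 ler_wiXn2l ?(ltW u0)// subn_gt0.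
split => //; first exact: logB.
have -> : y ^+ d = y ^+ (d - 1) * y by rewrite -exprSr subn1 prednK// ltnW.
by rewrite ler_wpM2r// ltW.
Qed.

(** In dimension one $\varepsilon y\le y^d$ would force $\varepsilon\le 1$, hence the cap at one;
    the constant in the threshold bounds [y] from below when the logarithm degenerates. *)
Lemma rate_dim_eq1 C : 1 <= C -> exists N0 : nat,
  forall eps (N : nat), 0 < eps ->
    N0%:R * Num.max ((eps^-1 * logp eps^-1) ^+ (1 + 2)) 1 <= N%:R ->
    let y := N%:R `^ ((1 + 2)%:R)^-1 in
    [/\ (0 < N)%N, 1 <= y, y ^+ (1 + 2) = N%:R,
       C * (1 + ln N%:R) <= Num.min eps 1 * y & Num.min eps 1 * y <= y ^+ 1].
Proof.
move=> C1; have [B B1 logB] := log_rate (1 + 2) C1.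
have [N0 [SN N0pos]] := N0E (1 + 2) B; exists N0 => eps N eps0 hN y.
have N0R : 1 <= N0%:R :> R by rewrite ler1n.
have hN1 : N0%:R * (eps^-1 * logp eps^-1) ^+ (1 + 2) <= N%:R.
  by apply: (le_trans _ hN); rewrite ler_wpM2l// le_max lexx.
have hN2 : N0%:R * 1 ^+ (1 + 2) <= N%:R :> R.
  by apply: (le_trans _ hN); rewrite expr1n ler_wpM2l// le_max lexx orbT.
have Npos : (0 < N)%N.
  by rewrite -(ltr0n R) (lt_le_trans _ hN2)// expr1n mulr1 (lt_le_trans _ N0R).
have N1 : 1 <= N%:R :> R by rewrite ler1n.
have yN : y ^+ (1 + 2) = N%:R by exact: rootn_powRE.
have y0 : 0 < y by rewrite powR_gt0// (lt_le_trans _ N1).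
have y1 : 1 <= y by rewrite -(@expr_ge1 _ (1 + 2)) ?(ltW y0)// yN.
pose eta := Num.min eps 1.
have eta0 : 0 < eta by rewrite lt_min eps0 ltr01.
have eta1 : eta <= 1 by rewrite ge_min lexx orbT.
have [B_le lnB] : B <= eta * y /\ ln eta^-1 <= eta * y / B.
  have [L1|[L1 epsE]] := small_or_large eps0.
    have -> : eta = eps.
      apply/min_idPl; rewrite leNgt; apply/negP => eps1.
      have := ln_le0 (_ : eps^-1 <= 1); rewrite invf_le1// (ltW eps1) => /(_ isT).
      by move/(le_trans L1); rewrite ler10.
    exact: (threshold_small _ B1 eps0 (ltW y0) yN SN hN1).
  have etaE : 1 <= eta * E by rewrite /eta minElt; case: ifP => //; rewrite mul1r.
  have L2 : ln eta^-1 <= 1.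
    by rewrite /eta minElt; case: ifP => // _; rewrite invr1 ln1.
  apply: (threshold_large _ B1 (ltW y0) yN SN eta0 etaE L2 _ (lexx _)) => //.
  rewrite (le_trans _ hN2)// ler_wpM2l// expr1n exprn_ile1// ltW//.
split => //; first exact: logB.
by rewrite expr1 ler_piMl// ltW.
Qed.

End rate.

(** * Geometric series and the damped recursion *)

Lemma bernoulli_ineq {R : realType} (b : R) j : 0 <= b -> 1 + j%:R * b <= (1 + b) ^+ j.
Proof.
move=> b0; elim: j => [|j IH]; first by rewrite mul0r addr0 expr0.
rewrite exprS -natr1; apply: le_trans (ler_wpM2l _ IH); last by rewrite addr_ge0.
have : 0 <= j%:R * b * b by rewrite !mulr_ge0.
lra.
Qed.

(** Bernoulli's inequality makes the exponent at least [x + j * (x * b) >= x + j], and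
    [expR (-1) <= 1/2]. *)
Lemma expR_geometric {R : realType} (x b : R) j : 0 <= b -> 1 <= x * b -> 0 <= x ->
  expR (- (x * (1 + b) ^+ j)) <= expR (- x) * 2^-1 ^+ j.
Proof.
move=> b0 xb x0.
have e1 : expR (-1) <= 2^-1 :> R.
  rewrite expRN lef_pV2 ?posrE ?expR_gt0//.
  by rewrite (le_trans _ (expR_ge1Dx _)).
apply: (@le_trans _ _ (expR (- x) * expR (-1) ^+ j)).
  rewrite -expRM_natl -expRD ler_expR.
  have := ler_wpM2l x0 (bernoulli_ineq j b0).
  have : j%:R * 1 <= j%:R * (x * b) by rewrite ler_wpM2l.
  lra.
by rewrite ler_wpM2l ?expR_ge0// lerXn2r ?nnegrE ?expR_ge0.
Qed.

Lemma sum_geometric_le {R : realType} (q : R) n : 0 <= q -> q < 1 ->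
  \sum_(j < n) q ^+ j <= (1 - q)^-1.
Proof.
move=> q0 q1; rewrite -[leRHS]mul1r ler_pdivlMr ?subr_gt0//.
rewrite mulrC -opprB mulNr -subrX1 opprB lerBlDr lerDl exprn_ge0//.
Qed.

Lemma sum_half_powers {R : realType} n : \sum_(j < n) (2^-1 : R) ^+ j.+1 <= 1.
Proof.
under eq_bigr do rewrite exprS; rewrite -mulr_sumr.
apply: (le_trans (ler_wpM2l _ (sum_geometric_le n _ _))) => //; first lra.
have -> : 1 - 2^-1 = 2^-1 :> R by lra.
by rewrite divff.
Qed.

(** Unrolled backwards from [n], the error [j] steps before the last contributes at most
    $c(\chi\beta^2)^j$. *)
Lemma weighted_recursion {R : realType} (chi beta c : R) (V r : nat -> R) n :
  0 <= chi -> 0 <= beta -> chi * beta ^+ 2 < 1 -> 0 <= c ->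
  (forall k, (k < n)%N -> V k.+1 <= chi * V k + r k) ->
  (forall k, (k < n)%N -> r k <= c * (beta ^+ 2) ^+ (n - k.+1)) ->
  V n <= chi ^+ n * V 0%N + c / (1 - chi * beta ^+ 2).
Proof.
move=> chi0 beta0 q1 c0 Vr rc.
have q0 : 0 <= chi * beta ^+ 2 by rewrite mulr_ge0// sqr_ge0.
have unroll k : (k <= n)%N -> V n <= chi ^+ k * V (n - k)%N +
    c * \sum_(j < k) (chi * beta ^+ 2) ^+ j.
  elim: k => [|k IH] kn; first by rewrite big_ord0 mulr0 addr0 expr0 mul1r subn0.
  apply: (le_trans (IH (ltnW kn))).
  have nk : (n - k = (n - k.+1).+1)%N by rewrite -subSn.
  have lt : (n - k.+1 < n)%N by rewrite ltn_subrL (leq_ltn_trans _ kn).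
  rewrite nk big_ord_recr/= (mulrDr c) (addrC (c * _)) addrA lerD2r.
  apply: (le_trans (ler_wpM2l (exprn_ge0 k chi0) (Vr _ lt))).
  rewrite mulrDr mulrA -exprSr lerD2l exprMn.
  rewrite (mulrCA c) ler_wpM2l ?exprn_ge0//.
  by have := rc _ lt; rewrite subnSK// subKn// ltnW.
have := unroll n (leqnn n); rewrite subnn => /le_trans; apply.
by rewrite lerD2l ler_wpM2l// sum_geometric_le.
Qed.

Section scales.
Context {R : realType}.

(** Removes the prefactors linear in [N]: [g <= expR g], and [g + ln N <= (1 + g) * (1 + ln N)]. *)
Lemma expR_absorb (N : nat) (g C w : R) : (0 < N)%N -> 0 <= g -> 1 + g <= C ->
  C * (1 + ln N%:R) <= w -> g * N%:R <= expR w.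
Proof.
move=> N0 g0 gC hw; have N1 : 1 <= N%:R :> R by rewrite ler1n.
have L0 : 0 <= ln N%:R :> R by exact: ln_ge0.
have h : (1 + g) * (1 + ln N%:R) <= w.
  by apply: le_trans hw; rewrite ler_wpM2r// addr_ge0.
have h2 : g + ln N%:R <= w.
  apply: le_trans h; have : 0 <= g * ln N%:R by rewrite mulr_ge0.
  lra.
rewrite -[N%:R](@lnK R) ?posrE ?ltr0n//.
apply: (@le_trans _ _ (expR g * expR (ln N%:R))); last by rewrite -expRD ler_expR.
rewrite ler_wpM2r ?expR_ge0//; apply: le_trans (expR_ge1Dx g).
by rewrite lerDr.
Qed.

Lemma pow2_le_expR n : (2 ^ n)%:R <= expR n%:R :> R.
Proof.
rewrite natrX -[n%:R]mulr1 expRM_natl lerXn2r ?nnegrE ?expR_ge0//.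
by rewrite (le_trans _ (expR_ge1Dx _)).
Qed.

Section bounds.
Variables (d N q : nat) (y eta : R).
Hypothesis N0 : (0 < N)%N.
Hypothesis y1 : 1 <= y.
Hypothesis yN : y ^+ (d + 2) = N%:R.
Hypothesis eta0 : 0 < eta.
Let v := eta * y.

Let y0 : 0 < y. Proof. exact: lt_le_trans y1. Qed.

(** The product of [K] and [tau] carries $b^2$, the mesh term only [b]. The exponential tail is at
    most $\kappa/N$, and $1/N\le\eta$ because $\eta y\ge 1$ and $y\le N$. *)
Lemma step_error_le (alpha H kappa t b c C : R) : y <= q%:R ->
  0 < alpha -> 1 <= H -> 0 < kappa -> 0 <= t -> 1 <= b ->
  4 * d%:R * kappa + 4 * kappa * t + kappa <= c ->
  1 + 4 * H / (alpha * kappa) <= alpha * kappa * C -> 1 <= C ->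
  C * (1 + ln N%:R) <= v ->
  @step_error R d alpha H q N (kappa * v * b) (t * b / y) <= c * eta * b ^+ 2.
Proof.
move=> yq alpha0 H1 kappa0 t0 b1 hc hC C1 Cv.
have b0 : 0 < b by exact: lt_le_trans b1.
have bb : b <= b ^+ 2 by rewrite expr2 ler_peMr// ltW.
have v0 : 0 < v by rewrite mulr_gt0.
have ak0 : 0 < alpha * kappa by rewrite mulr_gt0.
have H0 : 0 < H by exact: lt_le_trans H1.
have L0 : 0 <= ln N%:R :> R by rewrite ln_ge0// ler1n.
have t1 : d%:R * (2 * (2 * (kappa * v * b)) / q%:R) <= 4 * d%:R * kappa * eta * b ^+ 2.
  have -> : 4 * d%:R * kappa * eta * b ^+ 2 =
      d%:R * (2 * (2 * (kappa * v * b ^+ 2)) / y).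
    by rewrite /v; field; rewrite gt_eqF.
  rewrite ler_wpM2l// ler_pM//.
  - by rewrite !mulr_ge0// ltW.
  - by rewrite !ler_pM2l// mulr_gt0.
  - by rewrite lef_pV2 ?posrE ?(lt_le_trans y0).
have t2 : 2 * (2 * (kappa * v * b)) * (t * b / y) = 4 * kappa * t * eta * b ^+ 2.
  by rewrite /v; field; rewrite gt_eqF.
have Neta : N%:R^-1 <= eta.
  have yN' : y <= N%:R by rewrite -yN addn2 exprS ler_peMr ?(ltW y0)// exprn_ege1.
  have v1 : 1 <= eta * y.
    apply: le_trans Cv; apply: (le_trans C1).
    by apply: ler_peMr; [exact: le_trans C1|rewrite lerDl].
  rewrite -[leLHS]mul1r ler_pdivrMr ?ltr0n//; apply: (le_trans v1).
  by rewrite ler_wpM2l// ltW.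
have t3 : 2 * (2 / alpha * H * expR (- (alpha * (kappa * v * b)))) <= kappa * eta * b ^+ 2.
  have h := expR_absorb N0 (ltW (divr_gt0 (mulr_gt0 (ltr0Sn _ 3) H0) ak0)) hC
    (_ : _ <= alpha * kappa * v).
  have {h} : 4 * H / (alpha * kappa) * N%:R <= expR (alpha * kappa * v).
    by apply: h; rewrite -mulrA ler_wpM2l// ltW.
  move=> h; apply: (@le_trans _ _ (4 / alpha * H * (alpha * kappa / (4 * H)) * N%:R^-1)).
    rewrite (_ : 2 * _ = 4 / alpha * H * expR (- (alpha * (kappa * v * b)))); last by ring.
    rewrite -[leRHS]mulrA ler_wpM2l ?mulr_ge0 ?invr_ge0 ?(ltW alpha0) ?(ltW H0)//.
    have -> : alpha * kappa / (4 * H) * N%:R^-1 = (4 * H / (alpha * kappa) * N%:R)^-1.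
      by rewrite [RHS]invfM invf_div.
    rewrite expRN lef_pV2 ?posrE ?expR_gt0//; last first.
      by rewrite mulr_gt0 ?ltr0n// divr_gt0// mulr_gt0.
    apply: (le_trans h); rewrite ler_expR mulrA mulrA ler_peMr//.
    by rewrite mulr_ge0 ?ltW.
  have -> : 4 / alpha * H * (alpha * kappa / (4 * H)) = kappa.
    by field; rewrite !gt_eqF.
  have b2 : 1 <= b ^+ 2 by exact: le_trans bb.
  apply: (@le_trans _ _ (kappa * eta)); first by rewrite ler_wpM2l// ltW.
  by rewrite ler_peMr// mulr_ge0 ?ltW.
rewrite /step_error t2.
have : (4 * d%:R * kappa + 4 * kappa * t + kappa) * (eta * b ^+ 2) <= c * (eta * b ^+ 2).
  by rewrite ler_wpM2r// mulr_ge0 ?exprn_ge0 ?(ltW eta0)// ltW.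
lra.
Qed.

(** The Hoeffding exponent equals $(2\cdot 3^d+1)b^2y^d$ and exceeds the entropy $(3y)^d+1$ by at
    least $b^2y^d\ge vb$. The tail spends half of its exponent on the prefactor $2HN$. Both terms
    are thus below $e^{-c_2vb}$, and half of $c_2v$ is given up for the factor [4] that fits their
    sum under $2^{-(j+1)}$. *)
Lemma step_probability_le (H c1 kappa t C c2 g b : R) j : q.+1%:R <= 3 * y ->
  1 <= H -> 0 < c1 -> 0 < kappa -> t ^+ 2 = 8 * (2 * 3 ^+ d + 1) -> 0 < g ->
  1 + 2 * H <= c1 * kappa / 2 * C ->
  0 < c2 -> c2 <= 1 -> c2 <= c1 * kappa / 2 -> 1 <= c2 * C * g -> 6 <= c2 * C ->
  C * (1 + ln N%:R) <= v -> v <= y ^+ d -> 0 <= C -> b = (1 + g) ^+ j ->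
  2 * N%:R * (H * expR (- (c1 * (kappa * v * b)))) +
  (2 ^ (q.+1 ^ d).+1)%:R * expR (- ((t * b / y) ^+ 2 / 8 * N%:R))
  <= expR (- (c2 / 2 * v)) * 2^-1 ^+ j.+1.
Proof.
move=> qy H1 c10 kappa0 t2 g0 hC c20 c21 c2k hg h6 Cv vy C0 bE.
have b1 : 1 <= b by rewrite bE exprn_ege1// lerDl ltW.
have b0 : 0 < b by exact: lt_le_trans b1.
have bb : b <= b ^+ 2 by rewrite expr2 ler_peMr// ltW.
have v0 : 0 < v by rewrite mulr_gt0.
have H0 : 0 < H by exact: lt_le_trans H1.
have L0 : 0 <= ln N%:R :> R by rewrite ln_ge0// ler1n.
have Cv' : C <= v by apply: le_trans Cv; rewrite ler_peMr// lerDl.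
have ck0 : 0 < c1 * kappa by rewrite mulr_gt0.
have p1 : 2 * N%:R * (H * expR (- (c1 * (kappa * v * b)))) <= expR (- (c2 * v * b)).
  have h := expR_absorb N0 (mulr_ge0 (ler0n _ 2) (ltW H0)) hC
    (_ : _ <= c1 * kappa / 2 * v).
  have {}h : 2 * H * N%:R <= expR (c1 * kappa / 2 * v).
    by apply: h; rewrite -mulrA ler_wpM2l// divr_ge0// ltW.
  rewrite (_ : 2 * _ * _ = 2 * H * N%:R * expR (- (c1 * (kappa * v * b)))); last by ring.
  apply: (le_trans (ler_wpM2r (expR_ge0 _) h)); rewrite -expRD ler_expR.
  have h1 : c2 * (v * b) <= c1 * kappa / 2 * (v * b) by rewrite ler_wpM2r// mulr_ge0 ?ltW.
  have h2 : c1 * kappa / 2 * v * 1 <= c1 * kappa / 2 * v * b.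
    by rewrite ler_wpM2l// mulr_ge0 ?(ltW v0)// divr_ge0// ltW.
  lra.
have p2 : (2 ^ (q.+1 ^ d).+1)%:R * expR (- ((t * b / y) ^+ 2 / 8 * N%:R))
    <= expR (- (c2 * v * b)).
  apply: (le_trans (ler_wpM2r (expR_ge0 _) (pow2_le_expR _))).
  rewrite -expRD ler_expR -natr1 natrX.
  have -> : (t * b / y) ^+ 2 / 8 * N%:R = (2 * 3 ^+ d + 1) * (b ^+ 2 * y ^+ d).
    rewrite -yN exprD !exprMn t2 exprVn; field.
    by rewrite gt_eqF.
  have yd1 : 1 <= y ^+ d by rewrite exprn_ege1.
  have td1 : 1 <= 3 ^+ d :> R by rewrite exprn_ege1// ler1n.
  have qd : (q.+1%:R : R) ^+ d <= 3 ^+ d * y ^+ d.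
    by rewrite -exprMn lerXn2r ?nnegrE// mulr_ge0// ltW.
  have one : 1 <= 3 ^+ d * y ^+ d by rewrite -[leLHS]mulr1 ler_pM.
  have b21 : 1 <= b ^+ 2 by exact: le_trans bb.
  have h3 : 2 * 3 ^+ d * y ^+ d * 1 <= 2 * 3 ^+ d * y ^+ d * b ^+ 2.
    by rewrite ler_wpM2l// !mulr_ge0 ?exprn_ge0// ltW.
  have h4 : v * b <= y ^+ d * b ^+ 2 by apply: ler_pM => //; exact: ltW.
  have h5 : c2 * (v * b) <= 1 * (v * b) by rewrite ler_wpM2r// mulr_ge0 ?ltW.
  lra.
apply: (le_trans (lerD p1 p2)).
have geo := @expR_geometric R (c2 * v) g j (ltW g0) _ (mulr_ge0 (ltW c20) (ltW v0)).
rewrite -bE in geo.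
have c2v : c2 * C <= c2 * v by rewrite ler_wpM2l// ltW.
have {}geo : expR (- (c2 * v * b)) <= expR (- (c2 * v)) * 2^-1 ^+ j.
  by apply: geo; apply: (le_trans hg); rewrite ler_wpM2r// ltW.
have e4 : 4 <= expR (c2 / 2 * v).
  by apply: le_trans (expR_ge1Dx _); lra.
have split2 : expR (- (c2 / 2 * v)) = expR (- (c2 * v)) * expR (c2 / 2 * v).
  by rewrite -expRD; congr expR; lra.
rewrite split2 exprS.
have : expR (- (c2 * v)) * 2^-1 ^+ j * 4 <= expR (- (c2 * v)) * 2^-1 ^+ j * expR (c2 / 2 * v).
  by rewrite ler_wpM2l// mulr_ge0 ?expR_ge0// exprn_ge0.
lra.
Qed.

End bounds.

(* An error made [j] steps before the end is damped by [chi ^ j], so both the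
   truncation radius and the tolerated deviation may grow like [beta ^ j] as long
   as [chi * beta ^ 2 < 1]; this makes the failure probabilities summable uniformly
   in the number of steps. *)
Lemma exists_scales (d : nat) (chi alpha H c1 : R) :
  0 <= chi -> chi < 1 -> 0 < alpha -> 1 <= H -> 0 < c1 ->
  exists C0 C1 beta c : R, [/\ 1 <= C0, 0 < C1, 0 <= beta, chi * beta ^+ 2 < 1 &
    [/\ 0 <= c, c / (1 - chi * beta ^+ 2) <= 3 / 4 &
    forall (N : nat) y eta, (0 < N)%N -> 1 <= y -> y ^+ (d + 2) = N%:R -> 0 < eta ->
      C0 * (1 + ln N%:R) <= eta * y -> eta * y <= y ^+ d ->
      exists (q : nat) (K tau : nat -> R), (0 < q)%N /\ forall j,
        [/\ 0 < K j, 0 < tau j,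
          @step_error R d alpha H q N (K j) (tau j) <= c * eta * (beta ^+ 2) ^+ j &
          2 * N%:R * (H * expR (- (c1 * K j))) +
          (2 ^ (q.+1 ^ d).+1)%:R * expR (- (tau j ^+ 2 / 8 * N%:R))
          <= expR (- (C1 * (eta * y))) * 2^-1 ^+ j.+1]]].
Proof.
move=> chi0 chi1 alpha0 H1 c10.
(* Then $\beta = 2/(1+\chi)>1$, while $\chi\beta^2 = 4\chi/(1+\chi)^2<1$ amounts to
   $(1-\chi)^2>0$. *)
pose g := (1 - chi) / (1 + chi); pose beta := 1 + g.
have g0 : 0 < g by rewrite divr_gt0 ?subr_gt0// ltr_wpDr.
have betaE : beta = 2 / (1 + chi) by rewrite /beta /g; field; rewrite gt_eqF// ltr_wpDr.
have beta1 : 1 <= beta by rewrite lerDl ltW.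
(* The accumulated error is then three quarters of the target, leaving one quarter for the initial
   term. *)
pose c := 3 / 4 * (1 - chi * beta ^+ 2).
have q1 : chi * beta ^+ 2 < 1.
  have chi10 : 0 < (1 + chi) ^+ 2 by rewrite exprn_gt0// ltr_wpDr.
  rewrite betaE expr_div_n mulrA ltr_pdivrMr// mul1r.
  have : 0 < (1 - chi) ^+ 2 by rewrite exprn_gt0// subr_gt0.
  by rewrite !expr2; lra.
have c0 : 0 < c by rewrite mulr_gt0// subr_gt0.
pose t := Num.sqrt (8 * (2 * 3 ^+ d + 1)) : R.
have t2 : t ^+ 2 = 8 * (2 * 3 ^+ d + 1).
  by rewrite sqr_sqrtr// mulr_ge0// addr_ge0// mulr_ge0// exprn_ge0.
have t0 : 0 < t by rewrite sqrtr_gt0 mulr_gt0// ltr_wpDl// mulr_ge0// exprn_ge0.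
(* With [kappa = c / D] the three parts of the step error add up to [c]. *)
pose D := 4 * d%:R + 4 * t + 1.
have D0 : 0 < D by rewrite /D ltr_wpDl// addr_ge0// mulr_ge0// ltW.
pose kappa := c / D; have kappa0 : 0 < kappa by rewrite divr_gt0.
have ck0 : 0 < c1 * kappa / 2 by rewrite divr_gt0// mulr_gt0.
pose c2 := Num.min 1 (c1 * kappa / 2).
have c20 : 0 < c2 by rewrite lt_min ltr01.
have ak0 : 0 < alpha * kappa by rewrite mulr_gt0.
have H0 : 0 < H by exact: lt_le_trans H1.
(* Lower bounds on [C]: [A1] for the tail in the step error, [A2] for the prefactor [2 * H * N],
   [A3] for the geometric decay in [j], [A4] for the factor four. *)
pose A1 := (1 + 4 * H / (alpha * kappa)) / (alpha * kappa).
pose A2 := (1 + 2 * H) / (c1 * kappa / 2).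
pose A3 := (c2 * g)^-1.
pose A4 := 6 / c2.
have A10 : 0 <= A1.
  by rewrite divr_ge0 ?(ltW ak0)// addr_ge0// divr_ge0 ?(ltW ak0)// mulr_ge0// ltW.
have A20 : 0 <= A2 by rewrite divr_ge0 ?(ltW ck0)// addr_ge0// mulr_ge0// ltW.
have A30 : 0 <= A3 by rewrite invr_ge0 mulr_ge0 ?ltW.
have A40 : 0 <= A4 by rewrite divr_ge0// ltW.
pose C := 1 + A1 + A2 + A3 + A4.
have C1 : 1 <= C by rewrite /C; lra.
exists C, (c2 / 2), beta, c; split => //; [by rewrite divr_gt0|exact: le_trans beta1|].
split; first exact: ltW.
  by rewrite /c mulfK// gt_eqF// subr_gt0.
move=> N y eta N0 y1 yN eta0 Cv vy.
have y0 : 0 < y by exact: lt_le_trans y1.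
have v0 : 0 < eta * y by rewrite mulr_gt0.
(* Both [y <= q] and [q.+1 <= y + 2 <= 3 * y] are needed: the first for the mesh, the second for the
   number of cells. *)
pose q := (Num.truncn y).+1.
have yq : y <= q%:R by apply: ltW; exact: truncnS_gt.
have qy : q.+1%:R <= 3 * y.
  rewrite /q -!natr1; have : (Num.truncn y)%:R <= y by rewrite truncn_le ltW.
  lra.
exists q, (fun j => kappa * (eta * y) * beta ^+ j), (fun j => t * beta ^+ j / y).
split => // j; have bj : 1 <= beta ^+ j by rewrite exprn_ege1.
have bj0 : 0 < beta ^+ j by exact: lt_le_trans bj.
have ge_C x z : 0 < x -> z / x <= C -> z <= x * C by move=> x0; rewrite ler_pdivrMr// mulrC.
split.
- exact: mulr_gt0 (mulr_gt0 kappa0 v0) bj0.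
- by rewrite divr_gt0// mulr_gt0.
- rewrite -exprM mulnC exprM; apply: (@step_error_le d N q y eta N0 y1 yN eta0 alpha H kappa t (beta ^+ j) c C) => //.
    exact: ltW.
    have -> : c = kappa * D by rewrite /kappa divfK// gt_eqF.
    by rewrite /D; lra.
  by apply: ge_C => //; rewrite -/A1 /C; lra.
- apply: (@step_probability_le d N q y eta N0 y1 yN eta0 H c1 kappa t C c2 g (beta ^+ j) j) => //.
  + by apply: ge_C => //; rewrite -/A2 /C; lra.
  + by rewrite ge_min lexx.
  + by rewrite ge_min lexx orbT.
  + rewrite mulrAC; apply: ge_C; first by rewrite mulr_gt0.
    by rewrite mul1r -/A3 /C; lra.
  + by apply: ge_C => //; rewrite -/A4 /C; lra.
  + exact: le_trans C1.
Qed.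

End scales.

Local Open Scope ereal_scope.
(** * Propagation in time *)

Lemma exp_moment_lty d (T : measurableType d) {R : realType}
    (m : {measure set T -> \bar R}) (g : T -> R) (alpha : R) :
  measurable_fun setT g -> (forall x, 0 <= g x)%R -> (0 < alpha)%R ->
  \int[m]_x (expR (alpha * g x))%:E < +oo -> \int[m]_x (g x)%:E < +oo.
Proof.
move=> mg g0 alpha0 fin.
have me : measurable_fun setT (fun x => expR (alpha * g x)).
  by apply: measurable_fun_expR; apply: measurable_funM.
apply: (@le_lt_trans _ _ (\int[m]_x ((alpha^-1)%:E * (expR (alpha * g x))%:E))).
  apply: ge0_le_integral => //.
  - by move=> x _; rewrite lee_fin.
  - exact/measurable_EFinP.
  - by apply/measurable_EFinP; exact: measurable_funM.
  - move=> x _; rewrite -EFinM lee_fin ler_pdivlMl//.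
    by apply: le_trans (expR_ge1Dx _); rewrite lerDr.
rewrite ge0_integralZl_EFin//.
- by rewrite lte_mul_pinfty// lee_fin invr_ge0 ltW.
- exact/measurable_EFinP.
- by rewrite invr_ge0 ltW.
Qed.

(** In the application this is $\chi + 2\sigma\gamma_0<1$. For [s = 0] the threshold [a0] is
    infinite and only [omega > 0] is left to use. *)
Lemma a0_bound {R : realType} (omega s gamma delta : R) : (0 <= s)%R ->
  (0 < omega)%R -> (0 <= delta)%R ->
  gamma%:E < a0 omega s -> delta%:E < a0 omega s - gamma%:E ->
  (2 * s * (delta + gamma) < 1 - expR (- omega))%R.
Proof.
move=> s0 omega0 delta0; rewrite /a0; case: eqVneq => [->|sN0] _.
  by rewrite mulr0 mul0r subr_gt0 expR_lt1 oppr_lt0.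
have {}s0 : (0 < s)%R by rewrite lt_neqAle eq_sym sN0.
rewrite -EFinB lte_fin ltrBrDr ltr_pdivlMr ?mulr_gt0//.
by rewrite mulrC.
Qed.

Section deviation.
Context {R : realType} {d m : nat} {d0 : measure_display} {Omega : measurableType d0}.
Variables (A : 'M[R]_d) (delta : R).
Variable f : vec R d -> giry (vec R d) R -> vec R m -> vec R d.
Hypothesis dim0 : (0 < d)%N.
Hypothesis mf : measurable_fun setT
  (fun p : (vec R d * giry (vec R d) R * vec R m)%type => f p.1.1 p.1.2 p.2).
Hypothesis f_eq : forall x (mu1 mu2 : giry (vec R d) R) z,
  meas_eq mu1 mu2 -> f x mu1 z = f x mu2 z.
Variables (P : probability Omega R) (theta : probability (vec R m) R).
Variables (X0 : nat -> nat -> Omega -> vec R d) (eps : nat -> nat -> Omega -> vec R m).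
Hypothesis mX0 : forall N i, (i < N)%N -> measurable_fun setT (X0 N i).
Hypothesis meps : forall n i, measurable_fun setT (eps n i).
Hypothesis iid : iid_indep_noise P theta X0 eps.
Variables M a : R.
Hypothesis M0 : (0 <= M)%R.
Hypothesis DM : {ae theta, forall z, Dlip f z <= M%:E}.
Hypothesis delta0 : (0 <= delta)%R.
Hypothesis delta_half : (delta <= 2^-1)%R.
Hypothesis a0 : (0 <= a)%R.
Hypothesis Aa : forall x, (enorm (mxact A x) <= a * enorm x)%R.
Hypothesis rho1 : (a + 2 * delta * M < 1)%R.
Variables alpha H : R.
Hypothesis alpha0 : (0 < alpha)%R.
Hypothesis H1 : (1 <= H)%R.
Hypothesis drift_moment : \int[theta]_z (expR (alpha * drift0 f z))%:E <= H%:E.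
Hypothesis init_moment : forall N i, (i < N)%N ->
  \int[P]_w (expR (alpha * enorm (X0 N i w)))%:E <= H%:E.
Variable mu : nat -> probability (vec R d) R.
Hypothesis fmu0 : finite_first_moment (mu 0%N).
Hypothesis evolution : nonlinear_evolution A delta f theta mu.

Let E N n w := emp_particles A delta f X0 eps N n w.
Let V N n w := fine (W1 (E N n w) (mu n)).
Let chi := (a + 2 * delta * sigmaD f theta)%R.

Lemma evolution_finite_first_moment n : finite_first_moment (mu n).
Proof.
elim: n => // n IH.
apply: (Psi_finite_first_moment mf dim0 f_eq M0 DM delta0 a0 Aa _ IH (@evolution n)).
apply: (exp_moment_lty (alpha := alpha)) => //.
- exact: measurable_drift0.
- by move=> z; exact: enorm_ge0.
- by apply: (le_lt_trans drift_moment); exact: ltry.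
Qed.

(** Step [k] receives the scales of level [n - k.+1], its distance to the final step. The event
    [Bad] thus depends on [n], but the levels are always $0,\dots,n-1$, so its probability is
    bounded uniformly in [n]. *)
Lemma deviation_bound : exists C0 C1 : R, [/\ (1 <= C0)%R, (0 < C1)%R &
  forall N (y eta : R), (0 < N)%N -> (1 <= y)%R -> (y ^+ (d + 2) = N%:R)%R -> (0 < eta)%R ->
    (C0 * (1 + ln N%:R) <= eta * y)%R -> (eta * y <= y ^+ d)%R ->
  forall n, exists Bad : set Omega, [/\ measurable Bad,
    P Bad <= (expR (- (C1 * (eta * y))))%:E &
    forall w, ~ Bad w -> (V N n w <= chi ^+ n * V N 0%N w + 3 / 4 * eta)%R]].
Proof.
have sig0 : (0 <= sigmaD f theta)%R by exact: sigmaD_ge0 DM.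
have sigM : (sigmaD f theta <= M)%R by exact: sigmaD_le.
have chi0 : (0 <= chi)%R by rewrite addr_ge0// !mulr_ge0.
have chi1 : (chi < 1)%R.
  by apply: le_lt_trans rho1; rewrite lerD2l ler_wpM2l// mulr_ge0.
have [C0 [C1 [beta [c [C01 C10 beta0 q1 [c0 c34 scales]]]]]] :=
  exists_scales d chi0 chi1 alpha0 H1 (decay_gt0 rho1 alpha0).
have q2 : (0 < 1 - chi * beta ^+ 2)%R by rewrite subr_gt0.
exists C0, C1; split => // N y eta N0 y1 yN eta0 Cv vy n.
have [q [K [tau [q0 KT]]]] := scales N y eta N0 y1 yN eta0 Cv vy.
have step k : exists Bad : set Omega, [/\ measurable Bad,
    P Bad <= (expR (- (C1 * (eta * y))) * 2^-1 ^+ (n - k.+1).+1)%:E &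
    forall w, ~ Bad w -> (V N k.+1 w <= chi * V N k w +
      @step_error R d alpha H q N (K (n - k.+1)%N) (tau (n - k.+1)%N))%R].
  have [K0 tau0 _ pr] := KT (n - k.+1)%N.
  have [Bad [mBad PBad stepw]] := step_probability dim0 mf f_eq mX0 meps iid
    M0 DM delta0 delta_half a0 Aa rho1 alpha0 (le_trans ler01 H1) drift_moment
    init_moment k N0 q0 K0 tau0 (evolution_finite_first_moment k) (@evolution k).
  exists Bad; split => //; first by apply: (le_trans PBad); rewrite lee_fin.
  move=> w /stepw; suff <- : (V N k.+1 w)%:E = W1 (E N k.+1 w) (mu k.+1) by rewrite lee_fin.
  apply: W1_fineK; first exact: empirical_finite_first_moment.
  exact: evolution_finite_first_moment.
have [Bad HB] := choice step.
exists (\big[setU/set0]_(k < n) Bad k); split.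
- by apply: bigsetU_measurable => k _; have [] := HB k.
- apply: (le_trans (Boole_inequality P _)) => [k|]; first by have [] := HB k.
  apply: (@le_trans _ _ (\sum_(k < n)
      (expR (- (C1 * (eta * y))) * 2^-1 ^+ (n - k.+1).+1)%:E)).
    by apply: lee_sum => k _; have [] := HB k.
  rewrite sumEFin lee_fin -mulr_sumr (reindex_inj rev_ord_inj)/=.
  rewrite -[leRHS]mulr1 ler_wpM2l ?expR_ge0//.
  apply: le_trans (sum_half_powers n); apply: ler_sum => k _.
  by rewrite subnSK ?subKn// ltn_subrL (leq_ltn_trans _ (ltn_ord k)).
move=> w nBad; apply: (le_trans (@weighted_recursion _ chi beta (c * eta)
    (V N ^~ w) (fun k => @step_error R d alpha H q N (K (n - k.+1)%N) (tau (n - k.+1)%N))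
    n chi0 beta0 q1 _ _ _)).
- by rewrite mulr_ge0// ltW.
- move=> k kn; have [_ _] := HB k; apply=> Bk; apply: nBad.
  by rewrite -bigcup_mkord; exists k.
- by move=> k kn; have [] := KT (n - k.+1)%N.
- by rewrite lerD2l mulrAC ler_wpM2r// ltW.
Qed.

Section comparison.
Variables s vartheta : R.
Hypothesis s0 : (0 <= s)%R.
Hypothesis s1 : (s < 1)%R.
Hypothesis vartheta_chi : (vartheta * chi = 1 - s)%R.

Lemma deviation_probability N n (e eta y C1 : R) : (0 < N)%N -> (0 < e)%R ->
  (eta <= e)%R ->
  (forall n, exists Bad : set Omega, [/\ measurable Bad,
    P Bad <= (expR (- (C1 * (eta * y))))%:E &
    forall w, ~ Bad w -> (V N n w <= chi ^+ n * V N 0%N w + 3 / 4 * eta)%R]) ->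
  P [set w | e%:E < W1 (E N n w) (mu n)] <=
  P [set w | (s * vartheta ^+ n * e)%:E < W1 (E N 0%N w) (mu 0%N)] +
    (expR (- (C1 * eta * y)))%:E.
Proof.
move=> N0 e0 etae dev.
have mE k (c : R) : measurable [set w | c%:E < W1 (E N k w) (mu k)].
  apply: measurable_W1_empirical => //; first exact: evolution_finite_first_moment.
  by move=> i iN; apply: measurable_particle => // j; exact: mX0.
(* At time zero $s(1-s)^0$ need not be below a quarter; there both events concern the same distance
   and [s < 1] gives inclusion. *)
case: n => [|n].
  rewrite expr0 mulr1; apply: (@le_trans _ _ (P [set w | (s * e)%:E < W1 (E N 0%N w) (mu 0%N)])).
    apply: le_measure; rewrite ?inE//; try exact: mE.
    by move=> w /=; apply: le_lt_trans; rewrite lee_fin ler_piMl// ltW.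
  by rewrite leeDl// lee_fin expR_ge0.
have [Bad [mBad PBad VB]] := dev n.+1.
set G := [set w | _ < W1 (E N 0%N w) _].
have mG : measurable G by exact: mE.
apply: (@le_trans _ _ (P (G `|` Bad))).
  apply: le_measure; rewrite ?inE; [exact: mE|exact: measurableU|].
  move=> w We; have {}We : e%:E < W1 (E N n.+1 w) (mu n.+1) by exact: We.
  apply: contrapT => /not_orP[nG nB].
  have := VB _ nB.
  have WK k : (V N k w)%:E = W1 (E N k w) (mu k).
    apply: W1_fineK; first exact: empirical_finite_first_moment.
    exact: evolution_finite_first_moment.
  move: We; rewrite -WK lte_fin => We.
  move/negP: nG; rewrite -leNgt -WK lee_fin => V0.
  have chi0 : (0 <= chi)%R.
    by rewrite addr_ge0// !mulr_ge0//; exact: sigmaD_ge0 DM.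
  have h1 : (chi ^+ n.+1 * V N 0%N w <= s * (1 - s) ^+ n.+1 * e)%R.
    apply: (le_trans (ler_wpM2l (exprn_ge0 _ chi0) V0)).
    by rewrite -vartheta_chi exprMn; lra.
  have h2 : ((1 - s) ^+ n.+1 <= 1 - s)%R.
    by rewrite exprS ler_piMr ?subr_ge0 ?(ltW s1)// exprn_ile1 ?subr_ge0 ?(ltW s1)// lerBlDr lerDl.
  have h3 : (s * (1 - s) ^+ n.+1 <= 4^-1)%R.
    apply: (@le_trans _ _ (s * (1 - s))%R); first by rewrite ler_wpM2l.
    have : (0 <= (s - 2^-1) ^+ 2)%R by exact: sqr_ge0.
    by rewrite expr2; lra.
  have h4 : (s * (1 - s) ^+ n.+1 * e <= 4^-1 * e)%R by rewrite ler_wpM2r// ltW.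
  move=> h; have : (V N n.+1 w <= e)%R by lra.
  by rewrite leNgt We.
by apply: (le_trans (measureU2 P mG mBad)); rewrite leeD2l// -mulrA.
Qed.

End comparison.

End deviation.

Local Close Scope ereal_scope.

Theorem theorem3p8
  (R : realType) (d m : nat) (A : 'M[R]_d) (delta : R)
  (theta : probability (vec R m) R)
  (f : vec R d -> giry (vec R d) R -> vec R m -> vec R d)
  (d0 : measure_display) (Omega : measurableType d0) (P : probability Omega R)
  (X0 : nat -> nat -> Omega -> vec R d) (eps : nat -> nat -> Omega -> vec R m)
  (mu : nat -> probability (vec R d) R)
  (omega M gamma0 : R) :
  (0 < d)%N -> (0 < m)%N ->
  (* f is measurable on R^d x P(R^d) x R^m and depends on mu only through
     its values on Borel sets *)
  measurable_fun setT (fun p : (vec R d * giry (vec R d) R * vec R m)%type =>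
                         f p.1.1 p.1.2 p.2) ->
  (forall x (mu1 mu2 : giry (vec R d) R) z,
      meas_eq mu1 mu2 -> f x mu1 z = f x mu2 z) ->
  (* particle system *)
  (forall N i, (i < N)%N -> measurable_fun setT (X0 N i)) ->
  (forall n i, measurable_fun setT (eps n i)) ->
  exchangeable_init P X0 ->
  (forall N i (S : set (vec R d)), (i < N)%N -> measurable S ->
      P [set w | S (X0 N i w)] = mu 0%N S) ->
  iid_indep_noise P theta X0 eps ->
  (* nonlinear evolution mu_{n+1} = Psi(mu_n) *)
  nonlinear_evolution A delta f theta mu ->
  (* (A3) *)
  0 < omega ->
  (forall x : vec R d, enorm (mxact A x) <= expR (- omega) * enorm x) ->
  (* (A6) *)
  1 < M ->
  {ae theta, forall z, (Dlip f z <= M%:E)%E} ->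
  (exists alpha : R, 0 < alpha /\
     (\int[mu 0%N]_x (expR (alpha * enorm x))%:E < +oo)%E /\
     (\int[theta]_z (expR (alpha * enorm (f (vzero R d) (\d_(vzero R d) : probability _ R) z)))%:E
        < +oo)%E) ->
  (* gamma0 in (0, a0) and delta in [0, min{a0 - gamma0, (1-e^{-omega})/(2M)}) *)
  0 < gamma0 -> (gamma0%:E < a0 omega (sigmaD f theta))%E ->
  0 <= delta -> (delta%:E < a0 omega (sigmaD f theta) - gamma0%:E)%E ->
  delta < (1 - expR (- omega)) / (2 * M) ->
  let sigma := sigmaD f theta in
  let vartheta := (1 - 2 * sigma * gamma0) / (expR (- omega) + 2 * delta * sigma) in
  exists (N0 : nat) (C1 : R), 0 < C1 /\
    forall eps0 : R, 0 < eps0 ->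
    forall n N : nat,
      let muN := emp_particles A delta f X0 eps N n in
      let mu0N := emp_particles A delta f X0 eps N 0 in
      ((1 < d)%N ->
        N0%:R * Num.max ((eps0^-1 * logp (eps0^-1)) ^+ (d + 2))
                        (eps0 `^ ((d + 2)%:R / (d - 1)%:R)) <= N%:R ->
        (P [set w | (eps0%:E < W1 (muN w) (mu n))%E] <=
         P [set w | ((2 * sigma * gamma0 * vartheta ^+ n * eps0)%:E
                       < W1 (mu0N w) (mu 0%N))%E]
         + (expR (- (C1 * eps0 * N%:R `^ ((d + 2)%:R)^-1)))%:E)%E) /\
      (d = 1%N ->
        N0%:R * Num.max ((eps0^-1 * logp (eps0^-1)) ^+ (d + 2)) 1 <= N%:R ->
        (P [set w | (eps0%:E < W1 (muN w) (mu n))%E] <=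
         P [set w | ((2 * sigma * gamma0 * vartheta ^+ n * eps0)%:E
                       < W1 (mu0N w) (mu 0%N))%E]
         + (expR (- (C1 * Num.min eps0 1 * N%:R `^ ((d + 2)%:R)^-1)))%:E)%E).
Proof.
move=> dim0 _ mf f_eq mX0 meps _ X0law iid evolution omega0 Aa M1 DM
  [alpha [alpha0 [mu0_exp drift_exp]]] gamma00 gamma_a0 delta0 delta_a0 delta_M sigma vartheta.
set e := expR (- omega) in Aa delta_M vartheta *.
have e0 : 0 < e by exact: expR_gt0.
have M0 : 0 <= M by exact: le_trans ler01 (ltW M1).
have delta2 : delta * (2 * M) < 1 - e.
  by rewrite -ltr_pdivlMr// mulr_gt0// (lt_trans ltr01).
have rho1 : e + 2 * delta * M < 1 by lra.
(* Uses [M > 1]: [2 * delta <= 2 * delta * M < 1]. *)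
have delta_half : delta <= 2^-1.
  have : delta * 2 <= delta * (2 * M) by rewrite ler_wpM2l// ler_peMr// ltW.
  lra.
have sigma0 : 0 <= sigma by exact: sigmaD_ge0 DM.
(* This is [chi + s < 1] for the [chi] and [s] introduced next; it yields [s < 1]. *)
have gap : 2 * sigma * (delta + gamma0) < 1 - e by exact: a0_bound delta_a0.
pose chi := e + 2 * delta * sigma; pose s := 2 * sigma * gamma0.
have sd0 : 0 <= 2 * delta * sigma by rewrite !mulr_ge0.
have chi0 : 0 < chi by rewrite /chi; lra.
have s0 : 0 <= s by rewrite !mulr_ge0// ltW.
have s1 : s < 1 by rewrite /s; lra.
have vartheta_chi : vartheta * chi = 1 - s by rewrite divfK// gt_eqF.
have drift_exp' : (\int[theta]_z (expR (alpha * drift0 f z))%:E < +oo)%E by exact: drift_exp.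
pose I0 := (\int[mu 0%N]_x (expR (alpha * enorm x))%:E)%E.
pose I1 := (\int[theta]_z (expR (alpha * drift0 f z))%:E)%E.
have I00 : (0 <= I0)%E by apply: integral_ge0 => x _; rewrite lee_fin expR_ge0.
have I10 : (0 <= I1)%E by apply: integral_ge0 => x _; rewrite lee_fin expR_ge0.
have I0K : (fine I0)%:E = I0 by rewrite fineK// ge0_fin_numE.
have I1K : (fine I1)%:E = I1 by rewrite fineK// ge0_fin_numE.
(* One constant for both exponential moments; the summand one provides [1 <= H]. *)
pose H := 1 + fine I0 + fine I1.
have f0 : 0 <= fine I0 by exact: fine_ge0.
have f1 : 0 <= fine I1 by exact: fine_ge0.
have H1 : 1 <= H by rewrite /H; lra.
have drift_moment : (\int[theta]_z (expR (alpha * drift0 f z))%:E <= H%:E)%E.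
  by rewrite -/I1 -I1K lee_fin /H; lra.
have m_exp : measurable_fun setT (fun x : vec R d => expR (alpha * enorm x)).
  by apply: measurable_fun_expR; apply: measurable_funM => //; exact: measurable_enorm.
have init_moment N i : (i < N)%N ->
    (\int[P]_w (expR (alpha * enorm (X0 N i w)))%:E <= H%:E)%E.
  move=> iN; rewrite -(integral_law (mX0 N i iN) P (g := fun x => (expR (alpha * enorm x))%:E)).
  - rewrite (eq_measure_integral (mu 0%N)) -/I0; last first.
      by move=> S mS _; exact: X0law.
    by rewrite -I0K lee_fin /H; lra.
  - exact/measurable_EFinP.
  - by move=> x; rewrite lee_fin expR_ge0.
have fmu0 : finite_first_moment (mu 0%N).
  apply: (exp_moment_lty (alpha := alpha)) => //; last by move=> x; exact: enorm_ge0.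
  exact: measurable_enorm.
have [C0 [C1 [C01 C10 dev]]] := deviation_bound dim0 mf f_eq mX0 meps iid M0 DM delta0
  delta_half (ltW e0) Aa rho1 alpha0 H1 drift_moment init_moment fmu0 evolution.
(* Applied with [eta = eps0] for [d > 1] and with [eta = min eps0 1] for [d = 1]. *)
have final n N eps0 eta (y : R) := @deviation_probability R d m d0 Omega A delta f dim0 mf f_eq P theta X0 eps
  mX0 meps M e M0 DM delta0 (ltW e0) Aa alpha H alpha0 drift_moment mu fmu0 evolution s vartheta s0 s1
  vartheta_chi N n eps0 eta y C1.
have [d1|] := ltnP 1 d.
  have [N0 rate] := rate_dim_gt1 d1 C01.
  exists N0, C1; split => // eps0 eps00 n N muN mu0N; split; last by move=> dE; rewrite dE in d1.
  move=> _ hN; have [N1 y1 yN Cv vy] := rate eps0 N eps00 hN.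
  apply: final => //; exact: dev.
rewrite leq_eqVlt ltnNge dim0 orbF => /eqP dE.
have [N0 rate] := rate_dim_eq1 C01.
exists N0, C1; split => // eps0 eps00 n N muN mu0N; split => //.
move=> _ hN; rewrite dE in hN; have [N1 y1 yN Cv vy] := rate eps0 N eps00 hN.
have eta0 : 0 < Num.min eps0 1 by rewrite lt_min eps00 ltr01.
apply: final => //; first by rewrite ge_min lexx.
by apply: dev => //; rewrite dE.
Qed.
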